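(* Let $a \geq 0$. Then in the connection formula $N_{W}(a,x)=c_{0}^{+}(a)W(a,x)+c_{0}^{-}(a)W(a,-x)-\hat{N}_{W}(a,x)$ we have \[ c_{0}^{+}(a)=W(a,0)\left[\sqrt {\pi} e^{\pi a/2}\left\{1+\left(1+e^{-2\pi a}\right)^{-1/2}\right\}-4Y(a)\left\{W'(a,0)\right\}^{2}\right], \] \[ c_{0}^{-}(a)=-W(a,0) \left[4Y(a)\left\{W'(a,0)\right\}^{2}+ \sqrt {\pi} e^{-3\pi a/2}\left\{1+e^{-2\pi a}+\left(1+e^{-2\pi a}\right)^{1/2}\right\}^{-1}\right], \] and \[ c_{0}^{\pm}(-a)=W(a,0)\left[4Y(a)\left\{W'(a,0)\right\}^{2}\pm \sqrt {\pi} e^{-\pi a/2}\left\{1 \pm \left(1+e^{2\pi a}\right)^{-1/2}\right\}\right], \] where \[ W\left(a,0\right)=2^{-3/4}\left|\frac{\Gamma\left(\tfrac{1}{4}+\tfrac{1}{2}ia\right)}{\Gamma\left(\tfrac{3}{4}+\tfrac{1}{2}ia\right)}\right|^{1/2},\quad W'\left(a,0\right)=-2^{-1/4}\left|\frac{\Gamma\left(\tfrac{3}{4}+\tfrac{1}{2}ia\right)}{\Gamma\left(\tfrac{1}{4}+\tfrac{1}{2}ia\right)}\right|^{1/2}, \] \[ Y(a)= \Im\left\{ (1-2ia)^{-1}F\left(\tfrac{1}{2}, 1;\tfrac{5}{4}-\tfrac{1}{2}ia;\tfrac{1}{2}\right)\right\}, \] and $F$ is the (unscaled) Gauss hypergeometric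 function, given by the rapidly converging series $F(a,b;c;z)=\Gamma(c)\sum_{s\ge0}\frac{(a)_s(b)_s z^s}{\Gamma(c+s)s!}$.
   Context: $a$ is real; $W(a,\pm x)$ are the Weber parabolic cylinder functions (DLMF Sect. 12.14), solutions of $y''+(\tfrac14 x^2-a)y=0$. $N_{W}(a,x)=W(a,x) \int_{0}^x W(a,-t)dt-W(a,-x)\int_{0}^x W(a,t)dt$ (Nield-Kuznetsov function of the first kind) and $\hat{N}_{W}(a,x)=W(a,x)\int_{x}^{\infty} W(a,-t)dt-W(a,-x) \int_{x}^{\infty} W(a,t)dt$ (complementary Nield-Kuznetsov function). The connection coefficients are $c_{0}^{\pm}(a)=\mp \hat{N}_{W}'(a,0)W(a,0) - \hat{N}_{W}(a,0)W'(a,0)$. *)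

(* Defs.v *)
From Stdlib Require Import Reals Arith Factorial.
From Coquelicot Require Import Coquelicot.
Open Scope R_scope.

Fixpoint Cpoch (z : C) (n : nat) : C :=
  match n with
  | O => RtoC 1
  | S m => Cmult (Cpoch z m) (Cplus z (RtoC (INR m)))
  end.

Definition CSeries (u : nat -> C) : C :=
  (Series (fun n => Re (u n)), Series (fun n => Im (u n))).

Definition CLim_seq (u : nat -> C) : C :=
  (real (Lim_seq (fun n => Re (u n))), real (Lim_seq (fun n => Im (u n)))).

(* x^z = exp(z ln x) for real x > 0 and complex z. *)
Definition Rcpow (x : R) (z : C) : C :=
  (Rpower x (Re z) * cos (Im z * ln x), Rpower x (Re z) * sin (Im z * ln x)).

(* Complex Gamma function via the Euler--Gauss limit
   Gamma(z) = lim_n n! n^z / (z (z+1) ... (z+n)),  z not in {0,-1,-2,...}. *)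
Definition CGamma (z : C) : C :=
  CLim_seq (fun n =>
    Cdiv (Cmult (RtoC (INR (fact n))) (Rcpow (INR n) z)) (Cpoch z (S n))).

(* Gauss hypergeometric function F(a,b;c;z) = sum_s (a)_s (b)_s z^s / ((c)_s s!)
   (i.e. Gamma(c) sum_s (a)_s (b)_s z^s / (Gamma(c+s) s!), since
   Gamma(c)/Gamma(c+s) = 1/(c)_s). *)
Definition hyp2F1 (a b c z : C) : C :=
  CSeries (fun s => Cdiv (Cmult (Cmult (Cpoch a s) (Cpoch b s)) (Cpow z s))
                         (Cmult (Cpoch c s) (RtoC (INR (fact s))))).

Definition W0 (a : R) : R :=
  Rpower 2 (-3/4) *
  sqrt (Cmod (Cdiv (CGamma (RtoC (1/4) + Ci * RtoC (a/2))%C)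
                   (CGamma (RtoC (3/4) + Ci * RtoC (a/2))%C))).

Definition W0' (a : R) : R :=
  - Rpower 2 (-1/4) *
  sqrt (Cmod (Cdiv (CGamma (RtoC (3/4) + Ci * RtoC (a/2))%C)
                   (CGamma (RtoC (1/4) + Ci * RtoC (a/2))%C))).

(* W(a,.) (for every real a) is the solution of y'' + (x^2/4 - a) y = 0
   with the initial values W0 a, W0' a (this determines it uniquely). *)
Definition is_Weber_W (W : R -> R -> R) : Prop :=
  (forall a x, ex_derive (W a) x) /\
  (forall a x, is_derive (Derive (W a)) x ((a - x ^ 2 / 4) * W a x)) /\
  (forall a, W a 0 = W0 a) /\
  (forall a, Derive (W a) 0 = W0' a).

Definition IntInf (f : R -> R) (x : R) : R :=
  real (Lim (fun b => RInt f x b) p_infty).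

Definition NhatW (W : R -> R -> R) (a x : R) : R :=
  W a x * IntInf (fun t => W a (- t)) x - W a (- x) * IntInf (W a) x.

Definition c0p (W : R -> R -> R) (a : R) : R :=
  - Derive (NhatW W a) 0 * W a 0 - NhatW W a 0 * Derive (W a) 0.
Definition c0m (W : R -> R -> R) (a : R) : R :=
  Derive (NhatW W a) 0 * W a 0 - NhatW W a 0 * Derive (W a) 0.

Definition Yfun (a : R) : R :=
  Im (Cmult (Cinv (RtoC 1 - Ci * RtoC (2 * a))%C)
            (hyp2F1 (RtoC (1/2)) (RtoC 1)
                    (RtoC (5/4) - Ci * RtoC (a/2))%C (RtoC (1/2)))).

(* Main.v *)
(* The connection coefficients are c_0^+ = int_0^oo W(a,-t) dt and c_0^- = - int_0^oo W(a,t) dt.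
   For a solution y of the Weber equation, G(s) = int_0^X exp(-s x^2/4) y(x) dx satisfies the
   first order equation (1 + s^2) G' + (s/2 + a) G = (boundary terms); integrating it over s > 0
   and letting X -> oo gives
     int_0^oo y = sqrt(pi) e^(pi a/2) y(0) + y'(0) K(a),
     K(a) = int_0^oo (1+s^2)^(-3/4) e^(a atan s) ds = int_0^(pi/2) e^(a p) (cos p)^(-1/2) dp.
   Two relations determine K(a) and K(-a).
   (i) The reduction formula for int e^(a p) (cos p)^nu dp expresses K(a) + K(-a) as an infinite
   product, which is compared with |Gamma(3/4+ia/2) / Gamma(1/4+ia/2)| through the Euler-Gauss limit
   and the product for cosh, obtained from the same reduction formula.
   (ii) Moving the contour of e^(iaz) (cosh z)^(-1/2) from the half line z > 0 to i pi + (0, oo) gives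
   e^(pi a) K(-a) - e^(-pi a) K(a) = 2 cosh(pi a) int_0^oo sin(a v) (cosh v)^(-1/2) dv, and repeated
   integration by parts turns the last integral into the hypergeometric series of 2 Y(a). *)
Require Import Defs.
From Stdlib Require Import Reals Lra Lia Psatz Factorial.
From Coquelicot Require Import Coquelicot.
Open Scope R_scope.

(** * Improper integrals *)

(** The integrals of W converge only conditionally, so the order of limits matters: with X fixed, s
    runs up to a finite S that goes to infinity, the boundary terms at X leave an error O(1/X), and
    only then does X grow. They equal the coefficients because W(a,0) W'(a,0) = -1/2, that is,
    W(a,x) and W(a,-x) have Wronskian 1. K(a) is handled in the variable s = tan p, where the
    endpoint singularity of (cos p)^(-1/2) becomes decay at infinity. The obstacle in (ii) is the
    branch point i pi/2 on the left edge of the strip 0 <= Im z <= pi. The reflection v + ip -> v +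
    i(pi - p) sends cosh z to minus its conjugate, so the strip folds onto 0 <= p <= pi/2, where the
    branch of the square root is an explicit arctangent. The factor e^(pi a) - i is the one for
    which the two horizontal edges together contribute the real multiple 2 cosh(pi a) of e^(iav)
    (cosh v)^(-1/2). Cauchy's theorem is used in differential form for v > 0, and v = 0 is reached
    by cutting off a neighbourhood of p = pi/2 whose contribution is bounded uniformly in v. *)

Lemma ex_RInt_cont (f : R -> R) (a b : R) :
  (forall x, continuous f x) -> ex_RInt f a b.
Proof. intros H; apply (ex_RInt_continuous (V := R_CompleteNormedModule)); auto. Qed.

(** A domain D is carried along because the derivative formulas of the contour argument are
    available only where [chX] is positive. *)
Lemma is_derive_RInt_param_dom (D : R -> R -> Prop) (f df : R -> R -> R) (a b x : R) :
  a <= b ->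
  (forall u t, D u t -> is_derive (fun u => f u t) u (df u t)) ->
  (forall u t, D u t -> continuity_2d_pt df u t) ->
  (forall u t, D u t -> continuous (f u) t) ->
  (forall t, a <= t <= b -> locally_2d D x t) ->
  locally x (fun u => forall t, a <= t <= b -> D u t) ->
  is_derive (fun u => RInt (f u) a b) x (RInt (df x) a b).
Proof.
  intros Hab Hd Hc Hf HD HD'.
  replace (RInt (df x) a b) with (RInt (fun t => Derive (fun u => f u t) x) a b).
  2:{ apply RInt_ext; rewrite Rmin_left, Rmax_right by lra; intros t Ht.
      apply is_derive_unique, Hd. apply (locally_singleton _ _ HD'). lra. }
  apply is_derive_RInt_param; rewrite ?Rmin_left, ?Rmax_right by lra.
  - revert HD'; apply filter_imp; intros u Hu t Ht. eexists; apply Hd, Hu, Ht.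
  - intros t Ht. apply continuity_2d_pt_ext_loc with df.
    + generalize (HD t Ht); apply locally_2d_impl, locally_2d_forall.
      intros u v Huv. symmetry; apply is_derive_unique, Hd, Huv.
    + apply Hc. apply (locally_singleton _ _ HD'), Ht.
  - revert HD'; apply filter_imp; intros u Hu.
    apply (ex_RInt_continuous (V := R_CompleteNormedModule)).
    rewrite ?Rmin_left, ?Rmax_right by lra. intros t Ht; apply Hf, Hu, Ht.
Qed.

(** * Limits at infinity *)

Lemma is_lim_p_infty_abs (f : R -> R) (l : R) (g : R -> R) :
  is_lim g p_infty 0 -> Rbar_locally p_infty (fun x => Rabs (f x - l) <= g x) ->
  is_lim f p_infty l.
Proof.
  intros Hg Hf.
  apply (is_lim_le_le_loc (fun x => l - g x) (fun x => l + g x)).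
  - revert Hf; apply filter_imp; intros x Hx. apply Rabs_le_between' in Hx. lra.
  - replace (Finite l) with (Finite (l - 0)) by (f_equal; lra).
    apply (is_lim_minus _ _ _ l 0); [apply is_lim_const | exact Hg | reflexivity].
  - replace (Finite l) with (Finite (l + 0)) by (f_equal; lra).
    apply (is_lim_plus _ _ _ l 0); [apply is_lim_const | exact Hg | reflexivity].
Qed.

Lemma is_lim_le_p_infty (f g : R -> R) (l m : R) :
  is_lim f p_infty l -> is_lim g p_infty m ->
  Rbar_locally p_infty (fun x => f x <= g x) -> l <= m.
Proof.
  intros Hf Hg H. exact (is_lim_le_loc f g p_infty (Finite l) (Finite m) H Hf Hg).
Qed.

Lemma is_lim_lin (f g : R -> R) (x : Rbar) (l m a b : R) :
  is_lim f x l -> is_lim g x m -> is_lim (fun y => a * f y + b * g y) x (a * l + b * m).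
Proof.
  intros Hf Hg.
  apply (is_lim_plus _ _ _ (a * l) (b * m)).
  - apply (is_lim_scal_l f a x l Hf).
  - apply (is_lim_scal_l g b x m Hg).
  - reflexivity.
Qed.

Lemma is_lim_unique_fin (f : R -> R) (x : Rbar) (l m : R) :
  is_lim f x l -> is_lim f x m -> l = m.
Proof.
  intros H1 H2. apply is_lim_unique in H1; apply is_lim_unique in H2.
  rewrite H1 in H2; injection H2; auto.
Qed.

Lemma is_lim_inv_p_infty (C : R) : is_lim (fun x => C / x) p_infty 0.
Proof.
  replace (Finite 0) with (Finite (C * 0)) by (f_equal; ring).
  apply (is_lim_scal_l Rinv C p_infty 0).
  apply (is_lim_inv (fun x => x) p_infty p_infty (is_lim_id _)). discriminate.
Qed.

Definition is_improper (f : R -> R) (l : R) : Prop :=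
  is_lim (fun b => RInt f 0 b) p_infty l.

Lemma is_improper_unique (f : R -> R) (l m : R) :
  is_improper f l -> is_improper f m -> l = m.
Proof. apply is_lim_unique_fin. Qed.

Lemma is_improper_ext (f g : R -> R) (l : R) :
  (forall x, 0 <= x -> f x = g x) -> is_improper f l -> is_improper g l.
Proof.
  intros H; apply is_lim_ext_loc. exists 0; intros b Hb.
  apply RInt_ext; rewrite Rmin_left, Rmax_right by lra. intros x Hx; apply H; lra.
Qed.

Lemma is_improper_lin (f g : R -> R) (l m a b : R) :
  (forall x, continuous f x) -> (forall x, continuous g x) ->
  is_improper f l -> is_improper g m ->
  is_improper (fun x => a * f x + b * g x) (a * l + b * m).
Proof.
  intros Cf Cg Hf Hg. unfold is_improper.
  apply (is_lim_ext (fun c => a * RInt f 0 c + b * RInt g 0 c)).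
  2: now apply is_lim_lin.
  intros c. symmetry. apply is_RInt_unique.
  apply (is_RInt_plus (V := R_NormedModule)); apply (is_RInt_scal (V := R_NormedModule));
    apply (RInt_correct (V := R_CompleteNormedModule)), ex_RInt_cont; auto.
Qed.

Lemma RInt_0_Chasles (f : R -> R) (a b : R) : (forall x, continuous f x) ->
  RInt f 0 b = RInt f 0 a + RInt f a b.
Proof.
  intros H. symmetry. apply (RInt_Chasles (V := R_CompleteNormedModule)); apply ex_RInt_cont; auto.
Qed.

Lemma RInt_nonneg_incr (f : R -> R) (a b : R) :
  (forall x, continuous f x) -> (forall x, 0 <= x -> 0 <= f x) -> 0 <= a <= b ->
  RInt f 0 a <= RInt f 0 b.
Proof.
  intros Cf Pf Hab. rewrite (RInt_0_Chasles f a b Cf).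
  assert (0 <= RInt f a b). { apply RInt_ge_0; [lra | apply ex_RInt_cont, Cf |]. intros; apply Pf; lra. }
  lra.
Qed.

Lemma ex_improper_pos (f : R -> R) (M : R) :
  (forall x, continuous f x) -> (forall x, 0 <= x -> 0 <= f x) ->
  (forall b, 0 <= b -> RInt f 0 b <= M) -> exists l, is_improper f l.
Proof.
  intros Cf Pf HM.
  destruct (ex_finite_lim_seq_incr (fun n => RInt f 0 (INR n)) M) as [l Hl].
  - intros n. apply RInt_nonneg_incr; auto. rewrite S_INR. generalize (pos_INR n); lra.
  - intros n; apply HM, pos_INR.
  - exists l. apply is_lim_spec. intros eps.
    apply is_lim_seq_spec in Hl. destruct (Hl eps) as [N HN].
    exists (INR N). intros b Hb.
    destruct (nfloor_ex b) as [n Hn]. { generalize (pos_INR N); lra. }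
    assert (Hup : forall k, RInt f 0 (INR k) <= l).
    { intros k. apply Rnot_lt_le; intros Hk.
      destruct (Hl (mkposreal _ (proj2 (Rlt_0_minus _ _) Hk))) as [K HK].
      specialize (HK (max k K) (Nat.le_max_r _ _)). simpl in HK. apply Rabs_lt_between' in HK.
      assert (RInt f 0 (INR k) <= RInt f 0 (INR (max k K))).
      { apply RInt_nonneg_incr; auto. split. apply pos_INR. apply le_INR, Nat.le_max_l. }
      lra. }
    assert (H1 := HN N (le_n _)). apply Rabs_lt_between' in H1.
    assert (H2 : RInt f 0 (INR N) <= RInt f 0 b).
    { apply RInt_nonneg_incr; auto. generalize (pos_INR N); lra. }
    assert (H3 : RInt f 0 b <= RInt f 0 (INR (S n))).
    { apply RInt_nonneg_incr; auto. rewrite S_INR. generalize (pos_INR N); lra. }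
    generalize (Hup (S n)); intros H4. apply Rabs_lt_between'. destruct eps; simpl in *; lra.
Qed.

Lemma improper_ge_partial (f : R -> R) (l b : R) :
  (forall x, continuous f x) -> (forall x, 0 <= x -> 0 <= f x) -> 0 <= b ->
  is_improper f l -> RInt f 0 b <= l.
Proof.
  intros Cf Pf Hb Hl.
  apply (is_lim_le_p_infty (fun _ => RInt f 0 b) (fun c => RInt f 0 c)); auto.
  - apply is_lim_const.
  - exists b; intros c Hc. apply RInt_nonneg_incr; auto; lra.
Qed.

Lemma improper_le (f g : R -> R) (l m : R) :
  (forall x, continuous f x) -> (forall x, continuous g x) -> (forall x, 0 <= x -> f x <= g x) ->
  is_improper f l -> is_improper g m -> l <= m.
Proof.
  intros Cf Cg H Hf Hg. apply (is_lim_le_p_infty _ _ _ _ Hf Hg).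
  exists 0; intros b Hb. apply RInt_le; auto using ex_RInt_cont; try lra. intros; apply H; lra.
Qed.

Lemma ex_improper_dom (f g : R -> R) (m : R) :
  (forall x, continuous f x) -> (forall x, continuous g x) ->
  (forall x, 0 <= x -> Rabs (f x) <= g x) -> is_improper g m ->
  exists l, is_improper f l /\ Rabs l <= m.
Proof.
  intros Cf Cg H Hg.
  assert (Ch : forall x, continuous (fun x => 1 * f x + 1 * g x) x).
  { intros x. apply (continuous_plus (fun x => 1 * f x) (fun x => 1 * g x));
      apply (continuous_scal_r (V := R_NormedModule)); auto. }
  (* [f + g] lies between 0 and [2 * g], so the monotone criterion applies to it; [f] is recovered
     by subtracting [g]. The coefficients 1 fit the shape of [is_improper_lin]. *)
  destruct (ex_improper_pos (fun x => 1 * f x + 1 * g x) (2 * m)) as [l Hl]; auto.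
  - intros x Hx. specialize (H x Hx). apply Rabs_le_between in H; lra.
  - intros b Hb.
    apply Rle_trans with (RInt (fun x => 2 * g x) 0 b).
    + apply RInt_le; auto using ex_RInt_cont.
      * apply ex_RInt_cont; intros; apply (continuous_scal_r (V := R_NormedModule)); auto.
      * intros x Hx. assert (0 <= x) by lra. specialize (H x H0). apply Rabs_le_between in H; lra.
    + replace (RInt (fun x => 2 * g x) 0 b) with (2 * RInt g 0 b).
      2:{ symmetry. apply (RInt_scal (V := R_CompleteNormedModule) g 0 b 2); auto using ex_RInt_cont. }
      apply Rmult_le_compat_l; [lra |]. apply improper_ge_partial; auto.
      intros x Hx; specialize (H x Hx). generalize (Rabs_pos (f x)); lra.
  - assert (Hf : is_improper f (1 * l + (-1) * m)).
    { apply is_improper_ext with (fun x => 1 * (1 * f x + 1 * g x) + (-1) * g x).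
      intros; ring. apply is_improper_lin; auto. }
    exists (1 * l + (-1) * m); split; auto.
    apply Rabs_le_between; split.
    + replace (- m) with ((-1) * m + 0 * m) by ring.
      apply (improper_le (fun x => (-1) * g x + 0 * g x) f); auto.
      * intros x. apply (continuous_plus (fun x => (-1) * g x) (fun x => 0 * g x));
          apply (continuous_scal_r (V := R_NormedModule)); auto.
      * intros x Hx. specialize (H x Hx). apply Rabs_le_between in H; lra.
      * apply is_improper_lin; auto.
    + apply (improper_le f g); auto. intros x Hx. specialize (H x Hx). apply Rabs_le_between in H; lra.
Qed.

Lemma improper_FTC (F f : R -> R) (l : R) :
  (forall x, is_derive F x (f x)) -> (forall x, continuous f x) ->
  is_lim F p_infty l -> is_improper f (l - F 0).
Proof.
  intros HF Cf Hl.
  apply (is_lim_ext (fun b => F b - F 0)).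
  - intros b. symmetry. apply is_RInt_unique. apply (is_RInt_derive F f); auto.
  - apply (is_lim_minus _ _ _ l (F 0)); auto. apply is_lim_const. reflexivity.
Qed.

Lemma is_RInt_FTC (F f : R -> R) (a b : R) :
  (forall x, is_derive F x (f x)) -> (forall x, continuous f x) -> RInt f a b = F b - F a.
Proof. intros H1 H2. apply is_RInt_unique. apply (is_RInt_derive F f); auto. Qed.

Ltac cont_by_derive := apply (ex_derive_continuous (V := R_NormedModule)); auto_derive.

Lemma is_lim_eq (f : R -> R) (x : Rbar) (l m : R) : is_lim f x l -> l = m -> is_lim f x m.
Proof. now intros H <-. Qed.

Lemma is_lim_minus_fin (f g : R -> R) (x : Rbar) (l m : R) :
  is_lim f x l -> is_lim g x m -> is_lim (fun y => f y - g y) x (l - m).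
Proof. intros Hf Hg. apply (is_lim_minus _ _ _ l m); auto. reflexivity. Qed.

Lemma is_lim_mult_fin (f g : R -> R) (x : Rbar) (l m : R) :
  is_lim f x l -> is_lim g x m -> is_lim (fun y => f y * g y) x (l * m).
Proof. intros Hf Hg. apply (is_lim_mult _ _ _ l m); auto. reflexivity. Qed.

Lemma is_derive_continuous (f : R -> R) (x l : R) : is_derive f x l -> continuous f x.
Proof. intros H; apply (ex_derive_continuous (V := R_NormedModule)). exists l; exact H. Qed.

Lemma is_derive_0_const (f : R -> R) (x y : R) : (forall x, is_derive f x 0) -> f x = f y.
Proof.
  intros H. destruct (MVT_gen f y x (fun _ => 0)) as [c [_ Hc]]; [auto | | lra].
  intros z _. apply continuity_pt_filterlim, (is_derive_continuous _ _ _ (H z)).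
Qed.

Lemma exp_le_compat (x y : R) : x <= y -> exp x <= exp y.
Proof. intros [H | ->]; [left; now apply exp_increasing | right; reflexivity]. Qed.

(** * The Gaussian integral and the kernel e^(a atan s) (1 + s^2)^(-p) *)

Lemma is_lim_atan_p_infty : is_lim atan p_infty (PI / 2).
Proof.
  apply (is_lim_ext_loc (fun x => PI / 2 - atan (1 / x))).
  - exists 0; intros x Hx. replace (1 / x) with (/ x) by (field; lra). rewrite atan_inv by lra. ring.
  - apply is_lim_eq with (PI / 2 - atan 0); [| rewrite atan_0; ring].
    apply is_lim_minus_fin; [apply is_lim_const |].
    apply (is_lim_comp_continuous (fun x => 1 / x) atan p_infty 0 (is_lim_inv_p_infty 1)).
    apply (ex_derive_continuous (V := R_NormedModule)); auto_derive; auto.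
Qed.

Lemma continuity_2d_pt_comp1 (f : R -> R) (g : R -> R -> R) (x y : R) :
  ex_derive f (g x y) -> continuity_2d_pt g x y -> continuity_2d_pt (fun x y => f (g x y)) x y.
Proof.
  intros H; apply continuity_1d_2d_pt_comp. apply continuity_pt_filterlim.
  apply (ex_derive_continuous (V := R_NormedModule)), H.
Qed.

Ltac c2d :=
  repeat first
   [ assumption | apply continuity_2d_pt_const | apply continuity_2d_pt_id1 | apply continuity_2d_pt_id2
   | apply continuity_2d_pt_plus | apply continuity_2d_pt_minus
   | apply continuity_2d_pt_mult | apply continuity_2d_pt_opp
   | apply (continuity_2d_pt_comp1 exp) | apply (continuity_2d_pt_comp1 cos)
   | apply (continuity_2d_pt_comp1 sin) | apply (continuity_2d_pt_comp1 atan)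
   | apply (continuity_2d_pt_comp1 ln)
   | apply continuity_2d_pt_inv ].

(** After the substitution u = x t the x-derivatives of the two terms cancel, so the sum keeps its
    value at x = 0, which is atan 1. *)
Lemma gauss_sq (x : R) :
  (RInt (fun t => exp (- t ^ 2)) 0 x) ^ 2
  + RInt (fun t => exp (- (x ^ 2 * (1 + t ^ 2))) / (1 + t ^ 2)) 0 1 = PI / 4.
Proof.
  set (A := fun x => RInt (fun t => exp (- t ^ 2)) 0 x).
  set (g := fun x t => exp (- (x ^ 2 * (1 + t ^ 2))) / (1 + t ^ 2)).
  set (B := fun x => RInt (g x) 0 1).
  change (A x ^ 2 + B x = PI / 4).
  assert (P : forall t, 0 < 1 + t ^ 2) by (intros; nra).
  assert (CA : forall x, continuous (fun t => exp (- t ^ 2)) x) by (intros; cont_by_derive; auto).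
  assert (dA : forall x, is_derive A x (exp (- x ^ 2))).
  { intros y. apply (is_derive_RInt (fun t => exp (- t ^ 2)) A 0 y); auto.
    apply filter_forall; intros b. apply (RInt_correct (V := R_CompleteNormedModule)), ex_RInt_cont, CA. }
  set (dg := fun x t => - (2 * x) * exp (- (x ^ 2 * (1 + t ^ 2)))).
  assert (dB : forall x, is_derive B x (RInt (dg x) 0 1)).
  { intros y. apply (is_derive_RInt_param_dom (fun _ _ => True) g dg).
    - lra.
    - intros u t _. unfold g, dg. specialize (P t). auto_derive. lra. simpl in *; field; lra.
    - intros u t _. unfold dg. simpl. c2d; auto_derive; auto.
    - intros u t _. unfold g. specialize (P t). cont_by_derive. lra.
    - intros t _. apply locally_2d_forall; auto.
    - apply filter_forall; auto. }
  assert (Eq : forall y, RInt (dg y) 0 1 = - 2 * exp (- y ^ 2) * A y).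
  { intros y. assert (H := RInt_comp_lin (V := R_CompleteNormedModule) (fun t => exp (- t ^ 2)) y 0 0 1).
    replace (y * 0 + 0) with 0 in H by ring. replace (y * 1 + 0) with y in H by ring.
    unfold A. rewrite <- H by (apply ex_RInt_cont, CA).
    transitivity (RInt (fun t => scal (-2 * exp (- y ^ 2)) (scal y (exp (- (y * t + 0) ^ 2)))) 0 1).
    - apply RInt_ext; intros t _. unfold dg, scal; simpl; unfold mult; simpl.
      replace (- (y * (y * 1) * (1 + t * (t * 1)))) with
        (- (y * (y * 1)) + - ((y * t + 0) * ((y * t + 0) * 1))) by ring.
      rewrite exp_plus. ring.
    - apply (RInt_scal (V := R_CompleteNormedModule)). apply ex_RInt_cont; intros z.
      apply (continuous_scal_r (V := R_NormedModule)). cont_by_derive; auto. }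
  assert (D0 : forall y, is_derive (fun y => A y ^ 2 + B y) y 0).
  { intros y. replace 0 with (2 * A y * exp (- y ^ 2) + RInt (dg y) 0 1) by (rewrite Eq; ring).
    apply (is_derive_plus (fun y => A y ^ 2) B); auto.
    replace (2 * A y * exp (- y ^ 2)) with (INR 2 * exp (- y ^ 2) * A y ^ 1) by (simpl; ring).
    apply is_derive_pow; auto. }
  assert (H0 : A 0 ^ 2 + B 0 = PI / 4).
  { unfold A, B. rewrite RInt_point. unfold zero; simpl.
    rewrite (RInt_ext _ (fun t => / (1 + t ^ 2))).
    - rewrite (is_RInt_FTC atan); [rewrite atan_0, atan_1; ring | |].
      + intros t. specialize (P t). auto_derive; [auto | simpl in *; field; lra].
      + intros t; specialize (P t). cont_by_derive. simpl in *; lra.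
    - intros t _. change (@eq R (g 0 t) (/ (1 + t ^ 2))). unfold g. replace (- (0 ^ 2 * (1 + t ^ 2))) with 0 by ring. rewrite exp_0.
      specialize (P t). field; lra. }
  rewrite <- H0.
  apply (is_derive_0_const (fun y => A y ^ 2 + B y) x 0 D0).
Qed.

Lemma gauss_integral : is_improper (fun t => exp (- t ^ 2)) (sqrt PI / 2).
Proof.
  assert (C : forall x, continuous (fun t => exp (- t ^ 2)) x) by (intros; cont_by_derive; auto).
  assert (L : is_lim (fun x => (RInt (fun t => exp (- t ^ 2)) 0 x) ^ 2) p_infty (PI / 4)).
  { apply (is_lim_p_infty_abs _ _ (fun x => 1 / x)). apply is_lim_inv_p_infty.
    exists 1; intros x Hx. assert (E := gauss_sq x).
    set (b := RInt (fun t => exp (- (x ^ 2 * (1 + t ^ 2))) / (1 + t ^ 2)) 0 1) in *.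
    (* By e^u >= 1 + u the integrand is at most 1 / (1 + x^2 (1 + t^2)), hence at most 1/x. *)
    assert (Hb : 0 <= b <= 1 / x).
    { assert (ex : ex_RInt (fun t => exp (- (x ^ 2 * (1 + t ^ 2))) / (1 + t ^ 2)) 0 1).
      { apply ex_RInt_cont; intros t; cont_by_derive. nra. }
      assert (Q : forall t, 0 <= exp (- (x ^ 2 * (1 + t ^ 2))) / (1 + t ^ 2) <= 1 / x).
      { intros t. assert (0 < 1 + t ^ 2) by nra. split.
        - apply Rlt_le, Rdiv_lt_0_compat; auto using exp_pos.
        - apply Rle_trans with (exp (- (x ^ 2 * (1 + t ^ 2)))).
          + apply (Rmult_le_reg_r (1 + t ^ 2)); auto. unfold Rdiv.
            rewrite Rmult_assoc, Rinv_l by lra.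
            generalize (exp_pos (- (x ^ 2 * (1 + t ^ 2)))); nra.
          + rewrite exp_Ropp. unfold Rdiv; rewrite Rmult_1_l. apply Rinv_le_contravar; [lra |].
            apply Rle_trans with (1 + x ^ 2 * (1 + t ^ 2)); [nra | apply exp_ineq1_le]. }
      split.
      - apply RInt_ge_0; auto; [lra |]. intros; apply Q.
      - replace (1 / x) with (RInt (fun _ => 1 / x) 0 1).
        + apply RInt_le; auto; [lra | apply ex_RInt_const |]. intros; apply Q.
        + rewrite RInt_const. unfold scal; simpl; unfold mult; simpl. ring. }
    apply Rabs_le_between'. lra. }
  assert (L2 := is_lim_comp_continuous _ sqrt p_infty (PI / 4) L).
  replace (sqrt PI / 2) with (sqrt (PI / 4)).
  - apply (is_lim_ext_loc (fun x => sqrt ((RInt (fun t => exp (- t ^ 2)) 0 x) ^ 2))).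
    + exists 0; intros x Hx. rewrite <- Rsqr_pow2. apply sqrt_Rsqr.
      apply RInt_ge_0; [lra | apply ex_RInt_cont, C |]. intros; apply Rlt_le, exp_pos.
    + apply L2. apply continuous_sqrt.
  - rewrite sqrt_div_alt by lra. f_equal. replace 4 with (2 ^ 2) by ring. apply sqrt_pow2; lra.
Qed.

(** This is (1 + s^2)^(-p) e^(a atan s). With s = tan t its integral over s > 0 is the integral of
    e^(a t) (cos t)^(2p - 2) over [0, pi/2), so p = 3/4 gives K(a). The single exponential makes
    changes of p additive. *)
Definition kern (p a s : R) : R := exp (a * atan s - p * ln (1 + s ^ 2)).

Lemma one_plus_sqr_pos (s : R) : 0 < 1 + s ^ 2.
Proof. nra. Qed.

Lemma ln_one_plus_sqr_nonneg (s : R) : 0 <= ln (1 + s ^ 2).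
Proof. rewrite <- ln_1. apply Rcomplements.ln_le; nra. Qed.

Lemma kern_pos (p a s : R) : 0 < kern p a s.
Proof. apply exp_pos. Qed.

Lemma kern_succ (p a s : R) : kern p a s = (1 + s ^ 2) * kern (p + 1) a s.
Proof.
  unfold kern. rewrite <- (exp_ln (1 + s ^ 2)) at 2 by apply one_plus_sqr_pos.
  rewrite <- exp_plus. f_equal. ring.
Qed.

Lemma is_derive_kern (p a s : R) :
  is_derive (kern p a) s ((a - 2 * p * s) * kern (p + 1) a s).
Proof.
  assert (H := one_plus_sqr_pos s). unfold kern.
  auto_derive; [simpl in *; lra |].
  change (exp (a * atan s + - (p * ln (1 + s * (s * 1))))) with (kern p a s).
  rewrite kern_succ. fold (kern (p + 1) a s). field. lra.
Qed.

Lemma continuous_kern (p a s : R) : continuous (kern p a) s.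
Proof.
  apply (ex_derive_continuous (V := R_NormedModule)). eexists; apply is_derive_kern.
Qed.

Lemma kern_le (p p' a s : R) : p <= p' -> kern p' a s <= kern p a s.
Proof.
  intros H. unfold kern. apply exp_le_compat.
  generalize (ln_one_plus_sqr_nonneg s); nra.
Qed.

Lemma kern_0_le (p a s : R) : kern p a s <= exp (Rabs a * (PI / 2)) * kern p 0 s.
Proof.
  unfold kern. rewrite <- exp_plus. apply exp_le_compat.
  assert (a * atan s <= Rabs a * (PI / 2)); [| lra].
  apply Rle_trans with (1 := Rle_abs _). rewrite Rabs_mult.
  apply Rmult_le_compat_l; [apply Rabs_pos |]. apply Rabs_le. generalize (atan_bound s); lra.
Qed.

Lemma kern_1_0 (s : R) : kern 1 0 s = / (1 + s ^ 2).
Proof.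
  unfold kern. replace (0 * atan s - 1 * ln (1 + s ^ 2)) with (- ln (1 + s ^ 2)) by ring.
  rewrite exp_Ropp, exp_ln; auto using one_plus_sqr_pos.
Qed.

Lemma kern_0_add (p q s : R) : kern p 0 s * kern q 0 s = kern (p + q) 0 s.
Proof. unfold kern. rewrite <- exp_plus. f_equal. ring. Qed.

Lemma is_lim_kern_0 (p : R) : 0 < p -> is_lim (kern p 0) p_infty 0.
Proof.
  intros Hp. apply (is_lim_comp exp (fun s => 0 * atan s - p * ln (1 + s ^ 2)) p_infty 0 m_infty).
  - apply is_lim_exp_m.
  - apply is_lim_spec. intros M. exists (Rmax 1 (exp (Rabs M / p + 1))). intros s Hs.
    assert (1 < s) by (eapply Rle_lt_trans; [apply Rmax_l | apply Hs]).
    assert (exp (Rabs M / p + 1) < s) by (eapply Rle_lt_trans; [apply Rmax_r | apply Hs]).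
    assert (L : Rabs M / p + 1 < ln (1 + s ^ 2)).
    { rewrite <- (ln_exp (Rabs M / p + 1)). apply ln_increasing; [apply exp_pos | nra]. }
    assert (p * (Rabs M / p + 1) < p * ln (1 + s ^ 2)) by (apply Rmult_lt_compat_l; auto).
    replace (p * (Rabs M / p + 1)) with (Rabs M + p) in H1 by (field; lra).
    generalize (Rle_abs (- M)); rewrite Rabs_Ropp; lra.
  - exists 0; intros; discriminate.
Qed.

(** The majorant [g] is chosen for its explicit primitive [G]. It dominates because (1 + s^2)^(-3/4)
    = (1 + s^2)^(1/2) (1 + s^2)^(-5/4), (1 + s^2)^(1/2) <= 1 + s, and (1 + s^2)^(-5/4) <= (1 +
    s^2)^(-1). *)
Lemma ex_improper_kern (p a : R) : 3 / 4 <= p ->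
  exists l, is_improper (kern p a) l.
Proof.
  intros Hp.
  set (g := fun s => kern 1 0 s + s * kern (5 / 4) 0 s).
  set (G := fun s => atan s - 2 * kern (1 / 4) 0 s).
  set (M := exp (Rabs a * (PI / 2))).
  assert (dG : forall s, is_derive G s (g s)).
  { intros s. unfold G, g. rewrite kern_1_0.
    replace (s * kern (5 / 4) 0 s) with (- (2 * ((0 - 2 * (1 / 4) * s) * kern (1 / 4 + 1) 0 s)))
      by (replace (1 / 4 + 1) with (5 / 4) by field; field).
    apply (is_derive_plus atan (fun s => - (2 * kern (1 / 4) 0 s))).
    - auto_derive; auto. assert (H := one_plus_sqr_pos s). simpl in *. field. lra.
    - apply (is_derive_opp (fun s => 2 * kern (1 / 4) 0 s)).
      apply (is_derive_scal (kern (1 / 4) 0)). apply is_derive_kern. }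
  assert (Cg : forall s, continuous g s).
  { intros s. apply (continuous_plus (kern 1 0) (fun s => s * kern (5 / 4) 0 s)).
    apply continuous_kern. apply (continuous_mult (fun s => s) (kern (5 / 4) 0)).
    apply continuous_id. apply continuous_kern. }
  assert (IG : is_improper g (PI / 2 - G 0)).
  { apply improper_FTC; auto. apply is_lim_eq with (PI / 2 - 2 * 0); [| ring].
    apply is_lim_minus_fin; [apply is_lim_atan_p_infty |].
    apply (is_lim_scal_l (kern (1 / 4) 0) 2 p_infty 0). apply is_lim_kern_0; lra. }
  destruct (ex_improper_dom (kern p a) (fun s => M * g s + 0 * g s) (M * (PI / 2 - G 0) + 0 * (PI / 2 - G 0)))
    as [l [Hl _]].
  - intros; apply continuous_kern.
  - intros s. apply (continuous_plus (fun s => M * g s) (fun s => 0 * g s));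
      apply (continuous_scal_r (V := R_NormedModule)); auto.
  - intros s Hs. rewrite Rabs_pos_eq by apply Rlt_le, kern_pos.
    apply Rle_trans with (M * kern p 0 s); [apply kern_0_le |].
    replace (M * g s + 0 * g s) with (M * g s) by ring.
    apply Rmult_le_compat_l; [apply Rlt_le, exp_pos |].
    apply Rle_trans with (kern (3 / 4) 0 s); [now apply kern_le |].
    unfold g.
    replace (kern (3 / 4) 0 s) with ((1 + s ^ 2) * kern (-1/2) 0 s * kern (1/2) 0 s * kern (5 / 4) 0 s * kern (1/2) 0 s).
    2:{ replace (kern (3/4) 0 s) with ((1 + s ^ 2) * kern (7 / 4) 0 s).
        2:{ rewrite (kern_succ (3/4)). do 2 f_equal. field. }
        rewrite Rmult_assoc, !Rmult_assoc. f_equal. rewrite !kern_0_add. f_equal. field. }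
    replace (kern 1 0 s) with (kern (-1/4) 0 s * kern (5/4) 0 s) by (rewrite kern_0_add; f_equal; field).
    assert (E1 : 1 <= kern (-1/4) 0 s).
    { unfold kern. apply Rle_trans with (exp 0); [rewrite exp_0; lra |]. apply exp_le_compat.
      generalize (ln_one_plus_sqr_nonneg s); lra. }
    assert (E2 : kern (-1/2) 0 s * kern (1/2) 0 s = 1).
    { rewrite kern_0_add. unfold kern. transitivity (exp 0); [f_equal; field | apply exp_0]. }
    assert (E3 : kern (1/2) 0 s * kern (1/2) 0 s * (1 + s ^ 2) = 1).
    { rewrite kern_0_add. replace (1/2 + 1/2) with 1 by field. rewrite kern_1_0.
      field. generalize (one_plus_sqr_pos s); lra. }
    assert (P5 := kern_pos (5/4) 0 s). assert (Ph := kern_pos (1/2) 0 s).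
    assert (E4 : (1 + s ^ 2) * kern (1/2) 0 s <= 1 + s).
    { set (h := kern (1/2) 0 s) in *. assert (((1 + s ^ 2) * h) ^ 2 <= (1 + s) ^ 2).
      { replace (((1 + s ^ 2) * h) ^ 2) with ((h * h * (1 + s ^ 2)) * (1 + s ^ 2)) by ring.
        rewrite E3. simpl; nra. }
      apply Rsqr_incr_0; rewrite ?Rsqr_pow2; auto; nra. }
    replace ((1 + s ^ 2) * kern (-1 / 2) 0 s * kern (1 / 2) 0 s * kern (5 / 4) 0 s * kern (1 / 2) 0 s)
      with ((kern (-1 / 2) 0 s * kern (1 / 2) 0 s) * ((1 + s ^ 2) * kern (1/2) 0 s) * kern (5 / 4) 0 s) by ring.
    rewrite E2. nra.
  - apply is_improper_lin; auto.
  - exists l; auto.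
Qed.

(** * Integrals of solutions of the Weber equation *)

(* [z^2 / q + y^2] with [q = x^2/4 - a] is nonincreasing once [q > 0]. *)
Lemma weber_bound (a : R) (y z : R -> R) :
  (forall x, is_derive y x (z x)) -> (forall x, is_derive z x ((a - x ^ 2 / 4) * y x)) ->
  exists C x0, 0 <= C /\ 1 <= x0 /\ forall x, x0 <= x -> Rabs (y x) <= C /\ Rabs (z x) <= C * x.
Proof.
  intros Hy Hz.
  set (x0 := 1 + 2 * Rabs a + 1).
  set (q := fun x => x ^ 2 / 4 - a).
  assert (Hx0 : 1 <= x0) by (unfold x0; generalize (Rabs_pos a); lra).
  assert (Hq : forall x, x0 <= x -> 0 < q x <= x ^ 2).
  { intros x Hx. unfold q, x0 in *. generalize (Rle_abs a) (Rle_abs (- a)); rewrite Rabs_Ropp.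
    generalize (Rabs_pos a); intros; split; nra. }
  set (E := fun x => z x ^ 2 / q x + y x ^ 2).
  set (dE := fun x => - (x / 2) * (z x / q x) ^ 2).
  assert (HE : forall x, x0 <= x -> is_derive E x (dE x)).
  { intros x Hx. destruct (Hq x Hx) as [Hp _]. unfold E, dE.
    unfold q in *. auto_derive.
    - repeat split; try (eexists; apply Hy); try (eexists; apply Hz). simpl in *; lra.
    - replace (Derive (fun x => z x) x) with ((a - x ^ 2 / 4) * y x)
        by (symmetry; apply is_derive_unique, Hz).
      replace (Derive (fun x => y x) x) with (z x) by (symmetry; apply is_derive_unique, Hy).
      simpl in *. field. lra. }
  assert (HEle : forall x, x0 <= x -> E x <= E x0).
  { intros x Hx. destruct (MVT_gen E x0 x dE) as [c [Hc Ec]].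
    - rewrite Rmin_left, Rmax_right by lra. intros; apply HE; lra.
    - rewrite Rmin_left, Rmax_right by lra. intros t Ht.
      apply continuity_pt_filterlim, (is_derive_continuous _ _ _ (HE t ltac:(lra))).
    - rewrite Rmin_left, Rmax_right in Hc by lra.
      assert (dE c <= 0). { unfold dE. generalize (pow2_ge_0 (z c / q c)); nra. }
      nra. }
  assert (HE0 : 0 <= E x0).
  { unfold E. destruct (Hq x0 (Rle_refl _)).
    assert (0 <= z x0 ^ 2 / q x0) by (apply Rdiv_le_0_compat; [apply pow2_ge_0 | auto]). nra. }
  exists (sqrt (E x0)), x0. split; [apply sqrt_pos |]. split; [auto |].
  intros x Hx. destruct (Hq x Hx) as [Hp Hp']. specialize (HEle x Hx).
  assert (Hz2 : 0 <= z x ^ 2 / q x) by (apply Rdiv_le_0_compat; [apply pow2_ge_0 | auto]).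
  unfold E at 1 in HEle. split.
  - apply Rsqr_incr_0; auto using Rabs_pos, sqrt_pos.
    rewrite <- Rsqr_abs, Rsqr_sqrt, Rsqr_pow2 by auto. lra.
  - apply Rsqr_incr_0; auto using Rabs_pos.
    + rewrite <- Rsqr_abs, Rsqr_mult, Rsqr_sqrt, !Rsqr_pow2 by auto.
      apply Rle_trans with (E x0 * q x); [| apply Rmult_le_compat_l; auto].
      replace (z x ^ 2) with (z x ^ 2 / q x * q x) by (field; lra).
      apply Rmult_le_compat_r; [lra |]. generalize (pow2_ge_0 (y x)); lra.
    + apply Rmult_le_pos; [apply sqrt_pos | lra].
Qed.

(** Laplace's method at the endpoint 0. With y frozen at y(0), rescaling by sqrt S / 2 leaves twice
    the half Gaussian integral. Since y is Lipschitz on [0, X], freezing it costs at most a multiple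
    of sqrt S times the integral of x e^(-S x^2/4), which is O(S^(-1/2)). *)
Lemma is_lim_gauss_concentration (y z : R -> R) (X : R) : 0 < X ->
  (forall x, is_derive y x (z x)) -> (forall x, continuous z x) ->
  is_lim (fun S => sqrt S * RInt (fun x => exp (- (S * x ^ 2 / 4)) * y x) 0 X) p_infty
    (sqrt PI * y 0).
Proof.
  intros HX Hy Cz.
  assert (Cy : forall x, continuous y x) by (intros x; apply (is_derive_continuous _ _ _ (Hy x))).
  set (e := fun S x => exp (- (S * x ^ 2 / 4))).
  assert (Ce : forall S x, continuous (e S) x) by (intros; unfold e; cont_by_derive; auto).
  destruct (continuity_ab_maj (fun x => Rabs (z x)) 0 X) as [m [Hm _]]; [lra | |].
  { intros c _. apply continuity_pt_filterlim.
    apply (continuous_comp z Rabs); [apply Cz | apply continuous_Rabs]. }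
  set (M := Rabs (z m)) in *.
  assert (Lip : forall x, 0 <= x <= X -> Rabs (y x - y 0) <= M * x).
  { intros x Hx. destruct (MVT_gen y 0 x z) as [c [Hc Ec]]; auto.
    - intros t _; apply continuity_pt_filterlim, Cy.
    - rewrite Rmin_left, Rmax_right in Hc by lra. rewrite Ec, Rminus_0_r, Rabs_mult, (Rabs_pos_eq x) by lra.
      apply Rmult_le_compat_r; [lra |]. apply Hm; lra. }
  set (A := fun x => RInt (fun t => exp (- t ^ 2)) 0 x).
  assert (G : forall S, 0 < S -> sqrt S * RInt (e S) 0 X = 2 * A (sqrt S / 2 * X)).
  { intros S HS.
    assert (H := RInt_comp_lin (V := R_CompleteNormedModule) (fun t => exp (- t ^ 2)) (sqrt S / 2) 0 0 X).
    replace (sqrt S / 2 * 0 + 0) with 0 in H by ring.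
    replace (sqrt S / 2 * X + 0) with (sqrt S / 2 * X) in H by ring.
    unfold A. rewrite <- H by (apply ex_RInt_cont; intros; cont_by_derive; auto).
    rewrite (RInt_ext (fun t => scal (sqrt S / 2) (exp (- (sqrt S / 2 * t + 0) ^ 2)))
      (fun x => scal (sqrt S / 2) (e S x))).
    - rewrite (RInt_scal (V := R_CompleteNormedModule)) by (apply ex_RInt_cont, Ce).
      change (sqrt S * RInt (e S) 0 X = 2 * (sqrt S / 2 * RInt (e S) 0 X)). field.
    - intros x _. f_equal. unfold e. f_equal.
      replace ((sqrt S / 2 * x + 0) ^ 2) with ((sqrt S) ^ 2 * x ^ 2 / 4) by field.
      rewrite <- (Rsqr_pow2 (sqrt S)), Rsqr_sqrt by lra. field. }
  apply is_lim_eq with (2 * (sqrt PI / 2) * y 0 + 0); [| field].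
  apply (is_lim_ext_loc (fun S => (2 * A (sqrt S / 2 * X)) * y 0
    + sqrt S * RInt (fun x => e S x * (y x - y 0)) 0 X)).
  { exists 0; intros S HS. rewrite <- G by auto. rewrite Rmult_assoc, <- Rmult_plus_distr_l. f_equal.
    rewrite (Rmult_comm (RInt _ _ _)).
    symmetry. apply is_RInt_unique.
    apply (is_RInt_ext (V := R_NormedModule) (fun x => plus (scal (y 0) (e S x)) (e S x * (y x - y 0)))).
    { intros x _. change (y 0 * e S x + e S x * (y x - y 0) = e S x * y x). ring. }
    apply (is_RInt_plus (V := R_NormedModule)); [apply (is_RInt_scal (V := R_NormedModule)) |];
      apply (RInt_correct (V := R_CompleteNormedModule)), ex_RInt_cont; auto.
    intros x. apply (continuous_mult (e S) (fun x => y x - y 0)); auto.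
    apply (continuous_minus y (fun _ => y 0)); auto. apply continuous_const. }
  apply (is_lim_plus _ _ _ (2 * (sqrt PI / 2) * y 0) 0); [| | reflexivity].
  - apply (is_lim_scal_r (fun S => 2 * A (sqrt S / 2 * X)) (y 0) p_infty (2 * (sqrt PI / 2))).
    apply (is_lim_scal_l (fun S => A (sqrt S / 2 * X)) 2 p_infty (sqrt PI / 2)).
    apply (is_lim_comp A (fun S => sqrt S / 2 * X) p_infty (sqrt PI / 2) p_infty).
    + apply gauss_integral.
    + apply is_lim_spec. intros N. exists (Rmax 0 ((2 * Rabs N / X + 1) ^ 2)). intros S HS.
      assert (0 < S) by (eapply Rle_lt_trans; [apply Rmax_l | apply HS]).
      assert ((2 * Rabs N / X + 1) ^ 2 < S) by (eapply Rle_lt_trans; [apply Rmax_r | apply HS]).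
      assert (0 <= 2 * Rabs N / X) by (apply Rdiv_le_0_compat; [generalize (Rabs_pos N); lra | auto]).
      assert (2 * Rabs N / X + 1 < sqrt S).
      { rewrite <- (sqrt_pow2 (2 * Rabs N / X + 1)) by lra. apply sqrt_lt_1; auto; try lra. apply pow2_ge_0. }
      assert (2 * Rabs N / X * X < sqrt S * X) by (apply Rmult_lt_compat_r; lra).
      replace (2 * Rabs N / X * X) with (2 * Rabs N) in H3 by (field; lra).
      generalize (Rle_abs N); lra.
    + exists 0; intros; discriminate.
  - apply (is_lim_p_infty_abs _ _ (fun S => 2 * M / sqrt S)).
    { apply (is_lim_comp (fun r => 2 * M / r) sqrt p_infty 0 p_infty).
      - apply is_lim_inv_p_infty.
      - apply is_lim_sqrt_p, is_lim_id.
      - exists 0; intros; discriminate. }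
    exists 0; intros S HS. rewrite Rminus_0_r, Rabs_mult, (Rabs_pos_eq (sqrt S)) by apply sqrt_pos.
    assert (B : Rabs (RInt (fun x => e S x * (y x - y 0)) 0 X) <= 2 * M / S).
    { assert (HR : RInt (fun x => x * e S x) 0 X = 2 / S - 2 / S * e S X).
      { rewrite (is_RInt_FTC (fun x => - (2 / S) * e S x)).
        - replace (e S 0) with 1; [change (- (2 / S) * e S X - - (2 / S) * 1 = 2 / S - 2 / S * e S X); ring |].
          unfold e. rewrite <- exp_0. f_equal. field.
        - intros x. unfold e. auto_derive; auto. simpl. unfold Rdiv. field. lra.
        - intros x. apply (continuous_mult (fun x => x) (e S)); auto. apply continuous_id. }
      assert (P : 0 < / S) by now apply Rinv_0_lt_compat.
      assert (PM : 0 <= M) by apply Rabs_pos.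
      apply Rle_trans with (M * (2 / S - 2 / S * e S X)).
      2:{ replace (2 * M / S) with (M * (2 / S)) by (field; lra).
          apply Rmult_le_compat_l; auto. assert (0 < e S X) by apply exp_pos. unfold Rdiv; nra. }
      rewrite <- HR.
      assert (CC : forall x, continuous (fun x => x * e S x) x).
      { intros x. apply (continuous_mult (fun x => x) (e S)); auto. apply continuous_id. }
      apply (norm_RInt_le (V := R_NormedModule) (fun x => e S x * (y x - y 0)) (fun x => M * (x * e S x)) 0 X);
        [lra | | |].
      - intros x Hx. unfold norm; simpl; unfold abs; simpl.
        rewrite Rabs_mult, (Rabs_pos_eq (e S x)) by apply Rlt_le, exp_pos.
        replace (M * (x * e S x)) with (e S x * (M * x)) by ring.
        apply Rmult_le_compat_l; [apply Rlt_le, exp_pos | auto].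
      - apply (RInt_correct (V := R_CompleteNormedModule)), ex_RInt_cont.
        intros x. apply (continuous_mult (e S) (fun x => y x - y 0)); auto.
        apply (continuous_minus y (fun _ => y 0)); auto. apply continuous_const.
      - apply (is_RInt_scal (V := R_NormedModule)).
        apply (RInt_correct (V := R_CompleteNormedModule)), ex_RInt_cont, CC. }
    assert (0 < sqrt S) by now apply sqrt_lt_R0.
    apply Rle_trans with (sqrt S * (2 * M / S)); [apply Rmult_le_compat_l; lra |].
    right. rewrite <- (sqrt_sqrt S) at 2 by lra. field. lra.
Qed.

Lemma continuity_2d_pt_snd (f : R -> R) (x y : R) :
  continuous f y -> continuity_2d_pt (fun _ v => f v) x y.
Proof.
  intros H. apply (continuity_1d_2d_pt_comp f (fun _ v => v)).
  - now apply continuity_pt_filterlim.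
  - apply continuity_2d_pt_id2.
Qed.

Lemma kern_scal_le (a s : R) : 0 <= s -> s * kern (3 / 4) a s <= exp (Rabs a * (PI / 2)).
Proof.
  intros Hs. apply Rle_trans with (s * (exp (Rabs a * (PI / 2)) * kern (3 / 4) 0 s)).
  { apply Rmult_le_compat_l; auto using kern_0_le. }
  assert (s * kern (3 / 4) 0 s <= 1).
  { apply Rle_trans with (s * kern (1 / 2) 0 s).
    - apply Rmult_le_compat_l; auto. apply kern_le; lra.
    - assert (E3 : kern (1/2) 0 s * kern (1/2) 0 s * (1 + s ^ 2) = 1).
      { rewrite kern_0_add. replace (1/2 + 1/2) with 1 by field. rewrite kern_1_0.
        field. generalize (one_plus_sqr_pos s); lra. }
      generalize (kern_pos (1/2) 0 s); intros. nra. }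
  generalize (exp_pos (Rabs a * (PI / 2))); nra.
Qed.

Lemma kern_34_le (a s : R) : kern (3 / 4) a s <= exp (Rabs a * (PI / 2)).
Proof.
  apply Rle_trans with (kern 0 a s); [apply kern_le; lra |].
  rewrite <- (Rmult_1_r (exp _)). apply Rle_trans with (1 := kern_0_le _ _ _).
  right. f_equal. unfold kern. rewrite <- exp_0. f_equal. ring.
Qed.

(** The growth of the integrating factor of the equation for G. It compensates the S^(-1/2) decay of
    G and is the origin of e^(pi a/2) in the coefficients. *)
Lemma is_lim_kern_neg_14 (a : R) :
  is_lim (fun S => kern (- (1 / 4)) a S / sqrt S) p_infty (exp (PI * a / 2)).
Proof.
  apply (is_lim_ext_loc (fun S => exp (a * atan S + 1 / 4 * ln (1 + (1 / S) * (1 / S))))).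
  - exists 0; intros S HS. unfold kern.
    rewrite <- (exp_ln (sqrt S)) by now apply sqrt_lt_R0.
    assert (Ls : ln (sqrt S) = ln S / 2).
    { rewrite <- (sqrt_sqrt S) at 2 by lra. rewrite ln_mult by now apply sqrt_lt_R0. field. }
    assert (ED : forall u v, exp u / exp v = exp (u - v)).
    { intros u v. unfold Rminus, Rdiv. now rewrite exp_plus, exp_Ropp. }
    rewrite Ls, ED. f_equal.
    replace (1 + S ^ 2) with (S * (S * (1 + 1 / S * (1 / S)))) by (field; lra).
    assert (0 < 1 + 1 / S * (1 / S)).
    { assert (0 < 1 / S) by (apply Rdiv_lt_0_compat; lra). nra. }
    assert (0 < S * (1 + 1 / S * (1 / S))) by (apply Rmult_lt_0_compat; auto).
    rewrite !ln_mult by auto. field.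
  - apply is_lim_eq with (exp (a * (PI / 2) + 1 / 4 * ln (1 + 0 * 0))).
    2:{ replace (1 + 0 * 0) with 1 by ring. rewrite ln_1. f_equal. field. }
    apply (is_lim_comp_continuous (fun S => a * atan S + 1 / 4 * ln (1 + 1 / S * (1 / S))) exp).
    2: cont_by_derive; auto.
    apply is_lim_lin; [apply is_lim_atan_p_infty |].
    apply (is_lim_comp_continuous (fun S => 1 / S) (fun r => ln (1 + r * r)) p_infty 0).
    + apply is_lim_inv_p_infty.
    + cont_by_derive. lra.
Qed.

(** [kern (- (1 / 4)) a] is the integrating factor of the first order equation for G: its derivative
    is (a + s/2) [kern (3 / 4) a], and it equals (1 + s^2) [kern (3 / 4) a]. Hence the derivative of
    the product is [kern (3 / 4) a] times the boundary terms. *)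
Lemma weber_finite_identity (a : R) (y z : R -> R) (X S : R) :
  0 < X -> 0 < S ->
  (forall x, is_derive y x (z x)) -> (forall x, is_derive z x ((a - x ^ 2 / 4) * y x)) ->
  let G := (fun s => RInt (fun x => exp (- (s * x ^ 2 / 4)) * y x) 0 X) : R -> R in
  kern (- (1 / 4)) a S * G S - G 0 =
  RInt (fun s => kern (3 / 4) a s * (exp (- (s * X ^ 2 / 4)) * (z X + s * X / 2 * y X) - z 0)) 0 S.
Proof.
  intros HX HS Hy Hz G.
  assert (Cy : forall x, continuous y x) by (intros x; apply (is_derive_continuous _ _ _ (Hy x))).
  assert (Cz : forall x, continuous z x) by (intros x; apply (is_derive_continuous _ _ _ (Hz x))).
  set (g := fun s x => exp (- (s * x ^ 2 / 4)) * y x).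
  set (dg := fun s x => - (x ^ 2 / 4) * exp (- (s * x ^ 2 / 4)) * y x).
  assert (Cg : forall s x, continuous (g s) x).
  { intros s x. apply (continuous_mult (fun x => exp (- (s * x ^ 2 / 4))) y); auto. cont_by_derive; auto. }
  assert (Cdg : forall s x, continuous (dg s) x).
  { intros s x. apply (continuous_mult (fun x => - (x ^ 2 / 4) * exp (- (s * x ^ 2 / 4))) y); auto.
    cont_by_derive; auto. }
  assert (dG : forall s, is_derive G s (RInt (dg s) 0 X)).
  { intros s. apply (is_derive_RInt_param_dom (fun _ _ => True) g dg).
    - lra.
    - intros u t _. unfold g, dg. auto_derive; auto. simpl. unfold Rdiv. field.
    - intros u t _. unfold dg, Rdiv. simpl. c2d; try (auto_derive; auto).
      all: try lra. apply continuity_2d_pt_snd, Cy.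
    - intros u t _. apply Cg.
    - intros t _. apply locally_2d_forall; auto.
    - apply filter_forall; auto. }
  assert (Id : forall s, (1 + s ^ 2) * RInt (dg s) 0 X + (s / 2 + a) * RInt (g s) 0 X
    = exp (- (s * X ^ 2 / 4)) * (z X + s * X / 2 * y X) - z 0).
  { intros s.
    (* Once y'' is eliminated, F' is e^(-s x^2/4) y(x) times a + s/2 - (1 + s^2) x^2/4, which is the
       left-hand side under the integral sign. *)
    set (F := fun x => exp (- (s * x ^ 2 / 4)) * (z x + s * x / 2 * y x)).
    assert (HF : RInt (fun x => (1 + s ^ 2) * dg s x + (s / 2 + a) * g s x) 0 X = F X - F 0).
    { apply is_RInt_FTC.
      - intros x. unfold F, dg, g. auto_derive.
        + repeat split; try (eexists; apply Hy); try (eexists; apply Hz).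
        + replace (Derive (fun x => z x) x) with ((a - x ^ 2 / 4) * y x)
            by (symmetry; apply is_derive_unique, Hz).
          replace (Derive (fun x => y x) x) with (z x) by (symmetry; apply is_derive_unique, Hy).
          simpl. unfold Rdiv. field.
      - intros x. apply (continuous_plus (fun x => (1 + s ^ 2) * dg s x) (fun x => (s / 2 + a) * g s x));
          apply (continuous_scal_r (V := R_NormedModule)); auto. }
    transitivity (F X - F 0).
    - rewrite <- HF. symmetry. apply is_RInt_unique.
      apply (is_RInt_plus (V := R_NormedModule)); apply (is_RInt_scal (V := R_NormedModule));
        apply (RInt_correct (V := R_CompleteNormedModule)), ex_RInt_cont; auto.
    - unfold F. replace (- (s * 0 ^ 2 / 4)) with 0 by field. rewrite exp_0. field. }
  transitivity (kern (- (1 / 4)) a S * G S - kern (- (1 / 4)) a 0 * G 0).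
  { f_equal. unfold kern. rewrite atan_0. replace (1 + 0 ^ 2) with 1 by ring. rewrite ln_1.
    replace (a * 0 - - (1 / 4) * 0) with 0 by ring. rewrite exp_0. symmetry; apply Rmult_1_l. }
  symmetry. apply (is_RInt_FTC (fun s => kern (- (1 / 4)) a s * G s)).
  - intros s.
    replace (kern (3 / 4) a s * (exp (- (s * X ^ 2 / 4)) * (z X + s * X / 2 * y X) - z 0))
      with ((a - 2 * - (1 / 4) * s) * kern (- (1 / 4) + 1) a s * G s + kern (- (1 / 4)) a s * RInt (dg s) 0 X).
    + apply (is_derive_mult (kern (- (1 / 4)) a) G s); [apply is_derive_kern | apply dG |].
      intros; apply Rmult_comm.
    + rewrite <- Id. rewrite (kern_succ (- (1 / 4))).
      replace (- (1 / 4) + 1) with (3 / 4) by field. unfold G. fold (g s).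
      change (RInt (fun x => exp (- (s * x ^ 2 / 4)) * y x) 0 X) with (RInt (g s) 0 X). field.
  - intros s. apply (continuous_mult (kern (3 / 4) a)); [apply continuous_kern |].
    cont_by_derive; auto.
Qed.

(** In the finite identity the terms at X are O(1/X) uniformly in S. So S -> infinity at fixed X
    compares the integral of y up to X with the claimed value within 8MC/X, and X -> infinity
    finishes. *)
Lemma weber_integral (a K : R) (y z : R -> R) :
  (forall x, is_derive y x (z x)) -> (forall x, is_derive z x ((a - x ^ 2 / 4) * y x)) ->
  is_improper (kern (3 / 4) a) K ->
  is_improper y (sqrt PI * exp (PI * a / 2) * y 0 + z 0 * K).
Proof.
  intros Hy Hz HK.
  assert (Cy : forall x, continuous y x) by (intros x; apply (is_derive_continuous _ _ _ (Hy x))).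
  assert (Cz : forall x, continuous z x) by (intros x; apply (is_derive_continuous _ _ _ (Hz x))).
  destruct (weber_bound a y z Hy Hz) as [C [x0 [HC [Hx0 HB]]]].
  set (M := exp (Rabs a * (PI / 2))).
  assert (HM : 0 < M) by apply exp_pos.
  apply (is_lim_p_infty_abs _ _ (fun X => 8 * M * C / X)). { apply is_lim_inv_p_infty. }
  exists x0; intros X HX. assert (H1 : 1 < X) by lra.
  destruct (HB X (Rlt_le _ _ HX)) as [By Bz].
  set (G := (fun s => RInt (fun x => exp (- (s * x ^ 2 / 4)) * y x) 0 X) : R -> R).
  assert (G0 : G 0 = RInt y 0 X).
  { apply RInt_ext. intros x _. replace (- (0 * x ^ 2 / 4)) with 0 by field. rewrite exp_0. apply Rmult_1_l. }
  rewrite <- G0.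
  assert (Est : forall S, 0 < S ->
    Rabs (G 0 - (kern (- (1 / 4)) a S * G S + z 0 * RInt (kern (3 / 4) a) 0 S)) <= 8 * M * C / X).
  { intros S HS.
    assert (Id : kern (- (1 / 4)) a S * G S - G 0 =
      RInt (fun s => kern (3 / 4) a s * (exp (- (s * X ^ 2 / 4)) * (z X + s * X / 2 * y X) - z 0)) 0 S).
    { apply (weber_finite_identity a y z X S); auto; lra. }
    set (b := fun s => kern (3 / 4) a s * (exp (- (s * X ^ 2 / 4)) * (z X + s * X / 2 * y X))).
    assert (Cb : forall s, continuous b s).
    { intros s. apply (continuous_mult (kern (3 / 4) a)); [apply continuous_kern |]. cont_by_derive; auto. }
    replace (G 0 - (kern (- (1 / 4)) a S * G S + z 0 * RInt (kern (3 / 4) a) 0 S)) with (- RInt b 0 S).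
    2:{ assert (Id' : (kern (- (1 / 4)) a S * G S - G 0 = RInt b 0 S + (- z 0) * RInt (kern (3 / 4) a) 0 S)%R);
          [rewrite Id | lra].
        apply is_RInt_unique.
        apply (is_RInt_ext (V := R_NormedModule) (fun s => plus (b s) (scal (- z 0) (kern (3 / 4) a s)))).
        { intros s _. unfold b.
          change (kern (3 / 4) a s * (exp (- (s * X ^ 2 / 4)) * (z X + s * X / 2 * y X)) + (- z 0) * kern (3 / 4) a s
            = kern (3 / 4) a s * (exp (- (s * X ^ 2 / 4)) * (z X + s * X / 2 * y X) - z 0)). ring. }
        apply (is_RInt_plus (V := R_NormedModule)); [| apply (is_RInt_scal (V := R_NormedModule))];
          apply (RInt_correct (V := R_CompleteNormedModule)), ex_RInt_cont; auto using continuous_kern. }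
    rewrite Rabs_Ropp.
    (* [C] bounds y(X) and z(X)/X, and [M] bounds both [kern (3 / 4) a s] and s times it, so each of
       the two boundary terms is at most M C X e^(-s X^2/4). The integral of [h] over all s > 0 is
       8MC/X. *)
    set (h := fun s => 2 * M * C * X * exp (- (s * X ^ 2 / 4))).
    assert (X2 : 0 < X ^ 2) by nra.
    assert (Hh : RInt h 0 S <= 8 * M * C / X).
    { rewrite (is_RInt_FTC (fun s => - (8 * M * C / X) * exp (- (s * X ^ 2 / 4)))).
      - replace (- (0 * X ^ 2 / 4)) with 0 by field. rewrite exp_0.
        assert (0 < exp (- (S * X ^ 2 / 4))) by apply exp_pos.
        assert (0 <= 8 * M * C / X). { apply Rdiv_le_0_compat; [nra | lra]. }
        change (- (8 * M * C / X) * exp (- (S * X ^ 2 / 4)) - - (8 * M * C / X) * 1 <= 8 * M * C / X). nra.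
      - intros s. unfold h. auto_derive; auto. simpl. unfold Rdiv. field. lra.
      - intros s. unfold h. cont_by_derive; auto. }
    apply Rle_trans with (2 := Hh).
    apply (norm_RInt_le (V := R_NormedModule) b h 0 S); [lra | | |].
    - intros s Hs. change (Rabs (b s) <= h s). unfold b, h.
      rewrite !Rabs_mult, (Rabs_pos_eq (kern _ _ _)) by apply Rlt_le, kern_pos.
      rewrite (Rabs_pos_eq (exp _)) by apply Rlt_le, exp_pos.
      set (e := exp (- (s * X ^ 2 / 4))). assert (0 < e) by apply exp_pos.
      assert (K1 := kern_34_le a s). assert (K2 := kern_scal_le a s (proj1 Hs)).
      assert (K0 := kern_pos (3 / 4) a s). fold M in K1, K2. set (k := kern (3 / 4) a s) in *.
      replace (2 * M * C * X * e) with (e * (M * (C * X) + M * (X * C))) by ring.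
      replace (k * (e * Rabs (z X + s * X / 2 * y X))) with (e * (k * Rabs (z X + s * X / 2 * y X))) by ring.
      apply Rmult_le_compat_l; [lra |].
      apply Rle_trans with (k * (Rabs (z X) + s * (X * Rabs (y X)))).
      + apply Rmult_le_compat_l; [lra |]. eapply Rle_trans; [apply Rabs_triang |].
        apply Rplus_le_compat_l. rewrite Rabs_mult, (Rabs_pos_eq (s * X / 2)) by nra.
        generalize (Rabs_pos (y X)); intros. assert (0 <= s * X) by nra. nra.
      + rewrite Rmult_plus_distr_l. apply Rplus_le_compat.
        * apply Rmult_le_compat; auto using Rabs_pos; lra.
        * rewrite <- Rmult_assoc. apply Rmult_le_compat; auto; try nra.
          -- apply Rmult_le_pos; [lra | apply Rabs_pos].
    - apply (RInt_correct (V := R_CompleteNormedModule)), ex_RInt_cont, Cb.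
    - apply (RInt_correct (V := R_CompleteNormedModule)), ex_RInt_cont.
      intros s; unfold h; cont_by_derive; auto. }
  set (L := sqrt PI * exp (PI * a / 2) * y 0 + z 0 * K).
  assert (Lim : is_lim (fun S => kern (- (1 / 4)) a S * G S + z 0 * RInt (kern (3 / 4) a) 0 S) p_infty L).
  { apply (is_lim_ext_loc (fun S => 1 * ((kern (- (1 / 4)) a S / sqrt S) * (sqrt S * G S))
      + z 0 * RInt (kern (3 / 4) a) 0 S)).
    - exists 0; intros S HS. field. assert (0 < sqrt S) by now apply sqrt_lt_R0. lra.
    - apply is_lim_eq with (1 * (exp (PI * a / 2) * (sqrt PI * y 0)) + z 0 * K); [| unfold L; ring].
      apply is_lim_lin; auto. apply is_lim_mult_fin; [apply is_lim_kern_neg_14 |].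
      apply (is_lim_gauss_concentration y z X); auto; lra. }
  apply (is_lim_le_p_infty (fun S => Rabs (G 0 - (kern (- (1 / 4)) a S * G S + z 0 * RInt (kern (3 / 4) a) 0 S)))
    (fun _ => 8 * M * C / X)).
  - apply (is_lim_comp_continuous (fun S => G 0 - (kern (- (1 / 4)) a S * G S + z 0 * RInt (kern (3 / 4) a) 0 S))
      Rabs); [| apply continuous_Rabs].
    apply is_lim_minus_fin; [apply is_lim_const | exact Lim].
  - apply is_lim_const.
  - exists 0; auto.
Qed.

(** * The connection coefficients as integrals *)

Lemma IntInf_eq (f : R -> R) (l x : R) :
  (forall x, continuous f x) -> is_improper f l -> IntInf f x = l - RInt f 0 x.
Proof.
  intros Cf Hf. unfold IntInf.
  rewrite (is_lim_unique _ p_infty (Finite (l - RInt f 0 x))); auto.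
  apply (is_lim_ext (fun b => RInt f 0 b - RInt f 0 x)).
  - intros b. rewrite (RInt_0_Chasles f x b Cf). ring.
  - apply is_lim_minus_fin; auto. apply is_lim_const.
Qed.

(** At 0 the derivatives of the two integrals contribute opposite multiples of W(a,0)^2, so N-hat(0)
    = W(a,0) (lm - lp) and N-hat'(0) = W'(a,0) (lm + lp). In each coefficient one integral cancels
    and the other carries the factor -2 or 2 times W(a,0) W'(a,0). *)
Lemma connection_coefficients (W : R -> R -> R) (a lp lm : R) :
  (forall x, ex_derive (W a) x) ->
  is_improper (W a) lp -> is_improper (fun t => W a (- t)) lm ->
  W a 0 * Derive (W a) 0 = - 1 / 2 ->
  c0p W a = lm /\ c0m W a = - lp.
Proof.
  intros Hd Hp Hm Hw.
  assert (Cp : forall x, continuous (W a) x) by (intros x; apply (ex_derive_continuous (V := R_NormedModule)), Hd).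
  assert (Cm : forall x, continuous (fun t => W a (- t)) x).
  { intros x. apply (continuous_comp Ropp (W a)); auto. cont_by_derive; auto. }
  set (N := fun x => W a x * (lm - RInt (fun t => W a (- t)) 0 x) - W a (- x) * (lp - RInt (W a) 0 x)).
  assert (EN : forall x, NhatW W a x = N x).
  { intros x. unfold NhatW, N. now rewrite (IntInf_eq _ lm), (IntInf_eq _ lp). }
  assert (N0 : NhatW W a 0 = W a 0 * (lm - lp)).
  { rewrite EN. unfold N. rewrite Ropp_0, !RInt_point. unfold zero; simpl. ring. }
  assert (dI : forall f : R -> R, (forall x, continuous f x) -> is_derive (fun x => RInt f 0 x) 0 (f 0)).
  { intros f Cf. apply (is_derive_RInt f (fun x => RInt f 0 x) 0 0); auto.
    apply filter_forall; intros b. apply (RInt_correct (V := R_CompleteNormedModule)), ex_RInt_cont, Cf. }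
  assert (dN : Derive (NhatW W a) 0 = Derive (W a) 0 * (lm + lp)).
  { rewrite (Derive_ext _ N) by apply EN. apply is_derive_unique.
    set (Jm := (fun x => RInt (fun t => W a (- t)) 0 x) : R -> R).
    set (Jp := (fun x => RInt (W a) 0 x) : R -> R).
    change (is_derive (fun x => W a x * (lm - Jm x) - W a (- x) * (lp - Jp x)) 0 (Derive (W a) 0 * (lm + lp))).
    assert (dp := dI _ Cp : is_derive Jp 0 (W a 0)).
    assert (dm := dI _ Cm : is_derive Jm 0 (W a (- 0))).
    rewrite Ropp_0 in dm.
    auto_derive.
    - rewrite ?Ropp_0. repeat split; auto; [eexists; exact dm | eexists; exact dp].
    - rewrite Ropp_0.
      replace (Derive (fun x => Jm x) 0) with (W a 0) by (symmetry; apply is_derive_unique, dm).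
      replace (Derive (fun x => Jp x) 0) with (W a 0) by (symmetry; apply is_derive_unique, dp).
      replace (Jm 0) with 0 by (unfold Jm; now rewrite RInt_point).
      replace (Jp 0) with 0 by (unfold Jp; now rewrite RInt_point).
      change (Derive (fun x => W a x) 0) with (Derive (W a) 0). ring. }
  unfold c0p, c0m. rewrite N0, dN. split.
  - replace (- (Derive (W a) 0 * (lm + lp)) * W a 0 - W a 0 * (lm - lp) * Derive (W a) 0)
      with (- 2 * lm * (W a 0 * Derive (W a) 0)) by ring. rewrite Hw. field.
  - replace (Derive (W a) 0 * (lm + lp) * W a 0 - W a 0 * (lm - lp) * Derive (W a) 0)
      with (2 * lp * (W a 0 * Derive (W a) 0)) by ring. rewrite Hw. field.
Qed.

Lemma is_derive_comp_opp (f df : R -> R) (x : R) :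
  (forall x, is_derive f x (df x)) -> is_derive (fun t => f (- t)) x (- df (- x)).
Proof.
  intros H. replace (- df (- x)) with (scal (-1) (df (- x))) by (unfold scal; simpl; unfold mult; simpl; ring).
  apply (is_derive_comp f Ropp); [apply H |]. auto_derive; auto.
Qed.

Lemma weber_connection (W : R -> R -> R) (a K : R) : is_Weber_W W ->
  is_improper (kern (3 / 4) a) K -> W a 0 * Derive (W a) 0 = - 1 / 2 ->
  c0p W a = sqrt PI * exp (PI * a / 2) * W a 0 - Derive (W a) 0 * K /\
  c0m W a = - (sqrt PI * exp (PI * a / 2) * W a 0 + Derive (W a) 0 * K).
Proof.
  intros [Hd [Hd2 _]] HK Hw.
  assert (H1 : forall x, is_derive (W a) x (Derive (W a) x)) by (intros; apply Derive_correct, Hd).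
  assert (Ip := weber_integral a K (W a) (Derive (W a)) H1 (Hd2 a) HK).
  assert (Im := weber_integral a K (fun t => W a (- t)) (fun t => - Derive (W a) (- t))
    (fun x => is_derive_comp_opp (W a) (Derive (W a)) x H1)).
  assert (Im2 : is_improper (fun t => W a (- t))
    (sqrt PI * exp (PI * a / 2) * W a (- 0) + - Derive (W a) (- 0) * K)).
  { apply Im; auto. intros x.
    replace ((a - x ^ 2 / 4) * W a (- x)) with (- - ((a - (- x) ^ 2 / 4) * W a (- x))) by (field).
    apply (is_derive_opp (fun t => Derive (W a) (- t))).
    apply (is_derive_comp_opp (Derive (W a)) (fun x => (a - x ^ 2 / 4) * W a x)). apply Hd2. }
  rewrite Ropp_0 in Im2.
  destruct (connection_coefficients W a _ _ (Hd a) Ip Im2 Hw) as [-> ->].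
  split; ring.
Qed.

(** * Reduction formula and infinite products *)

Definition Kint (p a : R) : R := real (Lim (fun b => RInt (kern p a) 0 b) p_infty).

Lemma Kint_correct (p a : R) : 3 / 4 <= p -> is_improper (kern p a) (Kint p a).
Proof.
  intros Hp. destruct (ex_improper_kern p a Hp) as [l Hl]. unfold Kint.
  now rewrite (is_lim_unique _ _ _ Hl).
Qed.

Lemma continuous_lin2 (f g : R -> R) (a b x : R) :
  continuous f x -> continuous g x -> continuous (fun x => a * f x + b * g x) x.
Proof.
  intros Hf Hg. apply (continuous_plus (fun x => a * f x) (fun x => b * g x));
    apply (continuous_scal_r (V := R_NormedModule)); auto.
Qed.

(** The factor a + 2qs is conjugate to the a - 2qs of [is_derive_kern]: their product a^2 - 4 q^2
    s^2 equals (a^2 + 4 q^2) - 4 q^2 (1 + s^2), which only shifts the exponent. This is the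
    reduction formula for e^(a t) (cos t)^(2q - 2). *)
Lemma is_derive_kern_recurrence (q a s : R) :
  is_derive (fun s => (a + 2 * q * s) * kern q a s) s
    ((a ^ 2 + 4 * q ^ 2) * kern (q + 1) a s + (- (2 * q * (2 * q - 1))) * kern q a s).
Proof.
  replace ((a ^ 2 + 4 * q ^ 2) * kern (q + 1) a s + (- (2 * q * (2 * q - 1))) * kern q a s)
    with (2 * q * kern q a s + (a + 2 * q * s) * ((a - 2 * q * s) * kern (q + 1) a s)).
  2:{ rewrite (kern_succ q). ring. }
  apply (is_derive_mult (fun s => a + 2 * q * s) (kern q a) s).
  - auto_derive; auto. ring.
  - apply is_derive_kern.
  - intros; apply Rmult_comm.
Qed.

Lemma is_lim_kern (p a : R) : 0 < p -> is_lim (kern p a) p_infty 0.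
Proof.
  intros Hp. apply (is_lim_p_infty_abs _ _ (fun s => exp (Rabs a * (PI / 2)) * kern p 0 s)).
  - apply is_lim_eq with (exp (Rabs a * (PI / 2)) * 0); [| ring].
    apply (is_lim_scal_l (kern p 0) _ p_infty 0). now apply is_lim_kern_0.
  - exists 0; intros s _. rewrite Rminus_0_r, Rabs_pos_eq by apply Rlt_le, kern_pos. apply kern_0_le.
Qed.

Lemma is_lim_mul_kern (p a : R) : 1 / 2 < p -> is_lim (fun s => s * kern p a s) p_infty 0.
Proof.
  intros Hp. apply (is_lim_p_infty_abs _ _ (kern (p - 1 / 2) a)).
  - apply is_lim_kern; lra.
  - exists 0; intros s Hs. rewrite Rminus_0_r, Rabs_pos_eq by (apply Rmult_le_pos; [lra | apply Rlt_le, kern_pos]).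
    apply Rsqr_incr_0; try (apply Rlt_le, kern_pos).
    2:{ apply Rmult_le_pos; [lra | apply Rlt_le, kern_pos]. }
    assert (E : Rsqr (kern (p - 1 / 2) a s) = (1 + s ^ 2) * Rsqr (kern p a s)).
    { transitivity (exp (ln (1 + s ^ 2)) * Rsqr (kern p a s)).
      - unfold kern, Rsqr. rewrite <- !exp_plus. f_equal. field.
      - now rewrite exp_ln by apply one_plus_sqr_pos. }
    rewrite E, Rsqr_mult, !Rsqr_pow2. generalize (pow2_ge_0 (kern p a s)); nra.
Qed.

Lemma Kint_succ (q a : R) : 3 / 4 <= q ->
  (a ^ 2 + 4 * q ^ 2) * Kint (q + 1) a = 2 * q * (2 * q - 1) * Kint q a - a.
Proof.
  intros Hq.
  assert (H1 := is_improper_lin _ _ _ _ (a ^ 2 + 4 * q ^ 2) (- (2 * q * (2 * q - 1)))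
    (continuous_kern (q + 1) a) (continuous_kern q a) (Kint_correct (q + 1) a ltac:(lra)) (Kint_correct q a Hq)).
  assert (H2 : is_improper (fun s => (a ^ 2 + 4 * q ^ 2) * kern (q + 1) a s + (- (2 * q * (2 * q - 1))) * kern q a s)
    (0 - (a + 2 * q * 0) * kern q a 0)).
  { apply (improper_FTC (fun s => (a + 2 * q * s) * kern q a s)).
    - apply is_derive_kern_recurrence.
    - intros; apply continuous_lin2; apply continuous_kern.
    - apply is_lim_eq with (a * 0 + 2 * q * 0); [| ring].
      apply (is_lim_ext (fun s => a * kern q a s + 2 * q * (s * kern q a s))). { intros; ring. }
      apply is_lim_lin; [apply is_lim_kern | apply is_lim_mul_kern]; lra. }
  assert (H3 := is_improper_unique _ _ _ H1 H2).
  replace (kern q a 0) with 1 in H3. lra.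
  unfold kern. rewrite atan_0. replace (1 + 0 ^ 2) with 1 by ring. rewrite ln_1.
  rewrite <- exp_0. f_equal. ring.
Qed.

(** At q = 1/2 the coefficient 2q(2q - 1) of the reduction formula vanishes, which gives a closed
    form. The primitive then no longer tends to 0 but to e^(pi a/2). *)
Lemma Kint_3_2 (a : R) : (1 + a ^ 2) * Kint (3 / 2) a = exp (PI * a / 2) - a.
Proof.
  assert (H1 := is_improper_lin _ _ _ _ (1 + a ^ 2) 0
    (continuous_kern (3 / 2) a) (continuous_kern (3 / 2) a)
    (Kint_correct (3 / 2) a ltac:(lra)) (Kint_correct (3 / 2) a ltac:(lra))).
  assert (H2 : is_improper (fun s => (1 + a ^ 2) * kern (3 / 2) a s + 0 * kern (3 / 2) a s)
    (exp (PI * a / 2) - (a + 2 * (1 / 2) * 0) * kern (1 / 2) a 0)).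
  { apply (improper_FTC (fun s => (a + 2 * (1 / 2) * s) * kern (1 / 2) a s)).
    - intros s. assert (H := is_derive_kern_recurrence (1 / 2) a s).
      replace (1 / 2 + 1) with (3 / 2) in H by field.
      replace ((1 + a ^ 2) * kern (3 / 2) a s + 0 * kern (3 / 2) a s) with
       ((a ^ 2 + 4 * (1 / 2) ^ 2) * kern (3 / 2) a s + - (2 * (1 / 2) * (2 * (1 / 2) - 1)) * kern (1 / 2) a s)
       by field. exact H.
    - intros; apply continuous_lin2; apply continuous_kern.
    - apply is_lim_eq with (a * 0 + 1 * exp (PI * a / 2)); [| ring].
      apply (is_lim_ext (fun s => a * kern (1 / 2) a s + 1 * (s * kern (1 / 2) a s))). { intros; field. }
      apply is_lim_lin; [apply is_lim_kern; lra |].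
      apply (is_lim_ext_loc (fun s => exp (a * atan s) * / sqrt (1 + (1 / s) * (1 / s)))).
      + exists 0; intros s Hs. unfold kern. unfold Rminus. rewrite exp_plus.
        rewrite <- Rmult_assoc, (Rmult_comm s), Rmult_assoc. f_equal.
        assert (P := one_plus_sqr_pos s). assert (0 < sqrt (1 + s ^ 2)) by now apply sqrt_lt_R0.
        assert (L : 1 / 2 * ln (1 + s ^ 2) = ln (sqrt (1 + s ^ 2))).
        { rewrite <- (sqrt_sqrt (1 + s ^ 2)) at 1 by lra. rewrite ln_mult by auto. field. }
        rewrite L, exp_Ropp, exp_ln by auto.
        replace (1 + s ^ 2) with (s ^ 2 * (1 + 1 / s * (1 / s))) by (field; lra).
        assert (0 < 1 / s) by (apply Rdiv_lt_0_compat; lra).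
        rewrite sqrt_mult, sqrt_pow2 by nra. field. split; [| lra].
        assert (0 < sqrt (1 + 1 / s * (1 / s))) by (apply sqrt_lt_R0; nra).
        replace ((s ^ 2 + 1) / s ^ 2) with (1 + 1 / s * (1 / s)) by (field; lra). lra.
      + apply is_lim_eq with (exp (a * (PI / 2)) * / sqrt (1 + 0 * 0)).
        * apply is_lim_mult_fin.
          -- apply (is_lim_comp_continuous atan (fun t => exp (a * t)) p_infty (PI / 2) is_lim_atan_p_infty).
             cont_by_derive; auto.
          -- apply (is_lim_comp_continuous (fun s => 1 / s) (fun r => / sqrt (1 + r * r)) p_infty 0).
             apply is_lim_inv_p_infty. cont_by_derive.
             replace (1 + 0 * 0) with 1 by ring. rewrite sqrt_1. lra.
        * replace (1 + 0 * 0) with 1 by ring. rewrite sqrt_1. rewrite Rinv_1, Rmult_1_r. f_equal. field. }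
  assert (H3 := is_improper_unique _ _ _ H1 H2).
  replace (kern (1 / 2) a 0) with 1 in H3. lra.
  unfold kern. rewrite atan_0. replace (1 + 0 ^ 2) with 1 by ring. rewrite ln_1.
  rewrite <- exp_0. f_equal. ring.
Qed.

Lemma Kint_1_0 : Kint 1 0 = PI / 2.
Proof.
  apply (is_improper_unique (kern 1 0)). apply Kint_correct; lra.
  apply is_lim_eq with (PI / 2 - atan 0); [| rewrite atan_0; ring].
  apply (improper_FTC atan); [| apply continuous_kern | apply is_lim_atan_p_infty].
  intros s. rewrite kern_1_0. auto_derive; auto. assert (P := one_plus_sqr_pos s). simpl in *; field; lra.
Qed.

Lemma Kint_pos (p a : R) : 3 / 4 <= p -> 0 < Kint p a.
Proof.
  intros Hp. apply Rlt_le_trans with (RInt (kern p a) 0 1).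
  - apply RInt_gt_0; [lra | intros; apply kern_pos |]. intros; apply continuous_kern.
  - apply improper_ge_partial; auto using continuous_kern, Kint_correct; try lra.
    intros; apply Rlt_le, kern_pos.
Qed.

Lemma Kint_decr (p q a : R) : 3 / 4 <= p <= q -> Kint q a <= Kint p a.
Proof.
  intros H. apply (improper_le (kern q a) (kern p a)); auto using continuous_kern.
  - intros; apply kern_le; lra.
  - apply Kint_correct; lra.
  - apply Kint_correct; lra.
Qed.

(** cosh x - 1 = 2 sinh(x/2)^2, and 2 sinh(x/2) = e^(x/2) (1 - e^(-x)) <= x e^(x/2). *)
Lemma cosh_sub_1_le (x : R) : 0 <= x -> (exp x + exp (- x)) / 2 - 1 <= x ^ 2 / 2 * exp x.
Proof.
  intros Hx. set (t := x / 2). set (u := exp t). set (v := exp (- t)).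
  assert (uv : u * v = 1). { unfold u, v. rewrite <- exp_plus, Rplus_opp_r. apply exp_0. }
  assert (Eu : exp x = u * u) by (unfold u; rewrite <- exp_plus; f_equal; unfold t; field).
  assert (Ev : exp (- x) = v * v) by (unfold v; rewrite <- exp_plus; f_equal; unfold t; field).
  assert (0 < u) by apply exp_pos. assert (0 < v) by apply exp_pos.
  assert (H1 : u - v <= u * (2 * t)).
  { assert (H2 := exp_ineq1_le (- x)). rewrite Ev in H2. unfold t.
    replace v with (u * (v * v)) by (rewrite <- Rmult_assoc, uv; ring). nra. }
  assert (H2 : 0 <= u - v).
  { assert (exp (- t) <= exp t) by (apply exp_le_compat; unfold t; lra). unfold u, v; lra. }
  rewrite Eu, Ev. replace ((u * u + v * v) / 2 - 1) with ((u - v) ^ 2 / 2) by (simpl; lra).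
  replace (x ^ 2 / 2 * (u * u)) with ((u * (2 * t)) ^ 2 / 2) by (unfold t; field).
  apply Rmult_le_compat_r; [lra |]. apply pow_incr; lra.
Qed.

(** The even part in a. The inhomogeneous term -a of [Kint_succ] is odd and drops out, which leaves
    a homogeneous recurrence that unrolls into a product. *)
Definition Bint (p a : R) : R := (Kint p a + Kint p (- a)) / 2.

Lemma Bint_0 (p : R) : Bint p 0 = Kint p 0.
Proof. unfold Bint. rewrite Ropp_0. field. Qed.

Lemma Bint_pos (p a : R) : 3 / 4 <= p -> 0 < Bint p a.
Proof.
  intros Hp. unfold Bint. generalize (Kint_pos p a Hp) (Kint_pos p (- a) Hp); lra.
Qed.

Lemma Bint_succ (q a : R) : 3 / 4 <= q ->
  (a ^ 2 + 4 * q ^ 2) * Bint (q + 1) a = 2 * q * (2 * q - 1) * Bint q a.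
Proof.
  intros Hq. unfold Bint. generalize (Kint_succ q a Hq) (Kint_succ q (- a) Hq).
  replace ((- a) ^ 2) with (a ^ 2) by ring. lra.
Qed.

(** For large q the kernel concentrates at s = 0, where cosh(a atan s) = 1. Quantitatively 1 <=
    cosh(a atan s) <= 1 + M s^2 with M = a^2 e^(|a| pi/2) / 2. Since s^2 [kern q 0 s] is
    [kern (q - 1) 0 s - kern q 0 s], its integral is [Bint q 0 / (2 * q - 3)] by the recurrence. *)
Lemma Bint_bounds (q a : R) : 7 / 4 <= q ->
  1 <= Bint q a / Bint q 0 <= 1 + a ^ 2 * exp (Rabs a * (PI / 2)) / 2 / (2 * q - 3).
Proof.
  intros Hq.
  assert (P0 : 0 < Bint q 0) by (apply Bint_pos; lra).
  set (M := a ^ 2 * exp (Rabs a * (PI / 2)) / 2).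
  assert (HM : 0 <= M).
  { unfold M. generalize (pow2_ge_0 a) (exp_pos (Rabs a * (PI / 2))); nra. }
  assert (I1 : is_improper (fun s => 1 / 2 * kern q a s + 1 / 2 * kern q (- a) s) (Bint q a)).
  { replace (Bint q a) with (1 / 2 * Kint q a + 1 / 2 * Kint q (- a)) by (unfold Bint; field).
    apply is_improper_lin; auto using continuous_kern; apply Kint_correct; lra. }
  assert (E : forall s, 1 / 2 * kern q a s + 1 / 2 * kern q (- a) s =
    (exp (Rabs a * atan s) + exp (- (Rabs a * atan s))) / 2 * kern q 0 s).
  { intros s. unfold kern.
    replace (0 * atan s - q * ln (1 + s ^ 2)) with (- (q * ln (1 + s ^ 2))) by ring.
    unfold Rminus. rewrite !exp_plus.
    unfold Rabs; destruct Rcase_abs.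
    - replace (- (- a * atan s)) with (a * atan s) by ring. field.
    - replace (- a * atan s) with (- (a * atan s)) by ring. field. }
  split.
  - apply Rmult_le_reg_r with (Bint q 0); auto. unfold Rdiv. rewrite Rmult_assoc, Rinv_l, Rmult_1_l, Rmult_1_r by lra.
    rewrite (Bint_0 q).
    apply (improper_le (kern q 0) (fun s => 1 / 2 * kern q a s + 1 / 2 * kern q (- a) s)); auto using continuous_kern.
    + intros; apply continuous_lin2; apply continuous_kern.
    + intros s Hs. rewrite E. rewrite <- (Rmult_1_l (kern q 0 s)) at 1.
      apply Rmult_le_compat_r; [apply Rlt_le, kern_pos |].
      set (x := Rabs a * atan s). generalize (exp_ineq1_le x) (exp_ineq1_le (- x)); lra.
    + apply Kint_correct; lra.
  - assert (R1 := Bint_succ (q - 1) 0 ltac:(lra)). replace (q - 1 + 1) with q in R1 by ring.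
    assert (D : Bint (q - 1) 0 - Bint q 0 = Bint q 0 / (2 * q - 3)).
    { assert (R2 : 2 * (q - 1) * Bint q 0 = (2 * q - 3) * Bint (q - 1) 0).
      { apply Rmult_eq_reg_l with (2 * (q - 1)); [| lra].
        transitivity ((0 ^ 2 + 4 * (q - 1) ^ 2) * Bint q 0); [ring | rewrite R1; ring]. }
      apply Rmult_eq_reg_l with (2 * q - 3); [| lra]. rewrite Rmult_minus_distr_l, <- R2. field. lra. }
    apply Rmult_le_reg_r with (Bint q 0); auto. unfold Rdiv at 1. rewrite Rmult_assoc, Rinv_l, Rmult_1_r by lra.
    replace ((1 + M / (2 * q - 3)) * Bint q 0) with
      ((1 - M) * Bint q 0 + M * Bint (q - 1) 0).
    2:{ replace (Bint (q - 1) 0) with (Bint q 0 + Bint q 0 / (2 * q - 3)) by lra. field. lra. }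
    rewrite !Bint_0.
    apply (improper_le (fun s => 1 / 2 * kern q a s + 1 / 2 * kern q (- a) s)
      (fun s => (1 - M) * kern q 0 s + M * kern (q - 1) 0 s)); auto.
    + intros; apply continuous_lin2; apply continuous_kern.
    + intros; apply continuous_lin2; apply continuous_kern.
    + intros s Hs. rewrite E. rewrite (kern_succ (q - 1)). replace (q - 1 + 1) with q by ring.
      replace ((1 - M) * kern q 0 s + M * ((1 + s ^ 2) * kern q 0 s)) with ((1 + M * s ^ 2) * kern q 0 s) by ring.
      apply Rmult_le_compat_r; [apply Rlt_le, kern_pos |].
      assert (At : 0 <= atan s <= s).
      { split.
        - destruct Hs as [Hs | <-]; [| rewrite atan_0; lra]. rewrite <- atan_0. apply Rlt_le, atan_increasing; auto.
        - destruct Hs as [Hs | <-]; [| rewrite atan_0; lra].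
          destruct (MVT_gen atan 0 s (fun t => / (1 + t ^ 2))) as [c [Hc Ec]].
          + intros t _. auto_derive; auto. assert (P := one_plus_sqr_pos t). simpl in *; field; lra.
          + intros t _. apply continuity_pt_filterlim. cont_by_derive; auto.
          + rewrite atan_0, !Rminus_0_r in Ec. rewrite Ec.
            assert (/ (1 + c ^ 2) <= 1). { rewrite <- Rinv_1. apply Rinv_le_contravar; nra. } nra. }
      set (x := Rabs a * atan s).
      assert (Hx : 0 <= x) by (apply Rmult_le_pos; [apply Rabs_pos | lra]).
      assert (H1 := cosh_sub_1_le x Hx).
      assert (H2 : x ^ 2 / 2 * exp x <= M * s ^ 2); [| lra].
      replace (M * s ^ 2) with (a ^ 2 * s ^ 2 / 2 * exp (Rabs a * (PI / 2))) by (unfold M; field).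
      apply Rmult_le_compat; [nra | apply Rlt_le, exp_pos | |].
      * unfold x. rewrite Rpow_mult_distr, pow2_abs.
        assert (atan s ^ 2 <= s ^ 2) by (apply pow_incr; auto).
        generalize (pow2_ge_0 a); intros; nra.
      * apply exp_le_compat. unfold x. apply Rmult_le_compat_l; [apply Rabs_pos |].
        generalize (atan_bound s); lra.
    + apply is_improper_lin; auto using continuous_kern; apply Kint_correct; lra.
Qed.

(** * Infinite products for the even part, for cosh and for Wallis-type ratios *)

Fixpoint prodn (f : nat -> R) (n : nat) : R :=
  match n with O => 1 | S m => prodn f m * f m end.

Lemma prodn_S (f : nat -> R) (n : nat) : prodn f (S n) = prodn f n * f n.
Proof. reflexivity. Qed.

Lemma prodn_ext (f g : nat -> R) (n : nat) : (forall k, f k = g k) -> prodn f n = prodn g n.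
Proof. intros H; induction n as [|n IH]; simpl; auto. now rewrite IH, H. Qed.

Lemma prodn_mult (f g : nat -> R) (n : nat) :
  prodn (fun k => f k * g k) n = prodn f n * prodn g n.
Proof. induction n as [|n IH]; simpl; [ring |]. rewrite IH; ring. Qed.

Lemma prodn_pos (f : nat -> R) (n : nat) : (forall k, 0 < f k) -> 0 < prodn f n.
Proof. intros H; induction n as [|n IH]; simpl; [lra | now apply Rmult_lt_0_compat]. Qed.

Lemma prodn_S_l (f : nat -> R) (n : nat) : prodn f (S n) = f O * prodn (fun k => f (S k)) n.
Proof.
  induction n as [|n IH]; [simpl; ring |].
  change (prodn f (S n) * f (S n) = f O * (prodn (fun k => f (S k)) n * f (S n))).
  rewrite IH; ring.
Qed.

Lemma prodn_double (f : nat -> R) (n : nat) :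
  prodn f (2 * n) = prodn (fun k => f (2 * k)%nat * f (2 * k + 1)%nat) n.
Proof.
  induction n as [|n IH]; auto.
  replace (2 * S n)%nat with (S (S (2 * n))) by lia.
  change (prodn f (2 * n) * f (2 * n)%nat * f (S (2 * n)) =
    prodn (fun k => f (2 * k)%nat * f (2 * k + 1)%nat) n * (f (2 * n)%nat * f (2 * n + 1)%nat)).
  rewrite IH. replace (S (2 * n)) with (2 * n + 1)%nat by lia. ring.
Qed.

Lemma is_lim_seq_inv_INR (c d : R) : is_lim_seq (fun n => c / (INR n + d)) 0.
Proof.
  apply (is_lim_seq_ext (fun n => c * / (INR n + d))); [reflexivity |].
  replace (Finite 0) with (Rbar_mult c 0) by (simpl; f_equal; ring).
  apply is_lim_seq_scal_l.
  replace (Finite 0) with (Rbar_inv p_infty) by reflexivity.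
  apply is_lim_seq_inv; [| discriminate].
  apply (is_lim_seq_plus _ _ p_infty d); [apply is_lim_seq_INR | apply is_lim_seq_const | reflexivity].
Qed.

Lemma prodn_Bint (q a : R) (n : nat) : 3 / 4 <= q ->
  prodn (fun k => 1 + a ^ 2 / (4 * (q + INR k) ^ 2)) n * (Bint (q + INR n) a / Bint (q + INR n) 0)
  = Bint q a / Bint q 0.
Proof.
  intros Hq. induction n as [|n IH].
  - simpl. rewrite Rplus_0_r. ring.
  - rewrite <- IH. rewrite prodn_S, Rmult_assoc. f_equal. cbv beta.
    rewrite S_INR, <- Rplus_assoc. set (p := q + INR n).
    assert (Hp : 3 / 4 <= p) by (unfold p; generalize (pos_INR n); lra).
    assert (H0 := Bint_succ p 0 Hp). assert (Ha := Bint_succ p a Hp).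
    assert (P0 := Bint_pos p 0 Hp). assert (P1 := Bint_pos (p + 1) 0 ltac:(lra)).
    assert (E0 : 2 * p * Bint (p + 1) 0 = (2 * p - 1) * Bint p 0).
    { apply Rmult_eq_reg_l with (2 * p); [| lra].
      transitivity ((0 ^ 2 + 4 * p ^ 2) * Bint (p + 1) 0); [ring | rewrite H0; ring]. }
    replace (1 + a ^ 2 / (4 * p ^ 2)) with ((a ^ 2 + 4 * p ^ 2) / (4 * p ^ 2)) by (field; lra).
    replace ((a ^ 2 + 4 * p ^ 2) / (4 * p ^ 2) * (Bint (p + 1) a / Bint (p + 1) 0))
      with (((a ^ 2 + 4 * p ^ 2) * Bint (p + 1) a) / (2 * p * (2 * p * Bint (p + 1) 0)))
      by (field; lra).
    rewrite Ha, E0. field. lra.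
Qed.

(** The partial product times the ratio at q + n is independent of n, and that ratio tends to 1 by
    [Bint_bounds]. *)
Lemma is_lim_seq_prodn_Bint (q a : R) : 3 / 4 <= q ->
  is_lim_seq (fun n => prodn (fun k => 1 + a ^ 2 / (4 * (q + INR k) ^ 2)) n) (Bint q a / Bint q 0).
Proof.
  intros Hq.
  set (r := fun n => Bint (q + INR n) a / Bint (q + INR n) 0).
  assert (Hr : is_lim_seq r 1).
  { set (M := a ^ 2 * exp (Rabs a * (PI / 2)) / 2).
    apply (is_lim_seq_le_le_loc (fun _ => 1) _ (fun n => 1 + (M / 2) / (INR n + (q - 3 / 2)))).
    - exists 1%nat. intros n Hn. assert (1 <= INR n) by (apply (le_INR 1), Hn).
      destruct (Bint_bounds (q + INR n) a ltac:(lra)) as [B1 B2]. fold M in B2. fold (r n) in B1, B2.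
      split; auto. apply Rle_trans with (1 := B2). right. field. lra.
    - apply is_lim_seq_const.
    - replace (Finite 1) with (Finite (1 + 0)) by (f_equal; ring).
      apply (is_lim_seq_plus' _ _ 1 0); [apply is_lim_seq_const | apply is_lim_seq_inv_INR]. }
  apply (is_lim_seq_ext (fun n => (Bint q a / Bint q 0) * / r n)).
  - intros n. rewrite <- (prodn_Bint q a n Hq). fold (r n). field.
    assert (Hp : 3 / 4 <= q + INR n) by (generalize (pos_INR n); lra).
    unfold r. generalize (Bint_pos _ a Hp) (Bint_pos _ 0 Hp); intros.
    apply Rgt_not_eq, Rdiv_lt_0_compat; auto.
  - replace (Finite (Bint q a / Bint q 0)) with (Finite (Bint q a / Bint q 0 * / 1)) by (f_equal; field; apply Rgt_not_eq, Bint_pos; auto).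
    apply (is_lim_seq_mult' _ _ _ (/ 1)); [apply is_lim_seq_const |].
    apply (is_lim_seq_inv r 1); auto. intros H; injection H; lra.
Qed.

(** The case q = 3/2 with parameter 2a, where [Kint_3_2] gives [Bint (3 / 2) (2 * a)] = cosh(pi a) /
    (1 + 4 a^2). The missing factor is the one with m = 0, split off by the index shift. *)
Lemma is_lim_seq_prodn_cosh (a : R) :
  is_lim_seq (fun n => prodn (fun m => 1 + 4 * a ^ 2 / (2 * INR m + 1) ^ 2) n) (cosh (PI * a)).
Proof.
  apply is_lim_seq_incr_1.
  apply (is_lim_seq_ext (fun n => (1 + 4 * a ^ 2) * prodn (fun k => 1 + (2 * a) ^ 2 / (4 * (3 / 2 + INR k) ^ 2)) n)).
  - intros n. rewrite prodn_S_l. f_equal; [simpl; field |].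
    apply prodn_ext; intros k. rewrite S_INR. field. generalize (pos_INR k); lra.
  - replace (cosh (PI * a)) with ((1 + 4 * a ^ 2) * (Bint (3 / 2) (2 * a) / Bint (3 / 2) 0)).
    + apply (is_lim_seq_scal_l _ (1 + 4 * a ^ 2) (Finite _)). apply is_lim_seq_prodn_Bint; lra.
    + assert (B0 : Bint (3 / 2) 0 = 1).
      { rewrite Bint_0. generalize (Kint_3_2 0). replace (PI * 0 / 2) with 0 by field. rewrite exp_0. lra. }
      rewrite B0. unfold Bint, cosh. generalize (Kint_3_2 (2 * a)) (Kint_3_2 (- (2 * a))).
      replace (PI * (2 * a) / 2) with (PI * a) by field.
      replace (PI * - (2 * a) / 2) with (- (PI * a)) by field.
      replace ((- (2 * a)) ^ 2) with (4 * a ^ 2) by ring. replace ((2 * a) ^ 2) with (4 * a ^ 2) by ring.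
      lra.
Qed.

(** In the angle variable this is the product of the integrals of cos^(n+1) and cos^n over
    [0, pi/2]. The reduction formula makes n + 1 times this product independent of n. *)
Lemma wallis (n : nat) :
  (INR n + 1) * Kint (3 / 2 + INR n / 2) 0 * Kint (1 + INR n / 2) 0 = PI / 2.
Proof.
  induction n as [|n IH].
  - simpl. replace (3 / 2 + 0 / 2) with (3 / 2) by field. replace (1 + 0 / 2) with 1 by field.
    rewrite Kint_1_0. generalize (Kint_3_2 0). replace (PI * 0 / 2) with 0 by field. rewrite exp_0.
    intros H. replace (Kint (3 / 2) 0) with 1 by lra. field.
  - rewrite <- IH, S_INR. set (q := 1 + INR n / 2).
    replace (3 / 2 + (INR n + 1) / 2) with (q + 1) by (unfold q; field).
    replace (1 + (INR n + 1) / 2) with (3 / 2 + INR n / 2) by field.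
    assert (Hq : 1 <= q) by (unfold q; generalize (pos_INR n); lra).
    assert (H := Kint_succ q 0 ltac:(lra)).
    assert (E : (INR n + 1 + 1) * Kint (q + 1) 0 = (INR n + 1) * Kint q 0).
    { apply Rmult_eq_reg_l with (2 * q); [| lra].
      transitivity ((0 ^ 2 + 4 * q ^ 2) * Kint (q + 1) 0); [unfold q; field |].
      rewrite H. unfold q; field. }
    rewrite E. ring.
Qed.

(** The exponent 7/4 + n falls between those of [wallis], so by monotonicity the square is squeezed
    between the products at indices 2n + 2 and 2n. *)
Lemma is_lim_seq_wallis : is_lim_seq (fun n => INR n * Kint (7 / 4 + INR n) 0 ^ 2) (PI / 4).
Proof.
  apply (is_lim_seq_le_le (fun n => PI / 4 - 3 * PI / 8 / (INR n + 3 / 2)) _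
    (fun n => PI / 4 - PI / 8 / (INR n + 1 / 2))).
  - intros n. assert (Hn := pos_INR n).
    assert (W1 := wallis (2 * n)). assert (W2 := wallis (2 * n + 2)).
    rewrite plus_INR, mult_INR in W2. rewrite mult_INR in W1. simpl (INR 2) in W1, W2.
    replace (3 / 2 + (1 + 1) * INR n / 2) with (3 / 2 + INR n) in W1 by field.
    replace (1 + (1 + 1) * INR n / 2) with (1 + INR n) in W1 by field.
    replace (3 / 2 + ((1 + 1) * INR n + (1 + 1)) / 2) with (5 / 2 + INR n) in W2 by field.
    replace (1 + ((1 + 1) * INR n + (1 + 1)) / 2) with (2 + INR n) in W2 by field.
    assert (D1 := Kint_decr (1 + INR n) (3 / 2 + INR n) 0 ltac:(lra)).
    assert (D2 := Kint_decr (3 / 2 + INR n) (7 / 4 + INR n) 0 ltac:(lra)).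
    assert (D3 := Kint_decr (7 / 4 + INR n) (2 + INR n) 0 ltac:(lra)).
    assert (D4 := Kint_decr (2 + INR n) (5 / 2 + INR n) 0 ltac:(lra)).
    assert (P := Kint_pos (5 / 2 + INR n) 0 ltac:(lra)).
    set (k1 := Kint (1 + INR n) 0) in *. set (k2 := Kint (3 / 2 + INR n) 0) in *.
    set (k3 := Kint (7 / 4 + INR n) 0) in *. set (k4 := Kint (2 + INR n) 0) in *.
    set (k5 := Kint (5 / 2 + INR n) 0) in *. set (x := INR n) in *.
    assert (U : k3 ^ 2 <= PI / 4 / (x + 1 / 2)).
    { replace (PI / 4 / (x + 1 / 2)) with (k2 * k1).
      - simpl. rewrite Rmult_1_r. apply Rmult_le_compat; lra.
      - apply Rmult_eq_reg_l with (2 * x + 1); [| lra]. transitivity (PI / 2); [rewrite <- W1; ring | field; lra]. }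
    assert (Lo : PI / 4 / (x + 3 / 2) <= k3 ^ 2).
    { replace (PI / 4 / (x + 3 / 2)) with (k5 * k4).
      - simpl. rewrite Rmult_1_r. apply Rmult_le_compat; lra.
      - apply Rmult_eq_reg_l with (2 * x + 3); [| lra]. transitivity (PI / 2); [rewrite <- W2; ring | field; lra]. }
    split.
    + apply Rle_trans with (x * (PI / 4 / (x + 3 / 2))); [right; field; lra |].
      apply Rmult_le_compat_l; auto.
    + apply Rle_trans with (x * (PI / 4 / (x + 1 / 2))); [| right; field; lra].
      apply Rmult_le_compat_l; auto.
  - replace (Finite (PI / 4)) with (Finite (PI / 4 - 0)) by (f_equal; ring).
    apply (is_lim_seq_minus' _ _ (PI / 4) 0); [apply is_lim_seq_const | apply is_lim_seq_inv_INR].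
  - replace (Finite (PI / 4)) with (Finite (PI / 4 - 0)) by (f_equal; ring).
    apply (is_lim_seq_minus' _ _ (PI / 4) 0); [apply is_lim_seq_const | apply is_lim_seq_inv_INR].
Qed.

Lemma prodn_wallis (n : nat) :
  prodn (fun k => (3 / 4 + INR k) / (1 / 4 + INR k)) n * Kint (3 / 4 + INR n) 0 = Kint (3 / 4) 0.
Proof.
  induction n as [|n IH].
  - simpl. rewrite Rplus_0_r. ring.
  - rewrite <- IH. rewrite prodn_S, Rmult_assoc. f_equal. cbv beta.
    rewrite S_INR, <- Rplus_assoc. assert (Hn := pos_INR n). set (p := 3 / 4 + INR n) in *.
    assert (H := Kint_succ p 0 ltac:(unfold p; lra)).
    assert (E : 2 * p * Kint (p + 1) 0 = (2 * p - 1) * Kint p 0).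
    { apply Rmult_eq_reg_l with (2 * p); [| unfold p; lra].
      transitivity ((0 ^ 2 + 4 * p ^ 2) * Kint (p + 1) 0); [ring | rewrite H; ring]. }
    replace (Kint p 0) with ((2 * p * Kint (p + 1) 0) / (2 * p - 1))
      by (rewrite E; field; unfold p; lra).
    unfold p. field. lra.
Qed.

(** The product for [Bint (3 / 4) a] contains only the factors |3/4 + k + ia/2|^2. The product for
    cosh(pi a) supplies the factors |1/4 + k + ia/2|^2, which plays the part of the reflection
    formula for Gamma(1/4 + ia/2) Gamma(3/4 - ia/2). *)
Lemma is_lim_seq_gamma_ratio (a : R) :
  is_lim_seq (fun n => prodn (fun k => ((3 / 4 + INR k) ^ 2 + (a / 2) ^ 2) / ((1 / 4 + INR k) ^ 2 + (a / 2) ^ 2)) (S n)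
      / INR n)
    (4 / PI * Bint (3 / 4) a ^ 2 / cosh (PI * a)).
Proof.
  set (p := fun k => 1 + a ^ 2 / (4 * (3 / 4 + INR k) ^ 2)).
  set (r := fun k => (3 / 4 + INR k) / (1 / 4 + INR k)).
  set (c := fun m => 1 + 4 * a ^ 2 / (2 * INR m + 1) ^ 2).
  assert (Pp : forall k, 0 < p k).
  { intros k. unfold p. assert (Hk := pos_INR k).
    assert (0 <= a ^ 2 / (4 * (3 / 4 + INR k) ^ 2)); [| lra].
    apply Rdiv_le_0_compat; [apply pow2_ge_0 | nra]. }
  assert (Pr : forall k, 0 < r k).
  { intros k. unfold r. assert (Hk := pos_INR k). apply Rdiv_lt_0_compat; lra. }
  assert (Pc : forall k, 0 < c k).
  { intros k. unfold c. assert (Hk := pos_INR k).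
    assert (0 <= 4 * a ^ 2 / (2 * INR k + 1) ^ 2); [| lra].
    apply Rdiv_le_0_compat; [generalize (pow2_ge_0 a); lra | nra]. }
  assert (K0 := Kint_pos (3 / 4) 0 ltac:(lra)).
  assert (PP := PI_RGT_0).
  apply (is_lim_seq_ext_loc (fun n => Kint (3 / 4) 0 ^ 2 * / (INR n * Kint (7 / 4 + INR n) 0 ^ 2)
    * (prodn p (S n) * prodn p (S n)) * / prodn c (2 * S n))).
  - exists 1%nat; intros n Hn.
    assert (Hn1 : 1 <= INR n) by (apply (le_INR 1), Hn).
    (* The cosh factors with indices 2k and 2k + 1 are |1/4 + k + ia/2|^2 / (1/4 + k)^2 and |3/4 + k
       + ia/2|^2 / (3/4 + k)^2, hence the doubled length. *)
    assert (E : prodn (fun k => ((3 / 4 + INR k) ^ 2 + (a / 2) ^ 2) / ((1 / 4 + INR k) ^ 2 + (a / 2) ^ 2)) (S n)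
      * prodn c (2 * S n) = prodn r (S n) * prodn r (S n) * (prodn p (S n) * prodn p (S n))).
    { rewrite prodn_double, <- !prodn_mult. apply prodn_ext. intros k. unfold c, r, p.
      assert (Hk := pos_INR k). rewrite plus_INR, mult_INR. simpl (INR 2). simpl (INR 1).
      field. repeat split; try lra.
      all: generalize (pow2_ge_0 a) (pow2_ge_0 (INR k)); nra. }
    assert (W := prodn_wallis (S n)). rewrite S_INR in W. fold r in W.
    replace (3 / 4 + (INR n + 1)) with (7 / 4 + INR n) in W by field.
    assert (K7 := Kint_pos (7 / 4 + INR n) 0 ltac:(lra)).
    assert (Hc := prodn_pos c (2 * S n) Pc).
    apply Rmult_eq_reg_r with (prodn c (2 * S n)); [| lra].
    set (T := prodn (fun k => ((3 / 4 + INR k) ^ 2 + (a / 2) ^ 2) / ((1 / 4 + INR k) ^ 2 + (a / 2) ^ 2)) (S n)) in *.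
    replace (T / INR n * prodn c (2 * S n)) with (T * prodn c (2 * S n) / INR n) by (field; lra). rewrite E.
    rewrite <- W. field. lra.
  - replace (Finite (4 / PI * Bint (3 / 4) a ^ 2 / cosh (PI * a))) with
      (Finite (Kint (3 / 4) 0 ^ 2 * / (PI / 4) * ((Bint (3 / 4) a / Bint (3 / 4) 0) * (Bint (3 / 4) a / Bint (3 / 4) 0))
       * / cosh (PI * a))).
    2:{ f_equal. rewrite Bint_0. field. repeat split; try lra.
        unfold cosh. generalize (exp_pos (PI * a)) (exp_pos (- (PI * a))); lra. }
    assert (Lp : is_lim_seq (fun n => prodn p (S n)) (Bint (3 / 4) a / Bint (3 / 4) 0)).
    { apply (is_lim_seq_incr_1 (prodn p)). apply is_lim_seq_prodn_Bint; lra. }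
    apply is_lim_seq_mult'; [apply is_lim_seq_mult' |].
    + apply is_lim_seq_mult'; [apply is_lim_seq_const |].
      apply (is_lim_seq_inv _ (PI / 4)); [apply is_lim_seq_wallis |]. intros H; injection H; lra.
    + now apply is_lim_seq_mult'.
    + apply (is_lim_seq_inv _ (cosh (PI * a))).
      * apply (is_lim_seq_subseq (prodn c) _ (fun n => (2 * S n)%nat)); [| apply is_lim_seq_prodn_cosh].
        apply eventually_subseq. intros n; lia.
      * intros H; injection H. unfold cosh. generalize (exp_pos (PI * a)) (exp_pos (- (PI * a))); lra.
Qed.

(** * The Gamma function *)

(** The complex exponential of r + it. Storing the logarithm of the modulus turns the products and
    quotients of the Euler-Gauss sequence into sums. *)
Definition polar (r t : R) : C := (exp r * cos t, exp r * sin t).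

Lemma polar_mult (r t r' t' : R) : Cmult (polar r t) (polar r' t') = polar (r + r') (t + t').
Proof. unfold polar, Cmult; simpl. rewrite exp_plus, cos_plus, sin_plus. f_equal; ring. Qed.

Lemma Cmod_polar (r t : R) : Cmod (polar r t) = exp r.
Proof.
  unfold polar, Cmod; simpl fst; simpl snd.
  replace ((exp r * cos t) ^ 2 + (exp r * sin t) ^ 2) with ((exp r) ^ 2 * (Rsqr (sin t) + Rsqr (cos t)))
    by (unfold Rsqr; ring).
  rewrite sin2_cos2, Rmult_1_r. apply sqrt_pow2, Rlt_le, exp_pos.
Qed.

Lemma polar_neq_0 (r t : R) : polar r t <> RtoC 0.
Proof. apply Cmod_gt_0. rewrite Cmod_polar. apply exp_pos. Qed.

Lemma polar_div (r t r' t' : R) : Cdiv (polar r t) (polar r' t') = polar (r - r') (t - t').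
Proof.
  assert (H := polar_neq_0 r' t').
  replace (polar r t) with (Cmult (polar (r - r') (t - t')) (polar r' t')).
  - field. exact H.
  - rewrite polar_mult. f_equal; ring.
Qed.

Lemma C_polar (x y : R) : 0 < x -> (x, y) = polar (1 / 2 * ln (x ^ 2 + y ^ 2)) (atan (y / x)).
Proof.
  intros Hx. unfold polar.
  assert (P : 0 < x ^ 2 + y ^ 2) by nra.
  assert (Hs : 0 < sqrt (x ^ 2 + y ^ 2)) by now apply sqrt_lt_R0.
  replace (exp (1 / 2 * ln (x ^ 2 + y ^ 2))) with (sqrt (x ^ 2 + y ^ 2)).
  2:{ rewrite <- (exp_ln (sqrt (x ^ 2 + y ^ 2))) by auto. f_equal.
      rewrite <- (sqrt_sqrt (x ^ 2 + y ^ 2)) at 2 by lra. rewrite ln_mult by auto. field. }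
  rewrite cos_atan, sin_atan.
  assert (E : sqrt (1 + (y / x)²) = sqrt (x ^ 2 + y ^ 2) / x).
  { replace (1 + (y / x)²) with ((x ^ 2 + y ^ 2) / x ^ 2) by (unfold Rsqr; field; lra).
    rewrite sqrt_div_alt by nra. rewrite sqrt_pow2 by lra. reflexivity. }
  rewrite E. f_equal; field; lra.
Qed.

Fixpoint sumn (f : nat -> R) (n : nat) : R :=
  match n with O => 0 | S m => sumn f m + f m end.

Lemma sumn_S (f : nat -> R) (n : nat) : sumn f (S n) = sumn f n + f n.
Proof. reflexivity. Qed.

Lemma Cpoch_polar (x y : R) (n : nat) : 0 < x ->
  Cpoch (x, y) n = polar (sumn (fun k => 1 / 2 * ln ((x + INR k) ^ 2 + y ^ 2)) n)
    (sumn (fun k => atan (y / (x + INR k))) n).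
Proof.
  intros Hx. induction n as [|n IH].
  - simpl. unfold polar. rewrite exp_0, cos_0, sin_0. unfold RtoC. f_equal; ring.
  - change (Cpoch (x, y) (S n)) with (Cmult (Cpoch (x, y) n) (Cplus (x, y) (RtoC (INR n)))).
    rewrite IH. replace (Cplus (x, y) (RtoC (INR n))) with ((x + INR n, y) : C).
    + rewrite C_polar by (generalize (pos_INR n); lra). rewrite polar_mult. reflexivity.
    + unfold Cplus, RtoC; simpl. now rewrite Rplus_0_r.
Qed.

(** The bound on the increments telescopes to c/(n+1) - c/(n+2), so u(n) - c/(n+1) is increasing and
    bounded. *)
Lemma ex_lim_seq_telescope (u : nat -> R) (c : R) :
  (forall n, Rabs (u (S n) - u n) <= c / ((INR n + 1) * (INR n + 2))) -> ex_finite_lim_seq u.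
Proof.
  intros H.
  assert (H' : forall n, Rabs (u (S n) - u n) <= c / (INR n + 1) - c / (INR (S n) + 1)).
  { intros n. apply Rle_trans with (1 := H n). rewrite S_INR. right. field. generalize (pos_INR n); lra. }
  assert (Hw : ex_finite_lim_seq (fun n => u n - c / (INR n + 1))).
  { apply ex_finite_lim_seq_incr with (u O + c).
    - intros n. specialize (H' n). apply Rabs_le_between in H'. lra.
    - intros n.
      assert (Hv : u n + c / (INR n + 1) <= u O + c).
      { induction n as [|n IH]; [simpl; right; field |]. specialize (H' n).
        apply Rabs_le_between in H'. lra. }
      assert (Hc : 0 <= c / (INR n + 1)); [| lra].
      specialize (H O). assert (H1 := Rabs_pos (u 1%nat - u O)). simpl INR in H.
      apply Rdiv_le_0_compat; [| generalize (pos_INR n); lra].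
      replace (c / ((0 + 1) * (0 + 2))) with (c / 2) in H by field. lra. }
  destruct Hw as [l Hl]. exists (l + 0).
  apply (is_lim_seq_ext (fun n => (u n - c / (INR n + 1)) + c / (INR n + 1))); [intros; ring |].
  apply (is_lim_seq_plus' _ _ l 0); auto. apply is_lim_seq_inv_INR.
Qed.

Lemma ln_1_add_bounds (u : R) : 0 <= u -> u - u ^ 2 <= ln (1 + u) <= u.
Proof.
  intros Hu. split.
  - assert (H : ln (/ (1 + u)) <= / (1 + u) - 1).
    { assert (P : 0 < / (1 + u)) by (apply Rinv_0_lt_compat; lra).
      generalize (exp_ineq1_le (ln (/ (1 + u)))). rewrite exp_ln by auto. lra. }
    rewrite ln_Rinv in H by lra.
    assert (/ (1 + u) <= 1 - u + u ^ 2); [| lra].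
    apply Rmult_le_reg_r with (1 + u); [lra |]. rewrite Rinv_l by lra.
    replace ((1 - u + u ^ 2) * (1 + u)) with (1 + u ^ 3) by ring.
    assert (0 <= u ^ 3) by (apply pow_le; auto). lra.
  - generalize (exp_ineq1_le (ln (1 + u))). rewrite exp_ln by lra. lra.
Qed.

Lemma ln_succ_bounds (m : R) : 0 < m -> 0 <= ln (m + 1) - ln m - / (m + 1) <= / (m * (m + 1)).
Proof.
  intros Hm.
  replace (ln (m + 1) - ln m) with (ln ((m + 1) / m)).
  2:{ unfold Rdiv. rewrite ln_mult, ln_Rinv; [ring | | |]; try lra. now apply Rinv_0_lt_compat. }
  assert (P : 0 < (m + 1) / m) by (apply Rdiv_lt_0_compat; lra).
  split.
  - assert (H := exp_ineq1_le (ln (m / (m + 1)))).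
    assert (P' : 0 < m / (m + 1)) by (apply Rdiv_lt_0_compat; lra).
    rewrite exp_ln in H by auto.
    replace ((m + 1) / m) with (/ (m / (m + 1))) by (field; lra). rewrite ln_Rinv by auto.
    replace (/ (m + 1)) with (1 - m / (m + 1)) by (field; lra). lra.
  - assert (H := exp_ineq1_le (ln ((m + 1) / m))). rewrite exp_ln in H by auto.
    replace (/ (m * (m + 1))) with ((m + 1) / m - 1 - / (m + 1)) by (field; lra). lra.
Qed.

Lemma atan_sub_id_bound (u : R) : Rabs (atan u - u) <= u ^ 2.
Proof.
  destruct (MVT_gen atan 0 u (fun t => / (1 + t ^ 2))) as [c [Hc Ec]].
  - intros t _. auto_derive; auto. assert (P := one_plus_sqr_pos t). simpl in *; field; lra.
  - intros t _. apply continuity_pt_filterlim. cont_by_derive; auto.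
  - rewrite atan_0, !Rminus_0_r in Ec. rewrite Ec.
    assert (P := one_plus_sqr_pos c).
    assert (Hcu : Rabs c <= Rabs u).
    { unfold Rmin, Rmax in Hc. unfold Rabs. repeat destruct Rcase_abs; destruct (Rle_dec 0 u); lra. }
    replace (/ (1 + c ^ 2) * u - u) with (- (u * (c ^ 2 / (1 + c ^ 2)))) by (field; lra).
    rewrite Rabs_Ropp, Rabs_mult, <- (pow2_abs u).
    simpl (Rabs u ^ 2). rewrite Rmult_1_r. apply Rmult_le_compat_l; [apply Rabs_pos |].
    apply Rle_trans with (2 := Hcu). rewrite Rabs_pos_eq by (apply Rdiv_le_0_compat; nra).
    apply Rmult_le_reg_r with (1 + c ^ 2); auto. unfold Rdiv. rewrite Rmult_assoc, Rinv_l, Rmult_1_r by lra.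
    rewrite <- (pow2_abs c). generalize (Rabs_pos c); intros. nra.
Qed.

Definition gam_log (x y : R) (n : nat) : R :=
  ln (INR (fact n)) + x * ln (INR n) - sumn (fun k => 1 / 2 * ln ((x + INR k) ^ 2 + y ^ 2)) (S n).

Definition gam_arg (x y : R) (n : nat) : R :=
  y * ln (INR n) - sumn (fun k => atan (y / (x + INR k))) (S n).

Lemma gamma_seq_polar (x y : R) (n : nat) : 0 < x ->
  Cdiv (Cmult (RtoC (INR (fact n))) (Rcpow (INR n) (x, y))) (Cpoch (x, y) (S n))
  = polar (gam_log x y n) (gam_arg x y n).
Proof.
  intros Hx. rewrite Cpoch_polar by auto.
  replace (RtoC (INR (fact n))) with (polar (ln (INR (fact n))) 0).
  2:{ unfold polar. rewrite exp_ln by apply INR_fact_lt_0. rewrite cos_0, sin_0. unfold RtoC. f_equal; ring. }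
  change (Rcpow (INR n) (x, y)) with (polar (x * ln (INR n)) (y * ln (INR n))).
  rewrite polar_mult, polar_div. unfold gam_log, gam_arg. f_equal; ring.
Qed.

(** Although only moduli enter [W0], convergence of the argument is required as well: [CGamma] takes
    the limits of the real and the imaginary part separately. The increment y (ln(m+1) - ln m) -
    atan(y/(x+m+1)) is O(1/m^2) because both terms agree with y/(m+1) to that order. *)
Lemma ex_lim_gam_arg (x y : R) : 0 < x -> ex_finite_lim_seq (gam_arg x y).
Proof.
  (* The shift by one leaves out the term at index 0, which contains the default value of ln 0. *)
  intros Hx. destruct (ex_lim_seq_telescope (fun n => gam_arg x y (S n)) (Rabs y * (1 + x) + y ^ 2)) as [l Hl].
  2:{ exists l. now apply is_lim_seq_incr_1. }
  intros n. set (m := INR n + 1). assert (Hm : 1 <= m) by (unfold m; generalize (pos_INR n); lra).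
  replace (gam_arg x y (S (S n)) - gam_arg x y (S n)) with
    (y * (ln (m + 1) - ln m - / (m + 1)) + y * (/ (m + 1) - / (x + m + 1))
     - (atan (y / (x + m + 1)) - y / (x + m + 1))).
  2:{ unfold gam_arg. change (sumn (fun k => atan (y / (x + INR k))) (S (S (S n)))) with
      (sumn (fun k => atan (y / (x + INR k))) (S (S n)) + atan (y / (x + INR (S (S n))))).
      rewrite !S_INR. fold m. replace (x + (m + 1)) with (x + m + 1) by ring. field. lra. }
  replace (INR n + 2) with (m + 1) by (unfold m; ring).
  assert (PP : 0 < m * (m + 1)) by nra.
  assert (B1 := ln_succ_bounds m ltac:(lra)).
  assert (B2 : 0 <= / (m + 1) - / (x + m + 1) <= x / (m * (m + 1))).
  { replace (/ (m + 1) - / (x + m + 1)) with (x / ((x + m + 1) * (m + 1))) by (field; lra). split.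
    - apply Rdiv_le_0_compat; nra.
    - apply Rmult_le_compat_l; [lra |]. apply Rinv_le_contravar; nra. }
  assert (B3 := atan_sub_id_bound (y / (x + m + 1))).
  assert (B4 : (y / (x + m + 1)) ^ 2 <= y ^ 2 / (m * (m + 1))).
  { replace ((y / (x + m + 1)) ^ 2) with (y ^ 2 / ((x + m + 1) * (x + m + 1))) by (field; lra).
    apply Rmult_le_compat_l; [apply pow2_ge_0 |]. apply Rinv_le_contravar; nra. }
  eapply Rle_trans; [apply Rabs_triang |]. rewrite Rabs_Ropp.
  replace ((Rabs y * (1 + x) + y ^ 2) / (m * (m + 1))) with
    (Rabs y * / (m * (m + 1)) + Rabs y * (x / (m * (m + 1))) + y ^ 2 / (m * (m + 1))) by (field; lra).
  apply Rplus_le_compat; [| lra]. eapply Rle_trans; [apply Rabs_triang |].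
  rewrite !Rabs_mult. generalize (Rabs_pos y); intros.
  apply Rplus_le_compat; apply Rmult_le_compat_l; auto; rewrite Rabs_pos_eq; lra.
Qed.

(** With |x + m + 1|^2 + y^2 written as (m+1)^2 (1 + u), the terms of order 1/m in ln(1 + u)/2 and x
    (ln(m+1) - ln m) cancel, and what remains is O(1/m^2). *)
Lemma ex_lim_gam_log (x y : R) : 0 < x -> ex_finite_lim_seq (gam_log x y).
Proof.
  intros Hx. set (D := 2 * x + x ^ 2 + y ^ 2).
  destruct (ex_lim_seq_telescope (fun n => gam_log x y (S n)) (x + (D ^ 2) / 2 + (x ^ 2 + y ^ 2) / 2)) as [l Hl].
  2:{ exists l. now apply is_lim_seq_incr_1. }
  assert (HD : 0 <= D) by (unfold D; nra).
  intros n. set (m := INR n + 1). assert (Hm : 1 <= m) by (unfold m; generalize (pos_INR n); lra).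
  set (u := 2 * x / (m + 1) + (x ^ 2 + y ^ 2) / (m + 1) ^ 2).
  assert (Pm : 0 < / (m + 1)) by (apply Rinv_0_lt_compat; lra).
  assert (Pm2 : 0 < / (m + 1) ^ 2) by (apply Rinv_0_lt_compat; nra).
  assert (Pm3 : / (m + 1) ^ 2 <= / (m + 1)) by (apply Rinv_le_contravar; nra).
  assert (Pm4 : / (m + 1) ^ 2 <= / (m * (m + 1))) by (apply Rinv_le_contravar; nra).
  assert (Hu : 0 <= u <= D * / (m + 1)).
  { unfold u, D, Rdiv. assert (0 <= x ^ 2 + y ^ 2) by nra. split; nra. }
  replace (gam_log x y (S (S n)) - gam_log x y (S n)) with
    (x * (ln (m + 1) - ln m - / (m + 1)) - 1 / 2 * (ln (1 + u) - u) - (x ^ 2 + y ^ 2) / 2 * / (m + 1) ^ 2).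
  2:{ unfold gam_log. change (sumn (fun k => 1 / 2 * ln ((x + INR k) ^ 2 + y ^ 2)) (S (S (S n)))) with
      (sumn (fun k => 1 / 2 * ln ((x + INR k) ^ 2 + y ^ 2)) (S (S n)) + 1 / 2 * ln ((x + INR (S (S n))) ^ 2 + y ^ 2)).
      replace (ln (INR (fact (S (S n))))) with (ln (m + 1) + ln (INR (fact (S n)))).
      2:{ rewrite (fact_simpl (S n)), mult_INR, ln_mult; [| apply lt_0_INR; lia | apply INR_fact_lt_0].
          rewrite !S_INR. fold m. ring. }
      rewrite !S_INR. fold m.
      replace ((x + (m + 1)) ^ 2 + y ^ 2) with ((m + 1) * ((m + 1) * (1 + u))) by (unfold u; field; lra).
      rewrite !ln_mult by nra. unfold u. field. lra. }
  replace (INR n + 2) with (m + 1) by (unfold m; ring).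
  assert (PP : 0 < m * (m + 1)) by nra.
  assert (B1 := ln_succ_bounds m ltac:(lra)).
  assert (B2 := ln_1_add_bounds u (proj1 Hu)).
  assert (B3 : u ^ 2 <= D ^ 2 * / (m * (m + 1))).
  { apply Rle_trans with ((D * / (m + 1)) ^ 2); [apply pow_incr; auto |].
    rewrite Rpow_mult_distr, pow_inv. apply Rmult_le_compat_l; auto. apply pow2_ge_0. }
  set (w := / (m * (m + 1))) in *.
  replace ((x + D ^ 2 / 2 + (x ^ 2 + y ^ 2) / 2) / (m * (m + 1))) with
    (x * w + (D ^ 2 * w) / 2 + (x ^ 2 + y ^ 2) / 2 * w) by (unfold w; field; lra).
  assert (0 <= x ^ 2 + y ^ 2) by nra.
  assert ((x ^ 2 + y ^ 2) / 2 * / (m + 1) ^ 2 <= (x ^ 2 + y ^ 2) / 2 * w) by (apply Rmult_le_compat_l; lra).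
  assert (0 <= (x ^ 2 + y ^ 2) / 2 * / (m + 1) ^ 2) by (apply Rmult_le_pos; lra).
  assert (0 <= x * (ln (m + 1) - ln m - / (m + 1)) <= x * w).
  { split; [apply Rmult_le_pos | apply Rmult_le_compat_l]; lra. }
  assert (0 <= (x ^ 2 + y ^ 2) / 2 * w) by lra.
  apply Rabs_le_between. lra.
Qed.

Lemma CGamma_polar (x y : R) : 0 < x -> exists L Th : R,
  is_lim_seq (gam_log x y) L /\ CGamma (x, y) = polar L Th.
Proof.
  intros Hx. destruct (ex_lim_gam_log x y Hx) as [L HL]. destruct (ex_lim_gam_arg x y Hx) as [Th HT].
  exists L, Th. split; auto. unfold CGamma, CLim_seq.
  assert (HE : is_lim_seq (fun n => exp (gam_log x y n)) (exp L)).
  { apply (is_lim_seq_continuous exp); auto. apply derivable_continuous_pt, derivable_pt_exp. }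
  assert (HC : is_lim_seq (fun n => cos (gam_arg x y n)) (cos Th)).
  { apply (is_lim_seq_continuous cos); auto. apply continuity_cos. }
  assert (HS : is_lim_seq (fun n => sin (gam_arg x y n)) (sin Th)).
  { apply (is_lim_seq_continuous sin); auto. apply continuity_sin. }
  unfold polar. f_equal.
  - rewrite (is_lim_seq_unique _ (exp L * cos Th)); auto.
    apply (is_lim_seq_ext (fun n => exp (gam_log x y n) * cos (gam_arg x y n))).
    + intros n. now rewrite gamma_seq_polar.
    + now apply is_lim_seq_mult'.
  - rewrite (is_lim_seq_unique _ (exp L * sin Th)); auto.
    apply (is_lim_seq_ext (fun n => exp (gam_log x y n) * sin (gam_arg x y n))).
    + intros n. now rewrite gamma_seq_polar.
    + now apply is_lim_seq_mult'.
Qed.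

(** The Gamma quotients in [W0] and [W0'] are reciprocal, so the product is -2^(-3/4 - 1/4). The
    fourth power of [W0] is 1/8 of the squared modulus of the quotient, which
    [is_lim_seq_gamma_ratio] evaluates. *)
Lemma W0_values (a : R) :
  W0 a * W0' a = - 1 / 2 /\ 0 < W0 a /\ W0 a ^ 4 * (2 * PI * cosh (PI * a)) = Bint (3 / 4) a ^ 2.
Proof.
  destruct (CGamma_polar (1 / 4) (a / 2) ltac:(lra)) as [L1 [T1 [HL1 E1]]].
  destruct (CGamma_polar (3 / 4) (a / 2) ltac:(lra)) as [L3 [T3 [HL3 E3]]].
  assert (Z : forall r, (RtoC r + Ci * RtoC (a / 2))%C = (r, a / 2)).
  { intros r. unfold Cplus, Cmult, RtoC, Ci; simpl. f_equal; ring. }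
  unfold W0, W0'. rewrite !Z, E1, E3, !polar_div, !Cmod_polar.
  assert (S1 : sqrt (exp (L1 - L3)) = exp ((L1 - L3) / 2)).
  { rewrite <- (sqrt_pow2 (exp ((L1 - L3) / 2))) by (apply Rlt_le, exp_pos). f_equal.
    simpl. rewrite Rmult_1_r, <- exp_plus. f_equal. field. }
  assert (S3 : sqrt (exp (L3 - L1)) = exp (- ((L1 - L3) / 2))).
  { rewrite <- (sqrt_pow2 (exp (- ((L1 - L3) / 2)))) by (apply Rlt_le, exp_pos). f_equal.
    simpl. rewrite Rmult_1_r, <- exp_plus. f_equal. field. }
  rewrite S1, S3. unfold Rpower.
  split; [| split].
  - replace (exp (-3 / 4 * ln 2) * exp ((L1 - L3) / 2) * (- exp (-1 / 4 * ln 2) * exp (- ((L1 - L3) / 2))))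
      with (- (exp (-3 / 4 * ln 2) * exp (-1 / 4 * ln 2) * (exp ((L1 - L3) / 2) * exp (- ((L1 - L3) / 2))))) by ring.
    rewrite <- !exp_plus.
    replace (-3 / 4 * ln 2 + -1 / 4 * ln 2 + ((L1 - L3) / 2 + - ((L1 - L3) / 2))) with (- ln 2) by field.
    rewrite exp_Ropp, exp_ln by lra. field.
  - apply Rmult_lt_0_compat; apply exp_pos.
  - rewrite Rpow_mult_distr.
    assert (E2 : exp (-3 / 4 * ln 2) ^ 4 = / 8).
    { transitivity (exp (- (ln 2 + (ln 2 + ln 2)))).
      - simpl. rewrite Rmult_1_r, <- !exp_plus. f_equal. field.
      - rewrite exp_Ropp, !exp_plus, exp_ln by lra. field. }
    assert (EL : exp ((L1 - L3) / 2) ^ 4 = exp (2 * (L1 - L3))).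
    { simpl. rewrite Rmult_1_r, <- !exp_plus. f_equal. field. }
    rewrite E2, EL.
    assert (ET : exp (2 * (L1 - L3)) = 4 / PI * Bint (3 / 4) a ^ 2 / cosh (PI * a)).
    { assert (H1 := is_lim_seq_gamma_ratio a).
      assert (H2 : is_lim_seq (fun n => exp (2 * (gam_log (1 / 4) (a / 2) n - gam_log (3 / 4) (a / 2) n)))
        (exp (2 * (L1 - L3)))).
      { apply (is_lim_seq_continuous exp (fun n => 2 * (gam_log (1 / 4) (a / 2) n - gam_log (3 / 4) (a / 2) n))).
        - apply derivable_continuous_pt, derivable_pt_exp.
        - apply (is_lim_seq_scal_l _ 2 (Finite (L1 - L3))). apply is_lim_seq_minus'; [exact HL1 | exact HL3]. }
      (* Both sides are limits of the same sequence: the factorials cancel in the quotient of the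
         Euler-Gauss sequences, and the squared power of n is n^(2 (1/4 - 3/4)) = 1/n, for n >=
         1. *)
      enough (Hx : Finite (exp (2 * (L1 - L3))) = Finite (4 / PI * Bint (3 / 4) a ^ 2 / cosh (PI * a)))
        by (injection Hx; auto).
      rewrite <- (is_lim_seq_unique _ _ H1). rewrite <- (is_lim_seq_unique _ _ H2).
      apply Lim_seq_ext_loc. exists 1%nat. intros n Hn.
      assert (Hn1 : 1 <= INR n) by (apply (le_INR 1), Hn).
      unfold gam_log.
      set (s1 := sumn _ (S n)). set (s3 := sumn _ (S n)).
      replace (2 * (ln (INR (fact n)) + 1 / 4 * ln (INR n) - s1 - (ln (INR (fact n)) + 3 / 4 * ln (INR n) - s3)))
        with ((2 * (s3 - s1)) + - ln (INR n)) by field.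
      rewrite exp_plus, exp_Ropp, exp_ln by lra. apply (f_equal (fun t => t * / INR n)).
      unfold s1, s3. clear s1 s3 Hn Hn1. induction (S n) as [|k IH].
      - simpl. rewrite Rminus_diag, Rmult_0_r. apply exp_0.
      - rewrite prodn_S, <- IH, !sumn_S. cbv beta.
        set (A := sumn _ k). set (B := sumn _ k).
        assert (Q : forall r, 0 < r -> 0 < (r + INR k) ^ 2 + (a / 2) ^ 2).
        { intros r Hr. generalize (pos_INR k) (pow2_ge_0 (a / 2)); intros. nra. }
        assert (Q1 := Q (1 / 4) ltac:(lra)). assert (Q3 := Q (3 / 4) ltac:(lra)).
        transitivity (exp (2 * (A - B)) * exp (ln ((3 / 4 + INR k) ^ 2 + (a / 2) ^ 2) + - ln ((1 / 4 + INR k) ^ 2 + (a / 2) ^ 2))).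
        + rewrite <- exp_plus. f_equal. unfold A, B. field.
        + f_equal. rewrite exp_plus, exp_Ropp, !exp_ln by auto. reflexivity. }
    assert (0 < cosh (PI * a)).
    { unfold cosh. generalize (exp_pos (PI * a)) (exp_pos (- (PI * a))); lra. }
    rewrite ET. generalize PI_RGT_0; intros. field. lra.
Qed.

(** * The hypergeometric series *)

(** This is e^(-(1/2 + 2n) v) (1 + e^(-2v))^(-(1/2 + n)); for n = 0 it is (2 cosh v)^(-1/2). Each
    step multiplies it by e^(-2v) / (1 + e^(-2v)), which is at most 1/2 for v >= 0 and equals 1/2 at
    v = 0; this is where the argument 1/2 of F comes from. *)
Definition hker (n : nat) (v : R) : R :=
  exp (- (1 / 2 + 2 * INR n) * v - (1 / 2 + INR n) * ln (1 + exp (- 2 * v))).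

Lemma hker_S (n : nat) (v : R) : hker (S n) v = hker n v * (exp (- 2 * v) / (1 + exp (- 2 * v))).
Proof.
  assert (P := exp_pos (- 2 * v)).
  unfold hker. replace (exp (- 2 * v) / (1 + exp (- 2 * v))) with (exp (- 2 * v - ln (1 + exp (- 2 * v)))).
  - rewrite <- exp_plus, S_INR. f_equal. ring.
  - unfold Rminus, Rdiv. rewrite exp_plus, exp_Ropp, exp_ln by lra. reflexivity.
Qed.

Lemma is_derive_hker (n : nat) (v : R) :
  is_derive (hker n) v (- (1 / 2 + 2 * INR n) * hker n v + (1 + 2 * INR n) * hker (S n) v).
Proof.
  assert (P := exp_pos (- 2 * v)). rewrite hker_S. unfold hker. auto_derive; [lra |].
  unfold Rminus. field. lra.
Qed.

Lemma continuous_hker (n : nat) (v : R) : continuous (hker n) v.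
Proof. apply (is_derive_continuous _ _ _ (is_derive_hker n v)). Qed.

Lemma hker_bound (n : nat) (v : R) : 0 <= v -> 0 < hker n v <= (1 / 2) ^ n * exp (- v / 2).
Proof.
  intros Hv. split; [apply exp_pos |]. induction n as [|n IH].
  - simpl. rewrite Rmult_1_l. unfold hker. apply exp_le_compat. simpl INR.
    assert (P := exp_pos (- 2 * v)).
    assert (0 <= ln (1 + exp (- 2 * v))) by (rewrite <- ln_1; apply Rcomplements.ln_le; lra). lra.
  - rewrite hker_S. replace ((1 / 2) ^ S n * exp (- v / 2)) with ((1 / 2) ^ n * exp (- v / 2) * (1 / 2)) by (simpl; ring).
    assert (P := exp_pos (- 2 * v)).
    assert (Q : exp (- 2 * v) <= 1) by (rewrite <- exp_0; apply exp_le_compat; lra).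
    apply Rmult_le_compat; auto.
    + apply Rlt_le, exp_pos.
    + apply Rdiv_le_0_compat; lra.
    + apply Rmult_le_reg_r with (1 + exp (- 2 * v)); [lra |]. unfold Rdiv at 1.
      rewrite Rmult_assoc, Rinv_l by lra. lra.
Qed.

Lemma hker_0 (n : nat) : hker n 0 = / sqrt 2 * (1 / 2) ^ n.
Proof.
  induction n as [|n IH].
  - unfold hker. simpl. rewrite !Rmult_0_r, exp_0.
    assert (P : 0 < sqrt 2) by (apply sqrt_lt_R0; lra).
    transitivity (exp (- ln (sqrt 2))).
    + f_equal. replace 2 with (sqrt 2 * sqrt 2) at 5 by (apply sqrt_sqrt; lra).
      replace (1 + 1) with (sqrt 2 * sqrt 2) by (rewrite sqrt_sqrt; lra).
      rewrite ln_mult by auto. field.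
    + rewrite exp_Ropp, exp_ln by auto. ring.
  - rewrite hker_S, IH. rewrite Rmult_0_r, exp_0. simpl. field.
    assert (P : 0 < sqrt 2) by (apply sqrt_lt_R0; lra). lra.
Qed.

Lemma is_improper_exp_half : is_improper (fun v => exp (- v / 2)) 2.
Proof.
  apply is_lim_eq with (0 - (-2 * exp (- 0 / 2))).
  2:{ replace (- 0 / 2) with 0 by field. rewrite exp_0. ring. }
  apply (improper_FTC (fun v => -2 * exp (- v / 2))).
  - intros v. auto_derive; auto. unfold Rdiv. field.
  - intros v. cont_by_derive; auto.
  - apply is_lim_eq with (-2 * 0); [| ring].
    apply (is_lim_scal_l (fun v => exp (- v / 2)) (-2) p_infty 0).
    apply (is_lim_comp exp (fun v => - v / 2) p_infty 0 m_infty).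
    + apply is_lim_exp_m.
    + apply is_lim_spec. intros M. exists (2 * Rabs M). intros v Hv.
      generalize (Rle_abs (- M)); rewrite Rabs_Ropp; lra.
    + exists 0; intros; discriminate.
Qed.

Lemma ex_improper_hker (f : R -> R) (n : nat) :
  (forall v, continuous f v) -> (forall v, Rabs (f v) <= 1) ->
  exists l, is_improper (fun v => f v * hker n v) l /\ Rabs l <= 2 * (1 / 2) ^ n.
Proof.
  intros Cf Bf.
  destruct (ex_improper_dom (fun v => f v * hker n v)
    (fun v => (1 / 2) ^ n * exp (- v / 2) + 0 * exp (- v / 2)) ((1 / 2) ^ n * 2 + 0 * 2)) as [l [Hl Bl]].
  - intros v. apply (continuous_mult f (hker n)); auto using continuous_hker.
  - intros v. cont_by_derive; auto.
  - intros v Hv. destruct (hker_bound n v Hv) as [H1 H2].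
    rewrite Rabs_mult, (Rabs_pos_eq (hker n v)) by lra. generalize (Rabs_pos (f v)) (Bf v); intros. nra.
  - apply is_improper_lin; try apply is_improper_exp_half; intros; cont_by_derive; auto.
  - exists l. split; auto. lra.
Qed.

Definition cosI (a : R) (n : nat) : R :=
  real (Lim (fun b => RInt (fun v => cos (a * v) * hker n v) 0 b) p_infty).
Definition sinI (a : R) (n : nat) : R :=
  real (Lim (fun b => RInt (fun v => sin (a * v) * hker n v) 0 b) p_infty).

Lemma cosI_correct (a : R) (n : nat) :
  is_improper (fun v => cos (a * v) * hker n v) (cosI a n) /\ Rabs (cosI a n) <= 2 * (1 / 2) ^ n.
Proof.
  destruct (ex_improper_hker (fun v => cos (a * v)) n) as [l [Hl Bl]].
  - intros v; cont_by_derive; auto.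
  - intros v. apply Rabs_le, COS_bound.
  - unfold cosI. now rewrite (is_lim_unique _ _ _ Hl).
Qed.

Lemma sinI_correct (a : R) (n : nat) :
  is_improper (fun v => sin (a * v) * hker n v) (sinI a n) /\ Rabs (sinI a n) <= 2 * (1 / 2) ^ n.
Proof.
  destruct (ex_improper_hker (fun v => sin (a * v)) n) as [l [Hl Bl]].
  - intros v; cont_by_derive; auto.
  - intros v. apply Rabs_le, SIN_bound.
  - unfold sinI. now rewrite (is_lim_unique _ _ _ Hl).
Qed.

Lemma is_lim_mul_hker (f : R -> R) (n : nat) :
  (forall v, Rabs (f v) <= 1) -> is_lim (fun v => f v * hker n v) p_infty 0.
Proof.
  intros Bf. apply (is_lim_p_infty_abs _ _ (fun v => exp (- v / 2))).
  - apply (is_lim_comp exp (fun v => - v / 2) p_infty 0 m_infty).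
    + apply is_lim_exp_m.
    + apply is_lim_spec. intros M. exists (2 * Rabs M). intros v Hv.
      generalize (Rle_abs (- M)); rewrite Rabs_Ropp; lra.
    + exists 0; intros; discriminate.
  - exists 0; intros v Hv. rewrite Rminus_0_r. destruct (hker_bound n v (Rlt_le _ _ Hv)) as [H1 H2].
    rewrite Rabs_mult, (Rabs_pos_eq (hker n v)) by lra.
    assert ((1 / 2) ^ n <= 1) by (apply Rle_trans with (1 ^ n); [apply pow_incr; lra | rewrite pow1; lra]).
    assert (hker n v <= exp (- v / 2)) by (generalize (exp_pos (- v / 2)); nra).
    generalize (Rabs_pos (f v)) (Bf v); intros. nra.
Qed.

(** One integration by parts: with L_n = [cosI a n] + i [sinI a n], these are the real and imaginary
    parts of (1/2 + 2n - ia) L_n = [hker n 0] + (1 + 2n) L_(n+1). *)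
Lemma hker_integral_relations (a : R) (n : nat) :
  (1 / 2 + 2 * INR n) * cosI a n + a * sinI a n = hker n 0 + (1 + 2 * INR n) * cosI a (S n) /\
  (1 / 2 + 2 * INR n) * sinI a n - a * cosI a n = (1 + 2 * INR n) * sinI a (S n).
Proof.
  set (k := 1 / 2 + 2 * INR n). set (c := 1 + 2 * INR n).
  destruct (cosI_correct a n) as [C0 _]. destruct (cosI_correct a (S n)) as [C1 _].
  destruct (sinI_correct a n) as [S0 _]. destruct (sinI_correct a (S n)) as [S1 _].
  assert (Cc : forall m v, continuous (fun v => cos (a * v) * hker m v) v).
  { intros m v. apply (continuous_mult (fun v => cos (a * v)) (hker m)); [cont_by_derive; auto | apply continuous_hker]. }
  assert (Cs : forall m v, continuous (fun v => sin (a * v) * hker m v) v).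
  { intros m v. apply (continuous_mult (fun v => sin (a * v)) (hker m)); [cont_by_derive; auto | apply continuous_hker]. }
  split.
  - assert (I1 := is_improper_lin _ _ _ _ k a (Cc n) (Cs n) C0 S0).
    assert (I2 := is_improper_lin _ _ _ _ 1 (- c) (fun v => continuous_lin2 _ _ k a v (Cc n v) (Cs n v)) (Cc (S n)) I1 C1).
    assert (I3 : is_improper (fun v => 1 * (k * (cos (a * v) * hker n v) + a * (sin (a * v) * hker n v))
      + - c * (cos (a * v) * hker (S n) v)) (- 0 - - (cos (a * 0) * hker n 0))).
    { apply (improper_FTC (fun v => - (cos (a * v) * hker n v))).
      - intros v.
        replace (1 * (k * (cos (a * v) * hker n v) + a * (sin (a * v) * hker n v)) + - c * (cos (a * v) * hker (S n) v))
        with (- ((- (a * sin (a * v))) * hker n v + cos (a * v) * (- k * hker n v + c * hker (S n) v))) by ring.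
        apply (is_derive_opp (fun v => cos (a * v) * hker n v)).
        apply (is_derive_mult (fun v => cos (a * v)) (hker n) v); [auto_derive; auto; ring | apply is_derive_hker |].
        intros; apply Rmult_comm.
      - intros v. apply continuous_lin2; auto. apply continuous_lin2; auto.
      - apply (is_lim_opp (fun v => cos (a * v) * hker n v) p_infty 0). apply (is_lim_mul_hker (fun v => cos (a * v))).
        intros v; apply Rabs_le, COS_bound. }
    assert (E := is_improper_unique _ _ _ I2 I3). rewrite Rmult_0_r, cos_0 in E. lra.
  - assert (I1 := is_improper_lin _ _ _ _ k (- a) (Cs n) (Cc n) S0 C0).
    assert (I2 := is_improper_lin _ _ _ _ 1 (- c) (fun v => continuous_lin2 _ _ k (- a) v (Cs n v) (Cc n v)) (Cs (S n)) I1 S1).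
    assert (I3 : is_improper (fun v => 1 * (k * (sin (a * v) * hker n v) + - a * (cos (a * v) * hker n v))
      + - c * (sin (a * v) * hker (S n) v)) (- 0 - - (sin (a * 0) * hker n 0))).
    { apply (improper_FTC (fun v => - (sin (a * v) * hker n v))).
      - intros v.
        replace (1 * (k * (sin (a * v) * hker n v) + - a * (cos (a * v) * hker n v)) + - c * (sin (a * v) * hker (S n) v))
        with (- ((a * cos (a * v)) * hker n v + sin (a * v) * (- k * hker n v + c * hker (S n) v))) by ring.
        apply (is_derive_opp (fun v => sin (a * v) * hker n v)).
        apply (is_derive_mult (fun v => sin (a * v)) (hker n) v); [auto_derive; auto; ring | apply is_derive_hker |].
        intros; apply Rmult_comm.
      - intros v. apply continuous_lin2; auto. apply continuous_lin2; auto.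
      - apply (is_lim_opp (fun v => sin (a * v) * hker n v) p_infty 0). apply (is_lim_mul_hker (fun v => sin (a * v))).
        intros v; apply Rabs_le, SIN_bound. }
    assert (E := is_improper_unique _ _ _ I2 I3). rewrite Rmult_0_r, sin_0 in E. lra.
Qed.

(** * Complex partial sums and the hypergeometric series *)

Fixpoint Csum (f : nat -> C) (n : nat) : C :=
  match n with O => RtoC 0 | S m => Cplus (Csum f m) (f m) end.

Lemma Re_Csum (f : nat -> C) (n : nat) : Re (Csum f (S n)) = sum_n (fun k => Re (f k)) n.
Proof.
  induction n as [|n IH].
  - rewrite sum_O. change (0 + Re (f O) = Re (f O)). ring.
  - rewrite sum_Sn, <- IH. reflexivity.
Qed.

Lemma Im_Csum (f : nat -> C) (n : nat) : Im (Csum f (S n)) = sum_n (fun k => Im (f k)) n.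
Proof.
  induction n as [|n IH].
  - rewrite sum_O. change (0 + Im (f O) = Im (f O)). ring.
  - rewrite sum_Sn, <- IH. reflexivity.
Qed.

Lemma Cpoch_1 (n : nat) : Cpoch (RtoC 1) n = RtoC (INR (fact n)).
Proof.
  induction n as [|n IH]; [reflexivity |].
  change (Cpoch (RtoC 1) (S n)) with (Cmult (Cpoch (RtoC 1) n) (Cplus (RtoC 1) (RtoC (INR n)))).
  rewrite IH, <- RtoC_plus, <- RtoC_mult. f_equal. rewrite fact_simpl, mult_INR, S_INR. ring.
Qed.

Lemma Re_le_Cmod (z : C) : Rabs (Re z) <= Cmod z.
Proof. apply Rle_trans with (1 := Rmax_l _ (Rabs (Im z))), Rmax_Cmod. Qed.

Lemma Im_le_Cmod (z : C) : Rabs (Im z) <= Cmod z.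
Proof. apply Rle_trans with (1 := Rmax_r (Rabs (Re z)) _), Rmax_Cmod. Qed.

Lemma CSeries_eq (f : nat -> C) (l : C) (e : nat -> R) :
  (forall n, Cmod (Cminus l (Csum f n)) <= e n) -> is_lim_seq e 0 -> CSeries f = l.
Proof.
  intros H He.
  assert (He' : is_lim_seq (fun n => e (S n)) 0) by now apply is_lim_seq_incr_1 in He.
  assert (Aux : forall (u : nat -> R) (x : R), (forall n, Rabs (x - sum_n u n) <= e (S n)) -> Series u = x).
  { intros u x Hu. apply is_series_unique. unfold is_series.
    apply (is_lim_seq_le_le (fun n => x - e (S n)) (sum_n u) (fun n => x + e (S n)) x).
    - intros n. specialize (Hu n). apply Rabs_le_between in Hu. lra.
    - replace (Finite x) with (Finite (x - 0)) by (f_equal; ring).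
      apply (is_lim_seq_minus' _ _ x 0); auto. apply is_lim_seq_const.
    - replace (Finite x) with (Finite (x + 0)) by (f_equal; ring).
      apply (is_lim_seq_plus' _ _ x 0); auto. apply is_lim_seq_const. }
  unfold CSeries. rewrite (surjective_pairing l). f_equal.
  - apply Aux. intros n. rewrite <- Re_Csum. apply Rle_trans with (2 := H (S n)).
    apply Rle_trans with (2 := Re_le_Cmod _). right. reflexivity.
  - apply Aux. intros n. rewrite <- Im_Csum. apply Rle_trans with (2 := H (S n)).
    apply Rle_trans with (2 := Im_le_Cmod _). right. reflexivity.
Qed.

Lemma RtoC_neq_0 (x : R) : x <> 0 -> RtoC x <> RtoC 0.
Proof. intros H E. apply H. now injection E. Qed.

Lemma Re_pos_neq_0 (z : C) : 0 < Re z -> z <> RtoC 0.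
Proof. intros H E. rewrite E in H. simpl in H. lra. Qed.

Lemma is_lim_seq_linear_half_pow (c d : R) : is_lim_seq (fun n => (c + d * INR n) * (1 / 2) ^ n) 0.
Proof.
  assert (G : is_lim_seq (fun n => (3 / 4) ^ n) 0) by (apply is_lim_seq_geom; rewrite Rabs_pos_eq; lra).
  assert (B : forall n, (1 + INR n) * (1 / 2) ^ n <= 3 * (3 / 4) ^ n).
  { intros n. replace ((3 / 4) ^ n) with ((3 / 2) ^ n * (1 / 2) ^ n) by (rewrite <- Rpow_mult_distr; f_equal; field).
    rewrite <- Rmult_assoc. apply Rmult_le_compat_r; [apply pow_le; lra |].
    assert (H := poly n (1 / 2) ltac:(lra)). replace (1 + 1 / 2) with (3 / 2) in H by field.
    generalize (pos_INR n); lra. }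
  apply is_lim_seq_abs_0.
  apply (is_lim_seq_le_le (fun _ => 0) _ (fun n => ((Rabs c + Rabs d) * 3) * (3 / 4) ^ n)).
  - intros n. split; [apply Rabs_pos |].
    rewrite Rabs_mult, (Rabs_pos_eq ((1 / 2) ^ n)) by (apply pow_le; lra).
    rewrite Rmult_assoc. apply Rle_trans with ((Rabs c + Rabs d) * ((1 + INR n) * (1 / 2) ^ n)).
    + rewrite <- Rmult_assoc. apply Rmult_le_compat_r; [apply pow_le; lra |].
      apply Rle_trans with (1 := Rabs_triang _ _). rewrite Rabs_mult, (Rabs_pos_eq (INR n)) by apply pos_INR.
      generalize (Rabs_pos c) (Rabs_pos d) (pos_INR n); intros. nra.
    + apply Rmult_le_compat_l; auto. generalize (Rabs_pos c) (Rabs_pos d); lra.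
  - apply is_lim_seq_const.
  - replace (Finite 0) with (Rbar_mult ((Rabs c + Rabs d) * 3) 0) by (simpl; f_equal; ring).
    apply is_lim_seq_scal_l, G.
Qed.

(* [hyp2F1 (1/2) 1 c (1/2)] is the expansion of [int_0^oo e^{iav} hker 0 v dv] obtained by
   repeated integration by parts. *)
Lemma Yfun_sinI (a : R) : 2 * Yfun a = sqrt 2 * sinI a 0.
Proof.
  set (c := (RtoC (5 / 4) - Ci * RtoC (a / 2))%C).
  assert (Ec : c = (5 / 4, - (a / 2))).
  { unfold c, Cminus, Cplus, Copp, Cmult, Ci, RtoC; simpl. f_equal; ring. }
  set (L := fun n => (cosI a n, sinI a n) : C).
  set (M := fun n => Cmult (1 / 2 + 2 * INR n, - a) (L n)).
  assert (HM : forall n, M n = Cplus (RtoC (hker n 0)) (Cmult (RtoC (1 + 2 * INR n)) (L (S n)))).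
  { intros n. destruct (hker_integral_relations a n) as [H1 H2].
    unfold M, L, Cmult, Cplus, RtoC; simpl fst; simpl snd. f_equal; lra. }
  assert (Hcn : forall n, 5 / 4 + INR n <= Cmod (Cplus c (RtoC (INR n)))).
  { intros n. apply Rle_trans with (2 := Re_le_Cmod _). rewrite Ec. simpl.
    apply Rle_trans with (2 := Rle_abs _). lra. }
  assert (Hcn0 : forall n, Cplus c (RtoC (INR n)) <> RtoC 0).
  { intros n. apply Cmod_gt_0. generalize (Hcn n) (pos_INR n); lra. }
  assert (Hp0 : forall n, Cpoch c n <> RtoC 0).
  { induction n as [|n IH]; simpl; [apply RtoC_neq_0; lra |]. apply Cmult_neq_0; auto. }
  set (q := fun n => Cdiv (Cpoch (RtoC (1 / 2)) n) (Cpoch c n)).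
  assert (Hq : forall n, q (S n) = Cmult (q n) (Cdiv (RtoC (1 / 2 + INR n)) (Cplus c (RtoC (INR n))))).
  { intros n. unfold q.
    change (Cpoch c (S n)) with (Cmult (Cpoch c n) (Cplus c (RtoC (INR n)))).
    change (Cpoch (RtoC (1 / 2)) (S n)) with (Cmult (Cpoch (RtoC (1 / 2)) n) (Cplus (RtoC (1 / 2)) (RtoC (INR n)))).
    rewrite RtoC_plus. field. split; auto. }
  (* Each factor has numerator 1/2 + n and a denominator of real part 5/4 + n. *)
  assert (Bq : forall n, Cmod (q n) <= 1).
  { induction n as [|n IH].
    - unfold q; simpl. rewrite Cmod_div by (apply RtoC_neq_0; lra). rewrite Cmod_1. lra.
    - rewrite Hq, Cmod_mult, Cmod_div, Cmod_R by auto.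
      assert (Hn := pos_INR n). rewrite Rabs_pos_eq by lra. specialize (Hcn n).
      assert (D : 0 <= (1 / 2 + INR n) / Cmod (Cplus c (RtoC (INR n))) <= 1).
      { split; [apply Rdiv_le_0_compat; lra |].
        apply Rmult_le_reg_r with (Cmod (Cplus c (RtoC (INR n)))); [lra |].
        unfold Rdiv. rewrite Rmult_assoc, Rinv_l by lra. lra. }
      generalize (Cmod_ge_0 (q n)); intros. nra. }
  (* Iterating the recurrence n times gives a partial sum with exact remainder [q n * M n]. The
     quotient of Pochhammer symbols arises because 1 + 2n = 2 (1/2 + n) and the next prefactor 1/2 +
     2(n+1) - ia is 2 (c + n). *)
  assert (Hsum : forall n, M O = Cplus (Csum (fun s => Cmult (q s) (RtoC (hker s 0))) n) (Cmult (q n) (M n))).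
  { induction n as [|n IH].
    - simpl. unfold q; simpl. field.
    - rewrite IH at 1. rewrite (HM n) at 1. rewrite Hq.
      change (Csum (fun s => Cmult (q s) (RtoC (hker s 0))) (S n)) with
        (Cplus (Csum (fun s => Cmult (q s) (RtoC (hker s 0))) n) (Cmult (q n) (RtoC (hker n 0)))).
      assert (EM : M (S n) = Cmult (RtoC 2) (Cmult (Cplus c (RtoC (INR n))) (L (S n)))).
      { unfold M. rewrite Cmult_assoc. f_equal. rewrite Ec, S_INR.
        unfold Cmult, Cplus, RtoC; simpl. f_equal; field. }
      rewrite EM. replace (RtoC (1 + 2 * INR n)) with (Cmult (RtoC 2) (RtoC (1 / 2 + INR n))).
      2:{ rewrite <- RtoC_mult. f_equal. field. }
      field. auto. }
  assert (BM : forall n, Cmod (M n) <= (3 + 4 * INR n) * (1 / 2) ^ n).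
  { intros n. rewrite HM. apply Rle_trans with (1 := Cmod_triangle _ _).
    rewrite Cmod_mult, !Cmod_R. assert (Hn := pos_INR n).
    assert (Ph : 0 < (1 / 2) ^ n) by (apply pow_lt; lra).
    rewrite (Rabs_pos_eq (1 + 2 * INR n)) by lra.
    assert (B1 : Rabs (hker n 0) <= (1 / 2) ^ n).
    { destruct (hker_bound n 0 (Rle_refl _)) as [H1 H2]. rewrite Rabs_pos_eq by lra.
      replace (- 0 / 2) with 0 in H2 by field. rewrite exp_0 in H2. lra. }
    assert (B2 : Cmod (L (S n)) <= 2 * (1 / 2) ^ n).
    { unfold L. destruct (cosI_correct a (S n)) as [_ H1]. destruct (sinI_correct a (S n)) as [_ H2].
      simpl pow in H1, H2.
      replace ((cosI a (S n), sinI a (S n)) : C) with (Cplus (RtoC (cosI a (S n))) (Cmult Ci (RtoC (sinI a (S n))))).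
      - apply Rle_trans with (1 := Cmod_triangle _ _). rewrite Cmod_mult, !Cmod_R.
        replace (Cmod Ci) with 1; [lra |]. unfold Cmod, Ci; simpl.
        replace (0 * (0 * 1) + 1 * (1 * 1)) with 1 by ring. now rewrite sqrt_1.
      - unfold Cplus, Cmult, Ci, RtoC; simpl. f_equal; ring. }
    apply Rle_trans with ((1 / 2) ^ n + (1 + 2 * INR n) * (2 * (1 / 2) ^ n)); [| right; ring].
    apply Rplus_le_compat; auto. apply Rmult_le_compat_l; lra. }
  assert (Ps : 0 < sqrt 2) by (apply sqrt_lt_R0; lra).
  assert (Hs2 : sqrt 2 * / sqrt 2 = 1) by (field; lra).
  assert (HF : hyp2F1 (RtoC (1 / 2)) (RtoC 1) c (RtoC (1 / 2)) = Cmult (RtoC (sqrt 2)) (M O)).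
  { unfold hyp2F1. apply (CSeries_eq _ _ (fun n => (3 * sqrt 2 + 4 * sqrt 2 * INR n) * (1 / 2) ^ n)).
    2: apply is_lim_seq_linear_half_pow.
    intros n.
    assert (Et : forall m, Csum (fun s => Cdiv (Cmult (Cmult (Cpoch (RtoC (1 / 2)) s) (Cpoch (RtoC 1) s)) (Cpow (RtoC (1 / 2)) s))
      (Cmult (Cpoch c s) (RtoC (INR (fact s))))) m = Cmult (RtoC (sqrt 2)) (Csum (fun s => Cmult (q s) (RtoC (hker s 0))) m)).
    { induction m as [|m IH]; [simpl; ring |]. cbn [Csum]. rewrite IH.
      rewrite Cmult_plus_distr_l. f_equal. rewrite Cpoch_1, hker_0, RtoC_mult, <- RtoC_pow. unfold q.
      assert (Hf : RtoC (INR (fact m)) <> RtoC 0) by (apply RtoC_neq_0, INR_fact_neq_0).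
      transitivity (Cmult (Cmult (RtoC (sqrt 2)) (RtoC (/ sqrt 2))) (Cmult (Cdiv (Cpoch (RtoC (1 / 2)) m) (Cpoch c m)) (RtoC ((1 / 2) ^ m)))).
      - rewrite <- RtoC_mult, Hs2. field. split; auto.
      - field. auto. }
    rewrite Et.
    replace (Cminus (Cmult (RtoC (sqrt 2)) (M O)) (Cmult (RtoC (sqrt 2)) (Csum (fun s => Cmult (q s) (RtoC (hker s 0))) n)))
      with (Cmult (RtoC (sqrt 2)) (Cmult (q n) (M n))) by (rewrite (Hsum n); ring).
    rewrite !Cmod_mult, Cmod_R, Rabs_pos_eq by lra.
    replace ((3 * sqrt 2 + 4 * sqrt 2 * INR n) * (1 / 2) ^ n) with (sqrt 2 * (1 * ((3 + 4 * INR n) * (1 / 2) ^ n))) by ring.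
    apply Rmult_le_compat_l; [lra |]. apply Rmult_le_compat; auto using Cmod_ge_0. }
  unfold Yfun. fold c. rewrite HF.
  assert (D0 : (RtoC 1 - Ci * RtoC (2 * a))%C <> RtoC 0).
  { apply Re_pos_neq_0. unfold Cminus, Cplus, Copp, Cmult, Ci, RtoC; simpl. lra. }
  replace (Cmult (Cinv (RtoC 1 - Ci * RtoC (2 * a))%C) (Cmult (RtoC (sqrt 2)) (M O)))
    with (Cmult (RtoC (sqrt 2 / 2)) (L O)).
  - unfold L, Cmult, RtoC; simpl. field.
  - replace (M O) with (Cmult (RtoC (1 / 2)) (Cmult (RtoC 1 - Ci * RtoC (2 * a))%C (L O))).
    + replace (RtoC (sqrt 2 / 2)) with (Cmult (RtoC (sqrt 2)) (RtoC (1 / 2))).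
      * field. exact D0.
      * rewrite <- RtoC_mult. f_equal. field.
    + unfold M. rewrite Cmult_assoc. f_equal.
      unfold Cminus, Cplus, Copp, Cmult, Ci, RtoC; simpl. f_equal; field.
Qed.

(** * Contour deformation *)

(** For z = v + ip one has cosh z = e^(-v + ip) (e^(2v) + e^(-2ip)) / 2. The bracket is [chX v p] -
    i [chY p], and [chN v p] is its squared modulus. Writing cos 2p as 2 cos(p)^2 - 1 makes
    positivity visible for v > 0, and for v = 0 while cos p is nonzero. *)
Definition chX (v p : R) : R := exp (2 * v) - 1 + 2 * (cos p * cos p).
Definition chY (p : R) : R := 2 * (sin p * cos p).
Definition chN (v p : R) : R := (exp (2 * v) - 1) * (exp (2 * v) - 1) + 4 * (cos p * cos p) * exp (2 * v).

(* [cosh (v + i p) ^ (-1/2) = exp (- chM v p - i * chA v p)] where [chX > 0]. *)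
Definition chM (v p : R) : R := (ln (chN v p) - 2 * v - 2 * ln 2) / 4.
Definition chA (v p : R) : R := (p - atan (chY p / chX v p)) / 2.

(** [chP] + i [chQ] is tanh(z)/2, the derivative of log(cosh z)/2 = [chM] + i [chA]. *)
Definition chP (v p : R) : R := exp (2 * v) * chX v p / chN v p - 1 / 2.
Definition chQ (v p : R) : R := exp (2 * v) * chY p / chN v p.

Lemma sin_sin (p : R) : sin p * sin p = 1 - cos p * cos p.
Proof. generalize (sin2_cos2 p). unfold Rsqr. lra. Qed.

Lemma chN_eq (v p : R) : chN v p = chX v p * chX v p + chY p * chY p.
Proof.
  unfold chN, chX, chY.
  transitivity ((exp (2 * v) - 1 + 2 * (cos p * cos p)) * (exp (2 * v) - 1 + 2 * (cos p * cos p))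
    + 4 * (sin p * sin p) * (cos p * cos p)); [rewrite sin_sin; ring | ring].
Qed.

Lemma chN_pos (v p : R) : 0 < chX v p -> 0 < chN v p.
Proof. intros H. rewrite chN_eq. nra. Qed.

Lemma is_derive_atan_div (x y : R -> R) (t x' y' : R) :
  is_derive x t x' -> is_derive y t y' -> x t <> 0 ->
  is_derive (fun t => atan (y t / x t)) t ((y' * x t - y t * x') / (x t * x t + y t * y t)).
Proof.
  intros Hx Hy H0. assert (Hp : 0 < x t * x t + y t * y t) by (generalize (Rsqr_pos_lt _ H0); unfold Rsqr; nra).
  auto_derive.
  - repeat split; auto; eexists; eauto.
  - replace (Derive (fun t => x t) t) with x' by (symmetry; apply is_derive_unique, Hx).
    replace (Derive (fun t => y t) t) with y' by (symmetry; apply is_derive_unique, Hy).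
    field. repeat split; auto; lra.
Qed.

Lemma is_derive_chM_v (v p : R) : 0 < chX v p -> is_derive (fun v => chM v p) v (chP v p).
Proof.
  intros H. assert (HN := chN_pos v p H). unfold chM, chP. unfold chN, chX in *.
  auto_derive; [lra |]. field. lra.
Qed.

Lemma is_derive_chM_p (v p : R) : 0 < chX v p -> is_derive (fun p => chM v p) p (- chQ v p).
Proof.
  intros H. assert (HN := chN_pos v p H). unfold chM, chQ, chY. unfold chN, chX in *.
  auto_derive; [lra |]. field. lra.
Qed.

Lemma is_derive_chA_v (v p : R) : 0 < chX v p -> is_derive (fun v => chA v p) v (chQ v p).
Proof.
  intros H. assert (HN := chN_pos v p H). unfold chA, chQ.
  replace (exp (2 * v) * chY p / chN v p) with
    ((0 - (0 * chX v p - chY p * (2 * exp (2 * v))) / (chX v p * chX v p + chY p * chY p)) * / 2)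
    by (rewrite <- chN_eq; field; lra).
  apply (is_derive_ext (fun v => (p - atan (chY p / chX v p)) * / 2)); [reflexivity |].
  apply (is_derive_scal_l (V := R_NormedModule) (fun v => p - atan (chY p / chX v p))).
  apply (is_derive_minus (fun _ => p)); [apply (is_derive_const (V := R_NormedModule) p) |].
  apply (is_derive_atan_div (fun v => chX v p) (fun _ => chY p)); [| apply (is_derive_const (V := R_NormedModule) (chY p)) | lra].
  unfold chX. auto_derive; auto. ring.
Qed.

Lemma is_derive_chA_p (v p : R) : 0 < chX v p -> is_derive (fun p => chA v p) p (chP v p).
Proof.
  intros H. assert (HN := chN_pos v p H). unfold chA, chP.
  replace (exp (2 * v) * chX v p / chN v p - 1 / 2) with
    ((1 - ((2 * (cos p * cos p - sin p * sin p)) * chX v p - chY p * (- 4 * (sin p * cos p)))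
      / (chX v p * chX v p + chY p * chY p)) * / 2).
  2:{ rewrite <- chN_eq.
      replace ((2 * (cos p * cos p - sin p * sin p)) * chX v p - chY p * (- 4 * (sin p * cos p)))
        with (2 * chN v p - 2 * exp (2 * v) * chX v p).
      - field. lra.
      - transitivity (2 * (cos p * cos p - sin p * sin p) * chX v p + 8 * (sin p * sin p) * (cos p * cos p)).
        + rewrite sin_sin. unfold chN, chX. ring.
        + unfold chY. ring. }
  apply (is_derive_ext (fun p => (p - atan (chY p / chX v p)) * / 2)); [reflexivity |].
  apply (is_derive_scal_l (V := R_NormedModule) (fun p => p - atan (chY p / chX v p))).
  apply (is_derive_minus (K := R_AbsRing) (V := R_NormedModule) (fun p : R => p) (fun p : R => atan (chY p / chX v p)) p 1); [apply (is_derive_id (K := R_AbsRing)) |].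
  apply (is_derive_atan_div (fun p => chX v p) chY); [| | lra].
  - unfold chX. auto_derive; auto. ring.
  - unfold chY. auto_derive; auto. ring.
Qed.

(* Real and imaginary parts of [exp (i a z) * cosh z ^ (-1/2)] at [z = v + i p], and of its
   derivative. *)
Definition cR (a v p : R) : R := exp (- a * p - chM v p) * cos (a * v - chA v p).
Definition cI (a v p : R) : R := exp (- a * p - chM v p) * sin (a * v - chA v p).
Definition dR (a v p : R) : R :=
  exp (- a * p - chM v p) * (- chP v p * cos (a * v - chA v p) - (a - chQ v p) * sin (a * v - chA v p)).
Definition dI (a v p : R) : R :=
  exp (- a * p - chM v p) * (- chP v p * sin (a * v - chA v p) + (a - chQ v p) * cos (a * v - chA v p)).

Lemma cauchy_riemann (a v p : R) : 0 < chX v p ->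
  (is_derive (fun v => cR a v p) v (dR a v p) /\ is_derive (fun v => cI a v p) v (dI a v p)) /\
  (is_derive (fun p => cR a v p) p (- dI a v p) /\ is_derive (fun p => cI a v p) p (dR a v p)).
Proof.
  intros H.
  assert (Mv := is_derive_chM_v v p H). assert (Mp := is_derive_chM_p v p H).
  assert (Av := is_derive_chA_v v p H). assert (Ap := is_derive_chA_p v p H).
  unfold cR, cI, dR, dI.
  split; split; auto_derive;
    try (repeat split; auto; try (eexists; eassumption); fail);
    try replace (Derive (fun v => chM v p) v) with (chP v p) by (symmetry; apply is_derive_unique, Mv);
    try replace (Derive (fun v => chA v p) v) with (chQ v p) by (symmetry; apply is_derive_unique, Av);
    try replace (Derive (fun p => chM v p) p) with (- chQ v p) by (symmetry; apply is_derive_unique, Mp);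
    try replace (Derive (fun p => chA v p) p) with (chP v p) by (symmetry; apply is_derive_unique, Ap);
    unfold Rminus; ring.
Qed.

Lemma continuity_2d_ch (v p : R) : 0 < chX v p ->
  continuity_2d_pt chM v p /\ continuity_2d_pt chA v p /\
  continuity_2d_pt chP v p /\ continuity_2d_pt chQ v p.
Proof.
  intros H. assert (HN := chN_pos v p H).
  assert (CX : continuity_2d_pt chX v p) by (unfold chX; c2d; auto_derive; auto).
  assert (CY : continuity_2d_pt (fun _ p => chY p) v p) by (unfold chY; c2d; auto_derive; auto).
  assert (CN : continuity_2d_pt chN v p) by (unfold chN; c2d; auto_derive; auto).
  unfold chM, chA, chP, chQ, Rdiv.
  repeat split; c2d; auto; try (auto_derive; auto; lra); try lra.
Qed.

(* [Re ((e^{pi a} - i) f(z))] summed over [z = v + i p] and its mirror image [v + i (pi - p)],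
   where [f(z) = e^{iaz} cosh z ^ (-1/2)], and the corresponding imaginary part. *)
Definition cG (a v p : R) : R :=
  exp (PI * a) * cR a v p + cI a v p - cI (- a) v p - exp (- (PI * a)) * cR (- a) v p.
Definition cT (a v p : R) : R :=
  exp (PI * a) * cI a v p - cR a v p + cR (- a) v p - exp (- (PI * a)) * cI (- a) v p.
Definition dG (a v p : R) : R :=
  exp (PI * a) * dR a v p + dI a v p - dI (- a) v p - exp (- (PI * a)) * dR (- a) v p.

(** * Regularity of the folded integrand and Cauchy's theorem *)

Lemma is_derive_comb4 (f1 f2 f3 f4 : R -> R) (x d1 d2 d3 d4 a b : R) :
  is_derive f1 x d1 -> is_derive f2 x d2 -> is_derive f3 x d3 -> is_derive f4 x d4 ->
  is_derive (fun x => a * f1 x + f2 x - f3 x - b * f4 x) x (a * d1 + d2 - d3 - b * d4).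
Proof.
  intros H1 H2 H3 H4. auto_derive; [repeat split; auto; eexists; eassumption |].
  replace (Derive (fun x => f1 x) x) with d1 by (symmetry; apply is_derive_unique, H1).
  replace (Derive (fun x => f2 x) x) with d2 by (symmetry; apply is_derive_unique, H2).
  replace (Derive (fun x => f3 x) x) with d3 by (symmetry; apply is_derive_unique, H3).
  replace (Derive (fun x => f4 x) x) with d4 by (symmetry; apply is_derive_unique, H4).
  ring.
Qed.

Lemma is_derive_cG (a v p : R) : 0 < chX v p -> is_derive (fun v => cG a v p) v (dG a v p).
Proof.
  intros H. destruct (cauchy_riemann a v p H) as [[H1 H2] _].
  destruct (cauchy_riemann (- a) v p H) as [[H3 H4] _].
  unfold cG, dG. now apply is_derive_comb4.
Qed.

Lemma is_derive_cT (a v p : R) : 0 < chX v p -> is_derive (fun p => cT a v p) p (dG a v p).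
Proof.
  intros H. destruct (cauchy_riemann a v p H) as [_ [H1 H2]].
  destruct (cauchy_riemann (- a) v p H) as [_ [H3 H4]].
  unfold cT, dG.
  replace (exp (PI * a) * dR a v p + dI a v p - dI (- a) v p - exp (- (PI * a)) * dR (- a) v p)
    with (exp (PI * a) * dR a v p + - - dI a v p - - - dI (- a) v p - exp (- (PI * a)) * dR (- a) v p) by ring.
  apply (is_derive_ext (fun p => exp (PI * a) * cI a v p + - cR a v p - - cR (- a) v p - exp (- (PI * a)) * cI (- a) v p)).
  { intros t. match goal with |- @eq _ ?x ?y => change (@eq R x y) end. ring. }
  apply (is_derive_comb4 (fun p => cI a v p) (fun p => - cR a v p) (fun p => - cR (- a) v p) (fun p => cI (- a) v p)); auto.
  - apply (is_derive_opp (fun p => cR a v p)), H1.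
  - apply (is_derive_opp (fun p => cR (- a) v p)), H3.
Qed.

Lemma continuity_2d_dG (a v p : R) : 0 < chX v p -> continuity_2d_pt (dG a) v p.
Proof.
  intros H. destruct (continuity_2d_ch v p H) as [CM [CA [CP CQ]]].
  unfold dG, dR, dI. c2d; auto; auto_derive; auto.
Qed.

Lemma continuous_cG (a v p : R) : 0 < chX v p -> continuous (cG a v) p.
Proof.
  intros H. destruct (cauchy_riemann a v p H) as [_ [H1 H2]].
  destruct (cauchy_riemann (- a) v p H) as [_ [H3 H4]].
  unfold cG. eapply is_derive_continuous. apply is_derive_comb4; eassumption.
Qed.

Lemma continuous_dG (a v p : R) : 0 < chX v p -> continuous (dG a v) p.
Proof.
  intros H. assert (H2 := proj1 (continuity_2d_pt_filterlim _ _ _) (continuity_2d_dG a v p H)).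
  apply (filterlim_comp _ _ _ (fun p => (v, p)) (fun z => dG a (fst z) (snd z)) _ (locally (v, p))); auto.
  intros P [e He]. exists e. intros y Hy. apply He. split; [apply ball_center | exact Hy].
Qed.

Lemma chX_pos_locally_2d (v p : R) : 0 < chX v p -> locally_2d (fun v p => 0 < chX v p) v p.
Proof.
  intros H. assert (CX : continuity_2d_pt chX v p) by (unfold chX; c2d; auto_derive; auto).
  destruct (CX (mkposreal _ H)) as [d Hd]. exists d. intros v' p' Hv Hp.
  specialize (Hd v' p' Hv Hp). simpl in Hd. apply Rabs_lt_between' in Hd. lra.
Qed.

(** Cauchy's theorem in differential form: [dG] is the v-derivative of [cG] and the p-derivative of
    [cT], so differentiating under the integral sign leaves only the values of [cT] at the ends. *)
Lemma is_derive_int_cG (a v p1 : R) : 0 <= p1 ->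
  locally v (fun u => forall p, 0 <= p <= p1 -> 0 < chX u p) ->
  is_derive (fun v => RInt (cG a v) 0 p1) v (cT a v p1 - cT a v 0).
Proof.
  intros Hp1 HD.
  assert (HDv := locally_singleton _ _ HD). simpl in HDv.
  replace (cT a v p1 - cT a v 0) with (RInt (dG a v) 0 p1).
  - apply (is_derive_RInt_param_dom (fun v p => 0 < chX v p)); auto.
    + intros; now apply is_derive_cG.
    + intros; now apply continuity_2d_dG.
    + intros; now apply continuous_cG.
    + intros; apply chX_pos_locally_2d; auto.
  - apply is_RInt_unique. apply (is_RInt_derive (cT a v) (dG a v));
      rewrite Rmin_left, Rmax_right by auto; intros; [apply is_derive_cT | apply continuous_dG]; auto.
Qed.

Lemma chX_pos_right (v p : R) : 0 < v -> 0 < chX v p.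
Proof.
  intros H. unfold chX. assert (1 < exp (2 * v)) by (rewrite <- exp_0; apply exp_increasing; lra).
  generalize (Rle_0_sqr (cos p)). unfold Rsqr. lra.
Qed.

(** At p = 0 the mirror point is v + i pi, where the function f of the folding is -i e^(-pi a) f(v).
    The difference of the two edges carries the factor (e^(pi a) - i)(1 + i e^(-pi a)) = 2 cosh(pi
    a), and sqrt 2 [hker 0 v] is (cosh v)^(-1/2). *)
Lemma cT_0 (a v : R) : cT a v 0 = 2 * cosh (PI * a) * (sqrt 2 * (sin (a * v) * hker 0 v)).
Proof.
  unfold cT, cR, cI.
  assert (A0 : chA v 0 = 0).
  { unfold chA, chY. rewrite sin_0. replace (2 * (0 * cos 0) / chX v 0) with 0 by (unfold Rdiv; ring).
    rewrite atan_0. field. }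
  rewrite A0. replace (- a * v - 0) with (- (a * v)) by ring. rewrite Rminus_0_r, cos_neg, sin_neg.
  replace (- a * 0 - chM v 0) with (- chM v 0) by ring. replace (- - a * 0 - chM v 0) with (- chM v 0) by ring.
  assert (E : exp (- chM v 0) = sqrt 2 * hker 0 v).
  { assert (Ps : 0 < sqrt 2) by (apply sqrt_lt_R0; lra).
    rewrite <- (exp_ln (sqrt 2)) by auto. unfold hker. rewrite <- exp_plus. f_equal.
    unfold chM, chN. rewrite cos_0. simpl INR.
    replace ((exp (2 * v) - 1) * (exp (2 * v) - 1) + 4 * (1 * 1) * exp (2 * v))
      with ((exp (2 * v) * (1 + exp (- 2 * v))) * (exp (2 * v) * (1 + exp (- 2 * v)))).
    - assert (P2 := exp_pos (2 * v)). assert (P3 := exp_pos (- 2 * v)).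
      rewrite !ln_mult by nra. rewrite ln_exp.
      assert (L2 : ln 2 = ln (sqrt 2) + ln (sqrt 2)) by (rewrite <- ln_mult by auto; rewrite sqrt_sqrt; lra).
      rewrite L2. field.
    - replace (exp (2 * v) * (1 + exp (- 2 * v))) with (exp (2 * v) + 1); [ring |].
      rewrite Rmult_plus_distr_l, <- exp_plus. replace (2 * v + - 2 * v) with 0 by ring. rewrite exp_0. ring. }
  rewrite E. unfold cosh. field.
Qed.

(** The line p = pi/2 is fixed by the reflection, and [cT] is a difference of imaginary parts at a
    point and its mirror image. *)
Lemma cT_PI2 (a v : R) : cT a v (PI / 2) = 0.
Proof.
  unfold cT, cR, cI.
  assert (A0 : chA v (PI / 2) = PI / 4).
  { unfold chA, chY. rewrite cos_PI2. replace (2 * (sin (PI / 2) * 0) / chX v (PI / 2)) with 0 by (unfold Rdiv; ring).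
    rewrite atan_0. field. }
  rewrite A0. set (t := a * v - PI / 4).
  replace (- a * v - PI / 4) with (- (PI / 2 + t)) by (unfold t; field).
  rewrite cos_neg, sin_neg.
  replace (cos (PI / 2 + t)) with (- sin t) by (symmetry; rewrite Rplus_comm; rewrite cos_plus, cos_PI2, sin_PI2; ring).
  replace (sin (PI / 2 + t)) with (cos t) by (rewrite sin_plus, cos_PI2, sin_PI2; ring).
  set (m := chM v (PI / 2)).
  replace (- a * (PI / 2) - m) with (- (PI * a / 2) + - m) by field.
  replace (- - a * (PI / 2) - m) with (PI * a / 2 + - m) by field.
  rewrite !exp_plus.
  replace (exp (PI * a)) with (exp (PI * a / 2) * exp (PI * a / 2)) by (rewrite <- exp_plus; f_equal; field).
  replace (exp (- (PI * a))) with (exp (- (PI * a / 2)) * exp (- (PI * a / 2))) by (rewrite <- exp_plus; f_equal; field).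
  assert (E : exp (PI * a / 2) * exp (- (PI * a / 2)) = 1) by (rewrite <- exp_plus, Rplus_opp_r; apply exp_0).
  set (e := exp (PI * a / 2)) in *. set (e' := exp (- (PI * a / 2))) in *. set (k := exp (- m)).
  transitivity (k * sin t * e * (e * e' - 1) + k * cos t * e' * (e * e' - 1)); [ring |]. rewrite E. ring.
Qed.

(** * Estimates of the integrand and the passage to v = 0 *)

Definition cG_bound (a : R) : R :=
  (exp (PI * a) + 2 + exp (- (PI * a))) * exp (Rabs a * (PI / 2)).

Lemma cG_abs_le (a v p : R) : 0 <= p <= PI / 2 -> Rabs (cG a v p) <= cG_bound a * exp (- chM v p).
Proof.
  intros Hp.
  assert (B : forall b, Rabs b = Rabs a -> exp (- b * p - chM v p) <= exp (Rabs a * (PI / 2)) * exp (- chM v p)).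
  { intros b Hb. rewrite <- exp_plus. apply exp_le_compat.
    assert (- b * p <= Rabs a * (PI / 2)); [| lra].
    rewrite <- Hb. generalize (Rle_abs (- b)) (Rabs_pos b); rewrite Rabs_Ropp; intros. nra. }
  assert (Bc : forall b t, Rabs b = Rabs a -> Rabs (exp (- b * p - chM v p) * cos t) <= exp (Rabs a * (PI / 2)) * exp (- chM v p)).
  { intros b t Hb. rewrite Rabs_mult, (Rabs_pos_eq (exp (- b * p - chM v p))) by apply Rlt_le, exp_pos.
    assert (Rabs (cos t) <= 1) by (apply Rabs_le, COS_bound).
    generalize (B b Hb) (exp_pos (- b * p - chM v p)) (Rabs_pos (cos t)); intros. nra. }
  assert (Bs : forall b t, Rabs b = Rabs a -> Rabs (exp (- b * p - chM v p) * sin t) <= exp (Rabs a * (PI / 2)) * exp (- chM v p)).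
  { intros b t Hb. rewrite Rabs_mult, (Rabs_pos_eq (exp (- b * p - chM v p))) by apply Rlt_le, exp_pos.
    assert (Rabs (sin t) <= 1) by (apply Rabs_le, SIN_bound).
    generalize (B b Hb) (exp_pos (- b * p - chM v p)) (Rabs_pos (sin t)); intros. nra. }
  unfold cG, cR, cI, cG_bound.
  assert (H1 := Bc a (a * v - chA v p) eq_refl). assert (H2 := Bs a (a * v - chA v p) eq_refl).
  assert (H3 := Bs (- a) (- a * v - chA v p) (Rabs_Ropp a)). assert (H4 := Bc (- a) (- a * v - chA v p) (Rabs_Ropp a)).
  set (x1 := exp (- a * p - chM v p) * cos (a * v - chA v p)) in *.
  set (x2 := exp (- a * p - chM v p) * sin (a * v - chA v p)) in *.
  set (x3 := exp (- - a * p - chM v p) * sin (- a * v - chA v p)) in *.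
  set (x4 := exp (- - a * p - chM v p) * cos (- a * v - chA v p)) in *.
  set (K := exp (Rabs a * (PI / 2)) * exp (- chM v p)) in *.
  replace ((exp (PI * a) + 2 + exp (- (PI * a))) * exp (Rabs a * (PI / 2)) * exp (- chM v p))
    with (exp (PI * a) * K + 2 * K + exp (- (PI * a)) * K) by (unfold K; ring).
  apply Rabs_le_between in H1, H2, H3, H4.
  generalize (exp_pos (PI * a)) (exp_pos (- (PI * a))); intros.
  apply Rabs_le_between. split; nra.
Qed.

(** [exp (- chM v p)] is |cosh z|^(-1/2), and |cosh z|^2 = cos(p)^2 + sinh(v)^2 >= cos(p)^2. *)
Lemma chM_ge_cos (v p : R) : 0 < cos p -> exp (- chM v p) <= exp (- (ln (cos p) / 2)).
Proof.
  intros Hc. apply exp_le_compat. unfold chM.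
  assert (P := exp_pos (2 * v)).
  assert (H : ln (2 * cos p * (2 * cos p) * exp (2 * v)) <= ln (chN v p)).
  { apply Rcomplements.ln_le; [apply Rmult_lt_0_compat; auto; nra |].
    unfold chN. generalize (Rle_0_sqr (exp (2 * v) - 1)). unfold Rsqr. lra. }
  rewrite !ln_mult, ln_exp in H by nra. lra.
Qed.

Lemma chM_ge_large (v p : R) : 1 <= v -> exp (- chM v p) <= 2 * exp (- (v / 2)).
Proof.
  intros Hv. rewrite <- (exp_ln 2) at 1 by lra. rewrite <- exp_plus. apply exp_le_compat. unfold chM.
  assert (P : 2 <= exp (2 * v)) by (generalize (exp_ineq1_le (2 * v)); lra).
  assert (H : ln (exp (2 * v) / 2 * (exp (2 * v) / 2)) <= ln (chN v p)).
  { apply Rcomplements.ln_le; [nra |].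
    unfold chN. generalize (Rle_0_sqr (cos p)). unfold Rsqr. intros.
    assert (0 <= 4 * (cos p * cos p) * exp (2 * v)) by (apply Rmult_le_pos; lra). nra. }
  unfold Rdiv in H. rewrite !ln_mult, ln_exp, ln_Rinv in H by lra. lra.
Qed.

Lemma chM_0 (p : R) : 0 < cos p -> chM 0 p = ln (cos p) / 2.
Proof.
  intros Hc. unfold chM, chN. rewrite Rmult_0_r, exp_0.
  replace ((1 - 1) * (1 - 1) + 4 * (cos p * cos p) * 1) with ((2 * cos p) * (2 * cos p)) by ring.
  rewrite !ln_mult by lra. field.
Qed.

Lemma cG_0 (a p : R) : 0 <= p < PI / 2 ->
  cG a 0 p = exp (PI * a) * exp (- a * p - ln (cos p) / 2) - exp (- (PI * a)) * exp (a * p - ln (cos p) / 2).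
Proof.
  intros Hp. assert (Hc : 0 < cos p) by (apply cos_gt_0; lra).
  assert (A0 : chA 0 p = 0).
  { unfold chA, chY, chX. rewrite Rmult_0_r, exp_0.
    replace (2 * (sin p * cos p) / (1 - 1 + 2 * (cos p * cos p))) with (tan p) by (unfold tan; field; lra).
    rewrite atan_tan by lra. field. }
  unfold cG, cR, cI. rewrite A0, chM_0, !Rmult_0_r, Rminus_0_r, cos_0, sin_0 by auto.
  rewrite Ropp_involutive. ring.
Qed.

(** On the imaginary axis cosh(ip) = cos p is real, so the imaginary parts drop out of [cG]. The
    substitution p = atan s then turns (cos p)^(-1/2) dp into (1 + s^2)^(-3/4) ds. *)
Lemma int_cG_0 (a S : R) : 0 < S ->
  RInt (cG a 0) 0 (atan S) =
  exp (PI * a) * RInt (kern (3 / 4) (- a)) 0 S - exp (- (PI * a)) * RInt (kern (3 / 4) a) 0 S.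
Proof.
  intros HS.
  assert (At : forall s, 0 <= s -> 0 <= atan s < PI / 2).
  { intros s [Hs | <-]; split; try (apply atan_bound).
    - rewrite <- atan_0. apply Rlt_le, atan_increasing; auto.
    - rewrite atan_0; lra.  }
  assert (H := RInt_comp (V := R_CompleteNormedModule) (cG a 0) atan (fun s => / (1 + s ^ 2)) 0 S).
  rewrite atan_0 in H. rewrite <- H.
  - symmetry.
    transitivity (RInt (fun s => exp (PI * a) * kern (3 / 4) (- a) s + (- exp (- (PI * a))) * kern (3 / 4) a s) 0 S).
    + symmetry. apply is_RInt_unique.
      replace (exp (PI * a) * RInt (kern (3 / 4) (- a)) 0 S - exp (- (PI * a)) * RInt (kern (3 / 4) a) 0 S)
        with (exp (PI * a) * RInt (kern (3 / 4) (- a)) 0 S + (- exp (- (PI * a))) * RInt (kern (3 / 4) a) 0 S) by ring.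
      apply (is_RInt_plus (V := R_NormedModule)); apply (is_RInt_scal (V := R_NormedModule));
        apply (RInt_correct (V := R_CompleteNormedModule)), ex_RInt_cont, continuous_kern.
    + apply RInt_ext. rewrite Rmin_left, Rmax_right by lra. intros s Hs.
      change (exp (PI * a) * kern (3 / 4) (- a) s + (- exp (- (PI * a))) * kern (3 / 4) a s
        = / (1 + s ^ 2) * cG a 0 (atan s)).
      rewrite cG_0 by (apply At; lra).
      assert (P := one_plus_sqr_pos s).
      assert (Ps : 0 < sqrt (1 + s ^ 2)) by now apply sqrt_lt_R0.
      assert (Lc : ln (cos (atan s)) = - (ln (1 + s ^ 2) / 2)).
      { rewrite cos_atan. unfold Rdiv at 1. rewrite Rmult_1_l, Rsqr_pow2, ln_Rinv by auto.
        rewrite <- (sqrt_sqrt (1 + s ^ 2)) at 2 by lra. rewrite ln_mult by auto. field. }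
      rewrite Lc.
      assert (Ek : forall b, kern (3 / 4) b s = / (1 + s ^ 2) * exp (b * atan s - - (ln (1 + s ^ 2) / 2) / 2)).
      { intros b. rewrite <- (exp_ln (1 + s ^ 2)) at 1 by auto. rewrite <- exp_Ropp, <- exp_plus.
        unfold kern. f_equal. field. }
      rewrite !Ek. ring.
  - rewrite Rmin_left, Rmax_right by lra. intros s Hs. apply continuous_cG.
    destruct (At s ltac:(lra)) as [A1 A2].
    assert (Hc : 0 < cos (atan s)) by (apply cos_gt_0; lra).
    unfold chX. rewrite Rmult_0_r, exp_0. nra.
  - rewrite Rmin_left, Rmax_right by lra. intros s Hs. assert (P := one_plus_sqr_pos s). split.
    + auto_derive; auto. simpl in *; field; lra.
    + cont_by_derive. simpl in *; lra.
Qed.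

(** The bound must be uniform in v, since the integrand becomes singular at p = pi/2 as v -> 0. The
    derivative of -cos p |cosh z|^(-1/2) is |cosh z|^(-1/2) (sin p - cos p [chQ]). Since cos p [chQ]
    <= sin(p)/2 and sin p >= 1/2 from pi/6 on, it is at least a quarter of the integrand. *)
Lemma int_exp_chM_tail (v p1 : R) : 0 < v -> PI / 6 <= p1 < PI / 2 ->
  RInt (fun p => exp (- chM v p)) p1 (PI / 2) <= 4 * exp (ln (cos p1) / 2).
Proof.
  intros Hv Hp. assert (HPI := PI_RGT_0).
  assert (Hc1 : 0 < cos p1) by (apply cos_gt_0; lra).
  assert (HX : forall p, 0 < chX v p) by (intros; now apply chX_pos_right).
  assert (HM : forall p, is_derive (fun p => chM v p) p (- chQ v p)) by (intros; now apply is_derive_chM_p).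
  assert (CM : forall p, continuous (fun p => exp (- chM v p)) p).
  { intros p. apply (ex_derive_continuous (V := R_NormedModule)). auto_derive. exists (- chQ v p); apply HM. }
  set (F := fun p => - cos p * exp (- chM v p)).
  set (F' := fun p => exp (- chM v p) * (sin p - cos p * chQ v p)).
  assert (HF : forall p, is_derive F p (F' p)).
  { intros p. unfold F, F'. auto_derive; [exists (- chQ v p); apply HM |].
    replace (Derive (fun p => chM v p) p) with (- chQ v p) by (symmetry; apply is_derive_unique, HM). ring. }
  assert (CF : forall p, continuous F' p).
  { intros p. apply (continuous_mult (fun p => exp (- chM v p)) (fun p => sin p - cos p * chQ v p)); auto.
    assert (HN := chN_pos v p (HX p)). unfold chQ, chY. cont_by_derive.
    repeat split; auto.
    - unfold chN. auto_derive; auto.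
    - lra. }
  assert (HI := is_RInt_FTC F F' p1 (PI / 2) HF CF).
  apply Rle_trans with (4 * RInt F' p1 (PI / 2)).
  - replace (4 * RInt F' p1 (PI / 2)) with (RInt (fun p => scal 4 (F' p)) p1 (PI / 2))
      by (apply (RInt_scal (V := R_CompleteNormedModule)), ex_RInt_cont, CF).
    apply RInt_le; [lra | apply ex_RInt_cont, CM | |].
    + apply ex_RInt_cont. intros p. apply (continuous_scal_r (V := R_NormedModule)), CF.
    + intros p Hp'. change (exp (- chM v p) <= 4 * F' p). unfold F'.
      assert (Hs : 1 / 2 <= sin p) by (rewrite <- sin_PI6; apply sin_incr_1; lra).
      assert (HN := chN_pos v p (HX p)).
      assert (Q : cos p * chQ v p <= sin p / 2).
      { unfold chQ, chY. apply Rmult_le_reg_r with (chN v p); auto.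
        replace (cos p * (exp (2 * v) * (2 * (sin p * cos p)) / chN v p) * chN v p)
          with (sin p / 2 * (4 * (cos p * cos p) * exp (2 * v))) by (field; lra).
        apply Rmult_le_compat_l; [lra |]. unfold chN. generalize (Rle_0_sqr (exp (2 * v) - 1)). unfold Rsqr. lra. }
      generalize (exp_pos (- chM v p)); intros. nra.
  - rewrite HI. unfold F. rewrite cos_PI2.
    replace (- 0 * exp (- chM v (PI / 2)) - - cos p1 * exp (- chM v p1)) with (cos p1 * exp (- chM v p1)) by ring.
    apply Rmult_le_compat_l; [lra |].
    apply Rle_trans with (cos p1 * exp (- (ln (cos p1) / 2))).
    + apply Rmult_le_compat_l; [lra |]. now apply chM_ge_cos.
    + right. rewrite <- (exp_ln (cos p1)) at 1 by auto. rewrite <- exp_plus. f_equal. field.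
Qed.

Lemma ex_RInt_cG (a v b c : R) : 0 < v -> ex_RInt (cG a v) b c.
Proof. intros Hv. apply ex_RInt_cont. intros p. now apply continuous_cG, chX_pos_right. Qed.

Lemma is_lim_int_cG (a : R) : is_lim (fun v => RInt (cG a v) 0 (PI / 2)) p_infty 0.
Proof.
  assert (HPI := PI_RGT_0).
  apply (is_lim_p_infty_abs _ _ (fun v => (PI / 2 * (cG_bound a * 2)) * exp (- (v / 2)))).
  - apply is_lim_eq with ((PI / 2 * (cG_bound a * 2)) * 0); [| ring].
    apply (is_lim_scal_l (fun v => exp (- (v / 2))) _ p_infty 0).
    apply (is_lim_comp exp (fun v => - (v / 2)) p_infty 0 m_infty).
    + apply is_lim_exp_m.
    + apply is_lim_spec. intros M. exists (2 * Rabs M). intros v Hv.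
      generalize (Rle_abs (- M)); rewrite Rabs_Ropp; lra.
    + exists 0; intros; discriminate.
  - exists 1. intros v Hv. rewrite Rminus_0_r.
    replace ((PI / 2 * (cG_bound a * 2)) * exp (- (v / 2))) with ((PI / 2 - 0) * (cG_bound a * (2 * exp (- (v / 2))))) by ring.
    apply abs_RInt_le_const; [lra | apply ex_RInt_cG; lra |].
    intros p Hp. apply Rle_trans with (1 := cG_abs_le a v p Hp).
    apply Rmult_le_compat_l; [| apply chM_ge_large; lra].
    unfold cG_bound. generalize (exp_pos (PI * a)) (exp_pos (- (PI * a))) (exp_pos (Rabs a * (PI / 2))); intros. nra.
Qed.

(** The v-derivative of the left side comes from the real edge alone, as [cT] vanishes at pi/2. It
    is integrated from v to infinity, where the vertical integral tends to 0. *)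
Lemma int_cG_eq (a v : R) : 0 < v ->
  RInt (cG a v) 0 (PI / 2) =
  2 * cosh (PI * a) * (sqrt 2 * (sinI a 0 - RInt (fun t => sin (a * t) * hker 0 t) 0 v)).
Proof.
  intros Hv. assert (HPI := PI_RGT_0).
  set (k := 2 * cosh (PI * a) * sqrt 2). set (f := fun t => sin (a * t) * hker 0 t).
  assert (Cf : forall t, continuous f t).
  { intros t. apply (continuous_mult (fun v => sin (a * v)) (hker 0)); [cont_by_derive; auto | apply continuous_hker]. }
  set (H := (fun v => RInt (cG a v) 0 (PI / 2)) : R -> R).
  assert (dH : forall u, 0 < u -> is_derive H u (- (k * f u))).
  { intros u Hu. replace (- (k * f u)) with (cT a u (PI / 2) - cT a u 0) by (rewrite cT_PI2, cT_0; unfold k, f; ring).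
    apply is_derive_int_cG; [lra |].
    assert (Hu' : locally u (fun u => 0 < u)) by (apply (open_gt 0 u Hu)).
    revert Hu'; apply filter_imp. intros w Hw p _. now apply chX_pos_right. }
  assert (E : forall b, v < b -> H b - H v = - k * (RInt f 0 b - RInt f 0 v)).
  { intros b Hb. rewrite (RInt_0_Chasles f v b Cf).
    assert (Hr : forall x y : R, x + y - x = y) by (intros; ring). rewrite Hr.
    transitivity (RInt (fun u => scal (- k) (f u)) v b).
    - symmetry. apply is_RInt_unique. apply (is_RInt_derive H (fun u => scal (- k) (f u)));
        rewrite Rmin_left, Rmax_right by lra.
      + intros u Hu. replace (scal (- k) (f u)) with (- (k * f u)) by (unfold scal; simpl; unfold mult; simpl; ring).
        apply dH; lra.
      + intros u _. apply (continuous_scal_r (V := R_NormedModule)), Cf.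
    - apply (RInt_scal (V := R_CompleteNormedModule)), ex_RInt_cont, Cf. }
  assert (L : 0 - H v = - k * (sinI a 0 - RInt f 0 v)).
  { apply (is_lim_unique_fin (fun b => H b - H v) p_infty).
    - apply is_lim_minus_fin; [apply is_lim_int_cG | apply is_lim_const].
    - apply (is_lim_ext_loc (fun b => - k * (RInt f 0 b - RInt f 0 v))).
      + exists v. intros b Hb. symmetry; auto.
      + apply (is_lim_scal_l (fun b => RInt f 0 b - RInt f 0 v) (- k) p_infty (sinI a 0 - RInt f 0 v)).
        apply is_lim_minus_fin; [apply (proj1 (sinI_correct a 0)) | apply is_lim_const]. }
  change (H v = 2 * cosh (PI * a) * (sqrt 2 * (sinI a 0 - RInt f 0 v))).
  replace (2 * cosh (PI * a) * (sqrt 2 * (sinI a 0 - RInt f 0 v))) with (k * (sinI a 0 - RInt f 0 v)) by (unfold k; ring).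
  lra.
Qed.

(** With p cut off at atan S, both quantities are continuous in v at 0, while [int_cG_eq] and
    [int_exp_chM_tail] bound their difference for every v > 0. The tail bound is sqrt(cos(atan S)) =
    (1 + S^2)^(-1/4). *)
Lemma contour_estimate (a S : R) : 1 <= S ->
  Rabs (2 * cosh (PI * a) * (sqrt 2 * sinI a 0) - RInt (cG a 0) 0 (atan S)) <= 4 * cG_bound a * kern (1 / 4) 0 S.
Proof.
  intros HS. assert (HPI := PI_RGT_0).
  set (p1 := atan S).
  assert (Hp1 : PI / 6 <= p1 < PI / 2).
  { split; [| apply atan_bound]. apply Rle_trans with (PI / 4); [lra |]. rewrite <- atan_1.
    destruct HS as [HS | <-]; [apply Rlt_le, atan_increasing; auto | apply Rle_refl]. }
  assert (Hc1 : 0 < cos p1) by (apply cos_gt_0; lra).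
  assert (Ec : exp (ln (cos p1) / 2) = kern (1 / 4) 0 S).
  { unfold kern. f_equal. unfold p1.
    assert (P := one_plus_sqr_pos S). assert (Ps : 0 < sqrt (1 + S ^ 2)) by now apply sqrt_lt_R0.
    rewrite cos_atan. unfold Rdiv at 2. rewrite Rmult_1_l, Rsqr_pow2, ln_Rinv by auto.
    rewrite <- (sqrt_sqrt (1 + S ^ 2)) at 2 by lra. rewrite ln_mult by auto. field. }
  assert (HB : 0 <= cG_bound a).
  { unfold cG_bound. generalize (exp_pos (PI * a)) (exp_pos (- (PI * a))) (exp_pos (Rabs a * (PI / 2))); intros. nra. }
  set (f := fun t => sin (a * t) * hker 0 t).
  assert (Cf : forall t, continuous f t).
  { intros t. apply (continuous_mult (fun v => sin (a * v)) (hker 0)); [cont_by_derive; auto | apply continuous_hker]. }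
  set (J := (fun v => 2 * cosh (PI * a) * (sqrt 2 * (sinI a 0 - RInt f 0 v))) : R -> R).
  set (H1 := (fun v => RInt (cG a v) 0 p1) : R -> R).
  assert (Est : forall v, 0 < v -> Rabs (J v - H1 v) <= 4 * cG_bound a * kern (1 / 4) 0 S).
  { intros v Hv. unfold J, H1, f. rewrite <- int_cG_eq by auto.
    replace (RInt (cG a v) 0 (PI / 2) - RInt (cG a v) 0 p1) with (RInt (cG a v) p1 (PI / 2)).
    2:{ assert (HCh := RInt_Chasles (V := R_CompleteNormedModule) (cG a v) 0 p1 (PI / 2)
          (ex_RInt_cG a v _ _ Hv) (ex_RInt_cG a v _ _ Hv)).
        assert (Hr : forall x y : R, y = x + y - x) by (intros; ring). rewrite <- HCh. apply Hr. }
    assert (CM : forall p, continuous (fun p => exp (- chM v p)) p).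
    { intros p. apply (ex_derive_continuous (V := R_NormedModule)). auto_derive.
      eexists; apply is_derive_chM_p. now apply chX_pos_right. }
    apply Rle_trans with (cG_bound a * RInt (fun p => exp (- chM v p)) p1 (PI / 2)).
    - apply (norm_RInt_le (V := R_NormedModule) (cG a v) (fun p => cG_bound a * exp (- chM v p)) p1 (PI / 2)); [lra | | |].
      + intros p Hp. apply cG_abs_le. lra.
      + apply (RInt_correct (V := R_CompleteNormedModule)), ex_RInt_cG, Hv.
      + apply (is_RInt_scal (V := R_NormedModule)).
        apply (RInt_correct (V := R_CompleteNormedModule)), ex_RInt_cont, CM.
    - replace (4 * cG_bound a * kern (1 / 4) 0 S) with (cG_bound a * (4 * kern (1 / 4) 0 S)) by ring.
      apply Rmult_le_compat_l; auto. rewrite <- Ec. now apply int_exp_chM_tail. }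
  assert (CJ : continuous J 0).
  { assert (dI : is_derive (fun v => RInt f 0 v) 0 (f 0)).
    { apply (is_derive_RInt f (fun x => RInt f 0 x) 0 0); auto.
      apply filter_forall; intros b. apply (RInt_correct (V := R_CompleteNormedModule)), ex_RInt_cont, Cf. }
    set (I0 := (fun v => RInt f 0 v) : R -> R) in *.
    change (continuous (fun v => 2 * cosh (PI * a) * (sqrt 2 * (sinI a 0 - I0 v))) 0).
    apply (ex_derive_continuous (V := R_NormedModule)). auto_derive. exists (f 0); exact dI. }
  assert (CH : continuous H1 0).
  { eapply is_derive_continuous. apply is_derive_int_cG; [lra |].
    (* A two-sided neighbourhood of v = 0 contains negative v. There [chX] stays positive because
       cos p >= cos p1 > 0 on the truncated segment. *)
    assert (Hcc : 0 < cos p1 * cos p1) by nra.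
    assert (Hloc : locally 0 (fun u => 1 - 2 * (cos p1 * cos p1) < exp (2 * u))).
    { assert (Ce : continuous (fun u => exp (2 * u)) 0) by (cont_by_derive; auto).
      apply Ce. apply (open_gt (1 - 2 * (cos p1 * cos p1))). rewrite Rmult_0_r, exp_0. lra. }
    revert Hloc; apply filter_imp. intros u Hu p Hp. unfold chX.
    assert (cos p1 <= cos p) by (apply cos_decr_1; lra). nra. }
  assert (C0 : continuous (fun v => Rabs (J v - H1 v)) 0).
  { apply (continuous_comp (fun v => J v - H1 v) Rabs); [| apply continuous_Rabs].
    apply (continuous_minus J H1); auto. }
  replace (2 * cosh (PI * a) * (sqrt 2 * sinI a 0)) with (J 0)
    by (unfold J; rewrite RInt_point; unfold zero; simpl; ring).
  change (Rabs (J 0 - H1 0) <= 4 * cG_bound a * kern (1 / 4) 0 S).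
  (* A failure at v = 0 would persist by continuity for some v = d/2 > 0, against [Est]. *)
  apply Rnot_lt_le; intros Hlt.
  assert (Hloc := C0 _ (open_gt (4 * cG_bound a * kern (1 / 4) 0 S) _ Hlt)).
  destruct Hloc as [d Hd].
  assert (Hd2 := Est (d / 2) ltac:(destruct d; simpl; lra)).
  apply (Rlt_irrefl (4 * cG_bound a * kern (1 / 4) 0 S)). apply Rlt_le_trans with (2 := Hd2).
  apply (Hd (d / 2)). change (Rabs (d / 2 - 0) < d). rewrite Rminus_0_r, Rabs_pos_eq; destruct d; simpl; lra.
Qed.

Lemma contour_identity (a : R) :
  exp (PI * a) * Kint (3 / 4) (- a) - exp (- (PI * a)) * Kint (3 / 4) a = 2 * cosh (PI * a) * (2 * Yfun a).
Proof.
  rewrite Yfun_sinI.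
  apply (is_lim_unique_fin (fun S => exp (PI * a) * RInt (kern (3 / 4) (- a)) 0 S
    + (- exp (- (PI * a))) * RInt (kern (3 / 4) a) 0 S) p_infty).
  - apply is_lim_eq with (exp (PI * a) * Kint (3 / 4) (- a) + (- exp (- (PI * a))) * Kint (3 / 4) a); [| ring].
    apply is_lim_lin; apply (Kint_correct (3 / 4)); lra.
  - apply (is_lim_p_infty_abs _ _ (fun S => 4 * cG_bound a * kern (1 / 4) 0 S)).
    + apply is_lim_eq with (4 * cG_bound a * 0); [| ring].
      apply (is_lim_scal_l (kern (1 / 4) 0) _ p_infty 0). apply is_lim_kern_0; lra.
    + exists 1. intros S HS. rewrite Rabs_minus_sym.
      apply Rle_trans with (2 := contour_estimate a S (Rlt_le _ _ HS)). right. f_equal.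
      rewrite int_cG_0 by lra. ring.
Qed.

(** * Values of the connection coefficients *)

Lemma cosh_pos (x : R) : 0 < cosh x.
Proof. unfold cosh. generalize (exp_pos x) (exp_pos (- x)); lra. Qed.

(** Evenness is read off the closed form of the fourth power, since [Bint] and cosh are even in a.
    No conjugation symmetry of [CGamma] is involved. *)
Lemma W0_even (a : R) : W0 (- a) = W0 a.
Proof.
  destruct (W0_values a) as [_ [P1 E1]]. destruct (W0_values (- a)) as [_ [P2 E2]].
  replace (Bint (3 / 4) (- a)) with (Bint (3 / 4) a) in E2 by (unfold Bint; rewrite Ropp_involutive; field).
  replace (cosh (PI * - a)) with (cosh (PI * a)) in E2.
  2:{ unfold cosh. replace (PI * - a) with (- (PI * a)) by ring. rewrite Ropp_involutive. field. }
  assert (Hc := cosh_pos (PI * a)). assert (HPI := PI_RGT_0).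
  assert (E : W0 (- a) ^ 4 = W0 a ^ 4).
  { apply Rmult_eq_reg_r with (2 * PI * cosh (PI * a)); [congruence |].
    apply Rgt_not_eq, Rmult_lt_0_compat; lra. }
  assert (Sq : forall u v, 0 < u -> 0 < v -> u ^ 2 = v ^ 2 -> u = v).
  { intros u v Hu Hv H. apply Rsqr_inj; try lra. now rewrite !Rsqr_pow2. }
  apply Sq; auto. apply Sq; try now apply pow_lt. rewrite <- !pow_mult. exact E.
Qed.

(** Replacing a by -a changes the sign of the left side of [contour_identity] and fixes the factor
    cosh(pi a). *)
Lemma Yfun_odd (a : R) : Yfun (- a) = - Yfun a.
Proof.
  assert (H1 := contour_identity a). assert (H2 := contour_identity (- a)).
  assert (Ec : cosh (PI * - a) = cosh (PI * a)).
  { unfold cosh. replace (PI * - a) with (- (PI * a)) by ring. rewrite Ropp_involutive. field. }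
  rewrite Ec, Ropp_involutive in H2.
  replace (PI * - a) with (- (PI * a)) in H2 by ring. rewrite Ropp_involutive in H2.
  assert (Hc := cosh_pos (PI * a)).
  apply Rmult_eq_reg_l with (2 * cosh (PI * a) * 2); [| lra]. lra.
Qed.

(** A linear system for K(a) and K(-a): half their sum is W(a,0)^2 sqrt(pi) e^(pi a/2) s with s =
    sqrt(1 + e^(-2 pi a)), the positive root of the identity in [W0_values], and [contour_identity]
    gives K(-a) = e^(-2 pi a) K(a) + 2 s^2 Y(a). Adding K(a) makes s^2 (K(a) + 2 Y(a)) equal to
    twice the half-sum. *)
Lemma Kint_value (a : R) :
  Kint (3 / 4) a = 2 * W0 a ^ 2 * sqrt PI * exp (PI * a / 2) / sqrt (1 + exp (- 2 * PI * a)) - 2 * Yfun a.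
Proof.
  destruct (W0_values a) as [_ [Pw Ew]]. assert (D := contour_identity a).
  assert (HB := Bint_pos (3 / 4) a ltac:(lra)).
  set (x := exp (PI * a / 2)). set (x' := exp (- (PI * a / 2))).
  assert (Hx : 0 < x) by apply exp_pos.
  assert (xx : x * x' = 1) by (unfold x, x'; rewrite <- exp_plus, Rplus_opp_r; apply exp_0).
  assert (E1 : exp (PI * a) = x * x) by (unfold x; rewrite <- exp_plus; f_equal; field).
  assert (E2 : exp (- (PI * a)) = x' * x') by (unfold x'; rewrite <- exp_plus; f_equal; field).
  assert (E3 : exp (- 2 * PI * a) = x' * x' * (x' * x')) by (rewrite <- E2, <- exp_plus; f_equal; ring).
  set (s := sqrt (1 + exp (- 2 * PI * a))).
  assert (Ps : 0 < s) by (apply sqrt_lt_R0; generalize (exp_pos (- 2 * PI * a)); lra).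
  assert (ss : s * s = 1 + x' * x' * (x' * x')).
  { unfold s. rewrite sqrt_sqrt; [now rewrite E3 | generalize (exp_pos (- 2 * PI * a)); lra]. }
  assert (HPI := PI_RGT_0). assert (Pp : 0 < sqrt PI) by now apply sqrt_lt_R0.
  assert (pp : sqrt PI * sqrt PI = PI) by (apply sqrt_sqrt; lra).
  assert (Ch : 2 * cosh (PI * a) = x * x * (s * s)).
  { unfold cosh. rewrite E1, E2, ss.
    transitivity (x * x + (x * x') * (x * x') * (x' * x')); [rewrite xx; field | ring]. }
  assert (EB : Bint (3 / 4) a = W0 a ^ 2 * (sqrt PI * (x * s))).
  { apply Rsqr_inj.
    - lra.
    - apply Rmult_le_pos; [apply pow2_ge_0 |]. apply Rmult_le_pos; [lra | nra].
    - rewrite !Rsqr_pow2, <- Ew.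
      replace (2 * PI * cosh (PI * a)) with (PI * (2 * cosh (PI * a))) by ring. rewrite Ch, <- pp at 1. ring. }
  unfold Bint in EB. rewrite E1, E2, Ch in D.
  set (K := Kint (3 / 4) a) in *. set (K' := Kint (3 / 4) (- a)) in *.
  assert (HK' : K' = x' * x' * (x' * x') * K + s * s * (2 * Yfun a)).
  { transitivity ((x * x') * (x * x') * K'); [rewrite xx; ring |].
    transitivity (x' * x' * (x * x * K' - x' * x' * K) + x' * x' * (x' * x') * K); [ring |].
    rewrite D. transitivity ((x * x') * (x * x') * (s * s) * (2 * Yfun a) + x' * x' * (x' * x') * K); [ring |].
    rewrite xx. ring. }
  assert (HS : s * s * (K + 2 * Yfun a) = 2 * W0 a ^ 2 * sqrt PI * x * s).
  { rewrite ss at 1. rewrite HK', ss in EB. lra. }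
  apply Rmult_eq_reg_l with (s * s); [| nra].
  transitivity (2 * W0 a ^ 2 * sqrt PI * x * s - s * s * (2 * Yfun a)); [rewrite <- HS; ring | field; lra].
Qed.

Theorem theorem2p7 (W : R -> R -> R) (HW : is_Weber_W W) (a : R) (ha : 0 <= a) :
  c0p W a =
    W a 0 * (sqrt PI * exp (PI * a / 2) * (1 + / sqrt (1 + exp (- 2 * PI * a)))
             - 4 * Yfun a * (Derive (W a) 0) ^ 2)
  /\
  c0m W a =
    - W a 0 * (4 * Yfun a * (Derive (W a) 0) ^ 2
               + sqrt PI * exp (- 3 * PI * a / 2)
                 / (1 + exp (- 2 * PI * a) + sqrt (1 + exp (- 2 * PI * a))))
  /\
  c0p W (- a) =
    W a 0 * (4 * Yfun a * (Derive (W a) 0) ^ 2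
             + sqrt PI * exp (- PI * a / 2) * (1 + / sqrt (1 + exp (2 * PI * a))))
  /\
  c0m W (- a) =
    W a 0 * (4 * Yfun a * (Derive (W a) 0) ^ 2
             - sqrt PI * exp (- PI * a / 2) * (1 - / sqrt (1 + exp (2 * PI * a)))).
Proof.
  destruct HW as [Hd [Hd2 [HW0 HW1]]].
  destruct (W0_values a) as [w1 [w2 _]]. destruct (W0_values (- a)) as [w1' _].
  assert (Wr : forall b, W b 0 * Derive (W b) 0 = - 1 / 2).
  { intros b. rewrite HW0, HW1. apply (proj1 (W0_values b)). }
  assert (HW : is_Weber_W W) by (unfold is_Weber_W; auto).
  destruct (weber_connection W a _ HW (Kint_correct (3 / 4) a ltac:(lra)) (Wr a)) as [-> ->].
  destruct (weber_connection W (- a) _ HW (Kint_correct (3 / 4) (- a) ltac:(lra)) (Wr (- a))) as [-> ->].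
  rewrite !HW0, !HW1, !Kint_value, Yfun_odd, W0_even in *.
  assert (Ed : W0' (- a) = W0' a).
  { apply Rmult_eq_reg_l with (W0 a); [congruence | lra]. }
  rewrite Ed. clear w1' Ed Wr.
  replace (- 2 * PI * - a) with (2 * PI * a) by ring.
  replace (PI * - a / 2) with (- PI * a / 2) by field.
  set (w := W0 a) in *. set (w' := W0' a) in *.
  (* The Wronskian relation makes w the only unknown. The term 2Y(a) of K(a), multiplied by W'(a,0),
     becomes the stated one because 4 w w'^2 = 1/w. *)
  assert (Hw' : w' = - / (2 * w)).
  { apply Rmult_eq_reg_l with w; [| lra]. rewrite w1. field. lra. }
  set (s := sqrt (1 + exp (- 2 * PI * a))). set (t := sqrt (1 + exp (2 * PI * a))).
  assert (Ps : 0 < s) by (apply sqrt_lt_R0; generalize (exp_pos (- 2 * PI * a)); lra).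
  assert (Pt : 0 < t) by (apply sqrt_lt_R0; generalize (exp_pos (2 * PI * a)); lra).
  assert (ss : 1 + exp (- 2 * PI * a) = s * s).
  { unfold s. rewrite sqrt_sqrt; auto. generalize (exp_pos (- 2 * PI * a)); lra. }
  rewrite ss, Hw'.
  (* Since s^2 - 1 = e^(-2 pi a), the fraction with denominator s^2 + s reduces to e^(pi a/2) (1 -
     1/s), which avoids the cancellation between 1 and 1/s for large a. *)
  replace (exp (- 3 * PI * a / 2)) with (exp (PI * a / 2) * (s * s - 1)).
  2:{ rewrite <- ss. replace (1 + exp (- 2 * PI * a) - 1) with (exp (- 2 * PI * a)) by ring.
      rewrite <- exp_plus. f_equal. field. }
  repeat split; field; repeat split; try lra; nra.
Qed.
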